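(* Let $\mathbf{c}=(c_1,\dots,c_n)$ and $\bar{\mathbf{c}}=(\bar c_1,\dots,\bar c_n)$ be weak solutions of the Maxwell--Stefan system on $\mathbb{T}^3\times(0,\infty)$ (with velocities $u_i$ and $\bar u_i$, respectively) emanating from the same initial data, and suppose that $c_iu_i$ and $\bar c_i\bar u_i$ belong to $L^\infty(\mathbb{T}^3\times(0,\infty))$ for all $i=1,\dots,n$. Then $\mathbf{c}=\bar{\mathbf{c}}$.
   Context: $\mathbb{T}^3$ is the 3-dimensional torus, $n\ge 2$, and $D_{ij}=D_{ji}>0$ ($i\neq j$) are given constants. The Maxwell--Stefan system for concentrations $\mathbf{c}=(c_1,\dots,c_n)$ and velocities $u_i(x,t)\in\mathbb{R}^3$, with fluxes $J_i=c_iu_i$, is $$\partial_t c_i+\nabla\cdot(c_iu_i)=0,\qquad i=1,\dots,n,$$ together with the constrained linear system $$-\sum_{j\neq i}\frac{c_jJ_i-c_iJ_j}{D_{ij}}=\nabla c_i\quad (i=1,\dots,n),\qquad \sum_{i=1}^nJ_i=0, \qquad (\ast)$$ and initial conditions $c_i(x,0)=c_i^0(x)$. The initial data always satisfy $0\le c_i^0\in L^\infty(\mathbb{T}^3)$, $\sum_{i=1}^nc_i^0=1$, and $H(\mathbf{c}^0)=\int_{\mathbb{T}^3}\sum_ic_i^0(\ln c_i^0-1)\,dx<+\infty$. Weak solution: $\mathbf{c}$ (with velocities $u_i$) is a weak solution with initial data $\mathbf{c}^0$ if for all $i$: (i) $0\le c_i\le1$ and $\sum_ic_i=1$; (ii)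 $\nabla\sqrt{c_i}\in L^2(\mathbb{T}^3\times(0,T))$ and $\sqrt{c_i}\,u_i\in L^2(\mathbb{T}^3\times(0,T))$ for every $T>0$; (iii) for every $\phi_i\in C_c^\infty(\mathbb{T}^3\times[0,\infty))$, $$\int_{\mathbb{T}^3}c_i^0(x)\phi_i(x,0)\,dx+\int_0^\infty\!\!\int_{\mathbb{T}^3}c_i\,\partial_t\phi_i\,dx\,dt+\int_0^\infty\!\!\int_{\mathbb{T}^3}c_iu_i\cdot\nabla\phi_i\,dx\,dt=0,$$ and $J_i=c_iu_i$ satisfies $(\ast)$; (iv) $\lim_{t\to0}\int_{\mathbb{T}^3}|c_i(x,t)-c_i^0(x)|\,dx=0$. Equality of solutions is understood almost everywhere on $\mathbb{T}^3\times(0,\infty)$. *)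

(* Defs.v *)
From HB Require Import structures.
From mathcomp Require Import all_boot all_order all_algebra.
From mathcomp Require Import all_classical all_reals all_analysis.
From mathcomp Require Import measurable_realfun.

Set Implicit Arguments.
Unset Strict Implicit.
Unset Printing Implicit Defensive.

Import Order.TTheory GRing.Theory Num.Theory.
Import numFieldNormedType.Exports.

Local Open Scope classical_set_scope.
Local Open Scope ring_scope.

(* The torus is T^3 = R^3 / Z^3: functions on T^3 are functions on R^3 that are
   1-periodic in every coordinate, and integrals and almost-everywhere
   statements over T^3 are taken over the fundamental cell [0, 1[^3.
   Points of space-time are pairs p = (x, t). *)

Notation space3 R := (R * R * R)%type.
Notation spacetime R := (R * R * R * R)%type.

(* The same types, with each factor R carrying the Borel structure on which
   lebesgue_measure is defined. *)
Notation mspace3 R :=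
  (measurableTypeR R * measurableTypeR R * measurableTypeR R)%type.
Notation mspacetime R :=
  (measurableTypeR R * measurableTypeR R * measurableTypeR R *
   measurableTypeR R)%type.

Lemma sigma_finite_prod d1 d2 (T1 : measurableType d1) (T2 : measurableType d2)
    (R : realType) (m1 : {sigma_finite_measure set T1 -> \bar R})
    (m2 : {sigma_finite_measure set T2 -> \bar R}) :
  sigma_finite setT (m1 \x m2)%E.
Proof.
have /sigma_finiteP[F [TF ndF Foo]] := sigma_finiteT m1.
have /sigma_finiteP[G [TG ndG Goo]] := sigma_finiteT m2.
exists (fun n => F n `*` G n).
  rewrite -setXTT TF TG predeqE => -[x y]; split.
    move=> [/= [n _ Fnx] [k _ Gky]]; exists (maxn n k) => //; split.
    - by move: x Fnx; exact/subsetPset/ndF/leq_maxl.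
    - by move: y Gky; exact/subsetPset/ndG/leq_maxr.
  by move=> [n _ []/= ? ?]; split; exists n.
move=> k; have [? ?] := Foo k; have [? ?] := Goo k.
split; first exact: measurableX.
by rewrite product_measure1E// lte_mul_pinfty// ge0_fin_numE.
Qed.

(* The sigma-finiteness of products is declared by hand, because the library
   instance is masked by the one for products of subprobabilities. *)
Definition mu_plane (R : realType) :
    set (measurableTypeR R * measurableTypeR R)%type -> \bar R :=
  (@lebesgue_measure R \x @lebesgue_measure R)%E.
Arguments mu_plane R : clear implicits.
HB.instance Definition _ (R : realType) := Measure.on (mu_plane R).
HB.instance Definition _ (R : realType) :=
  Measure_isSigmaFinite.Build _ _ _ (mu_plane R)
    (sigma_finite_prod (@lebesgue_measure R) (@lebesgue_measure R)).

Definition mu_space (R : realType) : set (mspace3 R) -> \bar R :=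
  (mu_plane R \x @lebesgue_measure R)%E.
Arguments mu_space R : clear implicits.
HB.instance Definition _ (R : realType) := Measure.on (mu_space R).
HB.instance Definition _ (R : realType) :=
  Measure_isSigmaFinite.Build _ _ _ (mu_space R)
    (sigma_finite_prod (mu_plane R) (@lebesgue_measure R)).

Definition mu_spacetime (R : realType) : set (mspacetime R) -> \bar R :=
  (mu_space R \x @lebesgue_measure R)%E.
Arguments mu_spacetime R : clear implicits.
HB.instance Definition _ (R : realType) := Measure.on (mu_spacetime R).
HB.instance Definition _ (R : realType) :=
  Measure_isSigmaFinite.Build _ _ _ (mu_spacetime R)
    (sigma_finite_prod (mu_space R) (@lebesgue_measure R)).

Section torus.
Variable R : realType.

Definition cell : set (space3 R) := (`[0, 1[ `*` `[0, 1[) `*` `[0, 1[.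

Definition axis (k : 'I_3) : space3 R :=
  ((k == 0)%:R, (k == 1)%:R, (k == 2)%:R).

Definition Zperiodic (V : Type) (f : space3 R -> V) : Prop :=
  forall (k : 'I_3) (x : space3 R), f (x + axis k) = f x.

(* f is of class C^m: all its iterated directional derivatives of order at
   most m exist and are continuous. *)
Fixpoint Cm (m : nat) (f : spacetime R -> R) : Prop :=
  continuous f /\
  if m is m'.+1 then
    forall v : spacetime R, (forall p, derivable f p v) /\ Cm m' ('D_v f)
  else True.

(* Smooth functions on T^3 x R. Smooth functions on T^3 x [0, oo[ are the
   restrictions of these, so that test functions on T^3 x [0, oo[ may take
   arbitrary values at negative times. *)
Definition smooth (f : spacetime R -> R) : Prop :=
  (forall m, Cm m f) /\ (forall t, Zperiodic (fun x => f (x, t))).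

(* C_c^oo(T^3 x [0, oo[): T^3 being compact, only t has to be bounded on the
   support. *)
Definition test_closed (phi : spacetime R -> R) : Prop :=
  smooth phi /\ exists T : R, forall x t, T <= t -> phi (x, t) = 0.

(* C_c^oo(T^3 x ]0, oo[) *)
Definition test_open (phi : spacetime R -> R) : Prop :=
  smooth phi /\ exists a b : R,
    0 < a /\ forall x t, ~~ (a <= t <= b) -> phi (x, t) = 0.

Definition dt (f : spacetime R -> R) : spacetime R -> R :=
  'D_((0, 1) : spacetime R) f.

Definition dx (k : 'I_3) (f : spacetime R -> R) : spacetime R -> R :=
  'D_((axis k, 0) : spacetime R) f.

Definition cyl (I : set R) : set (spacetime R) := cell `*` I.

(* f \_ E is the extension by zero of the restriction of f to E *)
Definition Lq (E : set (spacetime R)) (q : \bar R) (f : spacetime R -> R) :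
    Prop :=
  f \_ E \in Lfun (mu_spacetime R) q.

Definition Lqv (E : set (spacetime R)) (q : \bar R)
    (f : spacetime R -> 'rV[R]_3) : Prop :=
  forall k, Lq E q (fun p => f p 0 k).

Definition loc_integrable (f : spacetime R -> R) : Prop :=
  forall a b : R, 0 < a -> Lq (cyl `[a, b]) 1%:E f.

(* g is the spatial gradient of f, in the sense of distributions on
   T^3 x ]0, oo[ *)
Definition weak_gradient (f : spacetime R -> R)
    (g : spacetime R -> 'rV[R]_3) : Prop :=
  loc_integrable f /\
  forall k, loc_integrable (fun p => g p 0 k) /\
    forall phi, test_open phi ->
      \int[mu_spacetime R]_(p in cyl `]0, +oo[) (f p * dx k phi p) =
      - \int[mu_spacetime R]_(p in cyl `]0, +oo[) (g p 0 k * phi p).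

Definition ae_cyl (P : spacetime R -> Prop) : Prop :=
  {ae (mu_spacetime R), forall p, cyl `]0, +oo[ p -> P p}.

Section Maxwell_Stefan.
Variable n : nat.

(* The constrained linear system relating, at one point, the concentrations c,
   the fluxes J and the concentration gradients dc. *)
Definition MS_system (D : 'I_n -> 'I_n -> R) (c : 'I_n -> R)
    (J dc : 'I_n -> 'rV[R]_3) : Prop :=
  (forall i, - \sum_(j < n | j != i)
                 (D i j)^-1 *: (c j *: J i - c i *: J j) = dc i) /\
  \sum_(i < n) J i = 0.

Record initial_data (c0 : 'I_n -> space3 R -> R) : Prop := {
  init_periodic : forall i, Zperiodic (c0 i) ;
  init_measurable : forall i, measurable_fun (cell : set (mspace3 R)) (c0 i) ;
  init_ge0 : {ae (mu_space R), forall x, cell x -> forall i, 0 <= c0 i x} ;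
  init_Linfty : forall i, c0 i \_ cell \in Lfun (mu_space R) +oo%E ;
  init_sum : {ae (mu_space R), forall x, cell x -> \sum_(i < n) c0 i x = 1} ;
  (* 0 ln 0 = 0, since ln 0 = 0 *)
  init_entropy : (\int[mu_space R]_(x in cell)
    (\sum_(i < n) c0 i x * (ln (c0 i x) - 1))%:E < +oo)%E }.

Definition flux (c : 'I_n -> spacetime R -> R)
    (u : 'I_n -> spacetime R -> 'rV[R]_3) (i : 'I_n) (p : spacetime R) :
    'rV[R]_3 :=
  c i p *: u i p.

(* The velocity u i is only determined where c i is positive, so that no
   measurability is asked of u i itself, only of sqrt (c i) u i. *)
Record weak_solution (D : 'I_n -> 'I_n -> R) (c0 : 'I_n -> space3 R -> R)
    (c : 'I_n -> spacetime R -> R) (u : 'I_n -> spacetime R -> 'rV[R]_3) :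
    Prop := {
  sol_periodic : forall i (t : R), 0 < t ->
    Zperiodic (fun x => c i (x, t)) /\ Zperiodic (fun x => u i (x, t)) ;
  sol_measurable : forall i,
    measurable_fun (cyl `]0, +oo[ : set (mspacetime R)) (c i) ;
  sol_bounds : ae_cyl (fun p => forall i, 0 <= c i p <= 1) ;
  sol_sum : ae_cyl (fun p => \sum_(i < n) c i p = 1) ;
  sol_grad_sqrt : forall i, exists2 s : spacetime R -> 'rV[R]_3,
    weak_gradient (fun p => Num.sqrt (c i p)) s &
    forall T : R, 0 < T -> Lqv (cyl `]0, T[) 2%:E s ;
  sol_velocity : forall i (T : R), 0 < T ->
    Lqv (cyl `]0, T[) 2%:E (fun p => Num.sqrt (c i p) *: u i p) ;
  sol_mass : forall i phi, test_closed phi ->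
    \int[mu_space R]_(x in cell) (c0 i x * phi (x, 0)) +
    \int[mu_spacetime R]_(p in cyl `]0, +oo[) (c i p * dt phi p) +
    \int[mu_spacetime R]_(p in cyl `]0, +oo[)
      (\sum_(k < 3) flux c u i p 0 k * dx k phi p) = 0 ;
  sol_flux : exists2 dc : 'I_n -> spacetime R -> 'rV[R]_3,
    (forall i, weak_gradient (c i) (dc i)) &
    ae_cyl (fun p => MS_system D (fun i => c i p) (fun i => flux c u i p)
                               (fun i => dc i p)) ;
  sol_initial : forall i,
    (\int[mu_space R]_(x in cell) `|c i (x, t) - c0 i x|%:E)%E
      @[t --> 0^'+] --> 0%E }.

End Maxwell_Stefan.
End torus.

(* Main.v *)
Require Import Defs.
From HB Require Import structures.
From mathcomp Require Import all_boot all_order all_algebra.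
From mathcomp Require Import all_classical all_reals all_analysis.
From mathcomp Require Import measurable_realfun ess_sup_inf.
From mathcomp Require Import ring lra.

Set Implicit Arguments.
Unset Strict Implicit.
Unset Printing Implicit Defensive.

Import Order.TTheory GRing.Theory Num.Theory.
Import numFieldNormedType.Exports.

Local Open Scope classical_set_scope.
Local Open Scope ring_scope.

(** Why the solution is unique. Both solutions satisfy the pointwise relation
    grad c_i = - ms c J i with bounded fluxes, so that the concentrations are
    Lipschitz in space, and w = c - cbar solves d_t w + div (J - Jbar) = 0 with
    zero initial data. This equation is tested against w_i / (c_i + e), that is,
    one estimates the energy
      E = sum_i int w_i^2 / (c_i + e).
    The weights 1 / (c_i + e) are those of the Hessian of a regularised entropy.
    They make the Maxwell-Stefan operator coercive on vectors k of sum zero,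
      sum_i k_i / (c_i + e) * ms c k i >= const * sum_i k_i^2,
    for a small e > 0 and for every nonnegative c of sum 1, including those with
    vanishing components (ms_coercive). In the derivative of E this quantity
    appears with a minus sign for k = J - Jbar, and absorbs all the other
    terms up to a multiple of |w|^2, since c is Lipschitz and the fluxes are
    bounded (energy_pointwise). Gronwall's lemma then gives w = 0.

    The solutions are too rough in time for this computation, which is
    therefore done on mollifications in space. The kernel K N is a trigonometric
    polynomial in x and y, hence a finite sum of products e_a(x) f_a(y). Only
    countably many test functions e_a occur, so that off a null set of times
    all the weak identities hold at once (slice_gradient, slice_mass, ae_good),
    and at a fixed scale the mollified concentrations are Lipschitz in time. The
    energy inequality is proved between two times t < t', with an error
    O((t' - t)^2) whose constant depends on the scale; it disappears when the
    time step tends to 0, at a fixed scale (discrete_gronwall, energy_bound).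
    Mollification does not commute with the products c_j J_i, but the
    commutator is O(epsilon), where epsilon is the first moment of the kernel,
    because c is Lipschitz (conv_commutator, approx_moll). Hence the mollified
    difference is O(epsilon) in mean square, with a constant independent of the
    scale, and w = 0 in the limit (slices_unique).

    The argument is run on functions which satisfy all the pointwise relations
    everywhere, obtained from the given solutions by a modification on a null
    set (solution_slices). *)

(** * Bounded measurable functions *)

Section bounded_measurable.
Context d (T : measurableType d) (R : realType).
Implicit Types (f g : T -> R).

(** Boundedness on a set of finite measure is all the integrability that is
    needed here, and it is stable under sums and products. *)
Definition bmeas f :=
  measurable_fun [set: T] f /\ exists M, forall x, `|f x| <= M.

Lemma bmeas_cst r : bmeas (cst r).
Proof. by split; [exact: measurable_cst | exists `|r|]. Qed.

Lemma bmeasD f g : bmeas f -> bmeas g -> bmeas (fun x => f x + g x).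
Proof.
move=> [mf [M fM]] [mg [N gN]]; split; first exact: measurable_funD.
by exists (M + N) => x; rewrite (le_trans (ler_normD _ _))// lerD.
Qed.

Lemma bmeasM f g : bmeas f -> bmeas g -> bmeas (fun x => f x * g x).
Proof.
move=> [mf [M fM]] [mg [N gN]]; split; first exact: measurable_funM.
by exists (M * N) => x; rewrite normrM ler_pM.
Qed.

Lemma bmeasN f : bmeas f -> bmeas (fun x => - f x).
Proof.
by move=> [mf [M fM]]; split; [exact: measurableT_comp | exists M => x; rewrite normrN].
Qed.

Lemma bmeasB f g : bmeas f -> bmeas g -> bmeas (fun x => f x - g x).
Proof. by move=> bf /bmeasN; exact: bmeasD. Qed.

Lemma bmeas_norm f : bmeas f -> bmeas (fun x => `|f x|).
Proof.
move=> [mf [M fM]]; split; first exact: measurableT_comp.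
by exists M => x; rewrite normr_id.
Qed.

Lemma bmeas_sum (I : Type) (s : seq I) (P : pred I) (h : I -> T -> R) :
  (forall i, P i -> bmeas (h i)) -> bmeas (fun x => \sum_(i <- s | P i) h i x).
Proof.
move=> bh; rewrite (_ : (fun _ => _) = \sum_(i <- s | P i) h i); last first.
  by apply/funext => x; rewrite fct_sumE.
elim/big_rec : _ => [|i f Pi bf]; first exact: bmeas_cst.
exact: (bmeasD (bh _ Pi) bf).
Qed.

Lemma bmeas_indic (A : set T) : measurable A -> bmeas (\1_A : T -> R).
Proof.
move=> mA; split; first exact: measurable_indic.
by exists 1 => x; rewrite indicE ger0_norm// lern1; case: (_ \in _).
Qed.

Section integral.
Variables (mu : {measure set T -> \bar R}) (D : set T).
Hypotheses (mD : measurable D) (Dfin : (mu D < +oo)%E).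

Lemma bmeas_integrable f : bmeas f -> mu.-integrable D (EFin \o f).
Proof.
move=> [mf [M fM]]; apply: measurable_bounded_integrable => //.
  exact: measurable_funTS.
by exists M; split; [exact: num_real | move=> N MN x _ /=; rewrite (le_trans (fM x))// ltW].
Qed.

Lemma RintD f g : bmeas f -> bmeas g ->
  \int[mu]_(x in D) (f x + g x) = \int[mu]_(x in D) f x + \int[mu]_(x in D) g x.
Proof. by move=> bf bg; rewrite RintegralD//; exact: bmeas_integrable. Qed.

Lemma RintB f g : bmeas f -> bmeas g ->
  \int[mu]_(x in D) (f x - g x) = \int[mu]_(x in D) f x - \int[mu]_(x in D) g x.
Proof. by move=> bf bg; rewrite RintegralB//; exact: bmeas_integrable. Qed.

Lemma RintZl r f : bmeas f ->
  \int[mu]_(x in D) (r * f x) = r * \int[mu]_(x in D) f x.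
Proof. by move=> bf; rewrite RintegralZl//; exact: bmeas_integrable. Qed.

Lemma RintZr r f : bmeas f ->
  \int[mu]_(x in D) (f x * r) = (\int[mu]_(x in D) f x) * r.
Proof. by move=> bf; rewrite RintegralZr//; exact: bmeas_integrable. Qed.

Lemma RintN f : bmeas f -> \int[mu]_(x in D) (- f x) = - \int[mu]_(x in D) f x.
Proof.
by move=> bf; rewrite -mulN1r -RintZl//; apply: eq_Rintegral => x _; rewrite mulN1r.
Qed.

Lemma Rint0 : \int[mu]_(x in D) (0 : R) = 0.
Proof. by rewrite Rintegral_cst// mul0r. Qed.

Lemma Rint_sum (I : Type) (s : seq I) (P : pred I) (h : I -> T -> R) :
  (forall i, P i -> bmeas (h i)) ->
  \int[mu]_(x in D) (\sum_(i <- s | P i) h i x) =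
  \sum_(i <- s | P i) \int[mu]_(x in D) h i x.
Proof.
move=> bh; elim: s => [|i s IH].
  by rewrite big_nil -[RHS]Rint0; apply: eq_Rintegral => x _; rewrite big_nil.
rewrite big_cons; under eq_Rintegral do rewrite big_cons.
case: ifPn => // Pi; rewrite RintD ?IH//; first exact: bh.
exact: bmeas_sum.
Qed.

Lemma le_Rint f g : bmeas f -> bmeas g -> (forall x, D x -> f x <= g x) ->
  \int[mu]_(x in D) f x <= \int[mu]_(x in D) g x.
Proof. by move=> bf bg; apply: le_Rintegral => //; exact: bmeas_integrable. Qed.

Lemma le_Rint_norm f g : bmeas f -> bmeas g -> (forall x, D x -> `|f x| <= g x) ->
  `|\int[mu]_(x in D) f x| <= \int[mu]_(x in D) g x.
Proof.
move=> bf bg fg; apply: (le_trans (le_normr_Rintegral mD (bmeas_integrable bf))).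
exact: le_Rint (bmeas_norm bf) bg fg.
Qed.

Lemma Rint_le_cst f M : bmeas f -> (forall x, D x -> `|f x| <= M) ->
  `|\int[mu]_(x in D) f x| <= M * fine (mu D).
Proof.
move=> bf fM; rewrite -(Rintegral_cst mu mD); exact: le_Rint_norm (bmeas_cst M) _.
Qed.

Lemma ae_eq_Rint f g : bmeas f -> bmeas g ->
  {ae mu, forall x, D x -> f x = g x} ->
  \int[mu]_(x in D) f x = \int[mu]_(x in D) g x.
Proof.
move=> [mf _] [mg _] fg; congr fine; apply: ae_eq_integral => //.
- by apply/measurable_EFinP; exact: measurable_funTS.
- by apply/measurable_EFinP; exact: measurable_funTS.
- by apply: filterS fg => x fg Dx; rewrite fg.
Qed.

Lemma cvg_Rint (f_ : nat -> T -> R) f M :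
  (forall n, bmeas (f_ n)) -> bmeas f ->
  (forall n x, D x -> `|f_ n x| <= M) ->
  (forall x, D x -> f_ ^~ x @ \oo --> f x) ->
  (fun n => \int[mu]_(x in D) f_ n x) @ \oo --> \int[mu]_(x in D) f x.
Proof.
move=> bf_ bf fM ff.
have [|||||_ _] := @dominated_convergence _ _ _ mu D mD
  (fun n => EFin \o f_ n) (EFin \o f) (cst M%:E).
- by move=> n; apply/measurable_EFinP/measurable_funTS; case: (bf_ n).
- by apply/measurable_EFinP/measurable_funTS; case: bf.
- by apply: aeW => x Dx; apply/fine_cvgP; split; [exact: nearW | exact: ff].
- exact: bmeas_integrable (bmeas_cst M).
- by apply: aeW => x n Dx; rewrite /= lee_fin fM.
move=> h; have /fine_cvgP[_] : (fun n => (\int[mu]_(x in D) (EFin \o f_ n) x)%E) @ \oo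
    --> (fine (\int[mu]_(x in D) (EFin \o f) x))%:E.
  by rewrite fineK//; apply: integrable_fin_num => //; exact: bmeas_integrable.
exact.
Qed.

Lemma Rint_sqr_eq0 f : bmeas f -> \int[mu]_(x in D) (f x ^+ 2) = 0 ->
  {ae mu, forall x, D x -> f x = 0}.
Proof.
pose f2 x := f x ^+ 2; move=> bf; rewrite -/(Rintegral mu D f2) => f20.
have bf2 : bmeas f2 by exact: bmeasM.
have mf2 : measurable_fun D (EFin \o f2).
  by apply/measurable_EFinP/measurable_funTS; case: bf2.
have /(ae_eq_integral_abs mu mD mf2) : (\int[mu]_(x in D) `|(EFin \o f2) x| = 0)%E.
  have : (\int[mu]_(x in D) (f2 x)%:E = 0)%E.
    have /fineK <- := integrable_fin_num mD (bmeas_integrable bf2).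
    by rewrite -[fine _]/(Rintegral mu D f2) f20.
  move=> <-; apply: eq_integral => x _ /=.
  by rewrite ger0_norm ?sqr_ge0.
apply: filterS => x + Dx => /(_ Dx)/= [] /eqP.
by rewrite sqrf_eq0 => /eqP.
Qed.

End integral.
End bounded_measurable.

Lemma bmeas_comp d1 d2 (T1 : measurableType d1) (T2 : measurableType d2)
    (R : realType) (h : T1 -> T2) (f : T2 -> R) :
  measurable_fun setT h -> bmeas f -> bmeas (f \o h).
Proof.
move=> mh [mf [M fM]]; split; first exact: measurableT_comp.
by exists M => x; exact: fM.
Qed.

(** * Fubini for bounded functions *)

Section fubini_bounded.
Context d1 d2 (T1 : measurableType d1) (T2 : measurableType d2) (R : realType).
Variables (m1 : {sigma_finite_measure set T1 -> \bar R}).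
Variables (m2 : {sigma_finite_measure set T2 -> \bar R}).
Variables (D1 : set T1) (D2 : set T2).
Hypotheses (mD1 : measurable D1) (mD2 : measurable D2).
Hypotheses (D1fin : (m1 D1 < +oo)%E) (D2fin : (m2 D2 < +oo)%E).
Implicit Types f : T1 * T2 -> R.

Lemma prod_fin : ((m1 \x m2)%E (D1 `*` D2) < +oo)%E.
Proof. by rewrite product_measure1E// lte_mul_pinfty// ge0_fin_numE. Qed.

Lemma bmeas_slice1 f x : bmeas f -> bmeas (fun y => f (x, y)).
Proof. by move=> bf; exact: (bmeas_comp (measurable_pair1 x) bf). Qed.

Lemma bmeas_slice2 f y : bmeas f -> bmeas (fun x => f (x, y)).
Proof. by move=> bf; exact: (bmeas_comp (measurable_pair2 y) bf). Qed.

Lemma bmeas_fst (g : T1 -> R) : bmeas g -> bmeas (fun p : T1 * T2 => g p.1).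
Proof. by move=> bf; exact: (bmeas_comp measurable_fst bf). Qed.

Lemma bmeas_snd (g : T2 -> R) : bmeas g -> bmeas (fun p : T1 * T2 => g p.2).
Proof. by move=> bf; exact: (bmeas_comp measurable_snd bf). Qed.

Let cut f (p : T1 * T2) := f p * (\1_D1 p.1 * \1_D2 p.2).

Let bmeas_cut f : bmeas f -> bmeas (cut f).
Proof.
move=> bf; apply: bmeasM => //; apply: bmeasM.
- exact: bmeas_fst (bmeas_indic R mD1).
- exact: bmeas_snd (bmeas_indic R mD2).
Qed.

Let cutE f : cut f = f \_ (D1 `*` D2).
Proof.
apply/funext => p; rewrite /cut patchE in_setX !indicE.
by case: (p.1 \in D1); case: (p.2 \in D2); rewrite ?(mulr0, mul0r, mulr1).
Qed.

Let cut_integrable f : bmeas f -> (m1 \x m2)%E.-integrable setT (EFin \o cut f).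
Proof.
move=> bf; rewrite cutE -restrict_EFin.
apply/(integrable_mkcond (EFin \o f)); first exact: measurableX.
by apply: bmeas_integrable => //; [exact: measurableX | exact: prod_fin].
Qed.

Let cutF f x : bmeas f ->
  (\int[m2]_y (EFin \o cut f) (x, y) =
   (\int[m2]_(y in D2) f (x, y) * \1_D1 x)%:E)%E.
Proof.
move=> bf; rewrite -RintZr//; last exact: bmeas_slice1.
rewrite /Rintegral fineK; last first.
  apply: integrable_fin_num => //; apply: bmeas_integrable => //.
  exact: bmeasM (bmeas_slice1 _ bf) (bmeas_cst _ _).
rewrite [RHS]integral_mkcond; apply: eq_integral => y _.
by rewrite patchE /cut/= !indicE; case: (y \in D2); rewrite ?(mulr1, mulr0).
Qed.

Let cutG f y : bmeas f ->
  (\int[m1]_x (EFin \o cut f) (x, y) =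
   (\int[m1]_(x in D1) f (x, y) * \1_D2 y)%:E)%E.
Proof.
move=> bf; rewrite -RintZr//; last exact: bmeas_slice2.
rewrite /Rintegral fineK; last first.
  apply: integrable_fin_num => //; apply: bmeas_integrable => //.
  exact: bmeasM (bmeas_slice2 _ bf) (bmeas_cst _ _).
rewrite [RHS]integral_mkcond; apply: eq_integral => x _.
by rewrite patchE /cut/= !indicE; case: (x \in D1); rewrite ?(mul1r, mul0r, mulr0).
Qed.

Lemma Rint_prod1 f : bmeas f ->
  \int[(m1 \x m2)%E]_(p in D1 `*` D2) f p =
  \int[m1]_(x in D1) \int[m2]_(y in D2) f (x, y).
Proof.
move=> bf; rewrite Rintegral_mkcond -cutE [RHS]Rintegral_mkcond; congr fine.
rewrite -(integral12_prod_meas1 (cut_integrable bf)); apply: eq_integral => x _.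
rewrite /fubini_F cutF// patchE indicE.
by case: (x \in D1); rewrite ?(mulr1, mulr0).
Qed.

Lemma Rint_prod2 f : bmeas f ->
  \int[(m1 \x m2)%E]_(p in D1 `*` D2) f p =
  \int[m2]_(y in D2) \int[m1]_(x in D1) f (x, y).
Proof.
move=> bf; rewrite Rintegral_mkcond -cutE [RHS]Rintegral_mkcond; congr fine.
rewrite -(integral21_prod_meas1 (cut_integrable bf)); apply: eq_integral => x _.
rewrite /fubini_G cutG// patchE indicE.
by case: (x \in D2); rewrite ?(mulr1, mulr0).
Qed.

Lemma bmeas_Rint1 f : bmeas f -> bmeas (fun x => \int[m2]_(y in D2) f (x, y)).
Proof.
move=> bf; have [_ [M fM]] := bf; split; last first.
  exists (M * fine (m2 D2)) => x; apply: Rint_le_cst => //.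
  exact: bmeas_slice1.
apply/measurable_EFinP.
pose g p := f p * \1_D2 p.2.
have [mg _] : bmeas g by apply: bmeasM => //; apply: bmeas_snd (bmeas_indic R mD2).
have gE h x : (forall p, h p = g p) -> (\int[m2]_(y in D2) (f (x, y))%:E = \int[m2]_y (h (x, y))%:E)%E.
  move=> hg; rewrite integral_mkcond; apply: eq_integral => y _.
  by rewrite patchE hg /g/= indicE; case: (y \in D2); rewrite ?(mulr1, mulr0).
rewrite (_ : _ \o _ = fun x => (\int[m2]_y (EFin \o g)^\+ (x, y) - \int[m2]_y (EFin \o g)^\- (x, y))%E).
  by apply: emeasurable_funB; apply: measurable_fun_fubini_tonelli_F => //;
    [apply: measurable_funepos | apply: measurable_funeneg]; exact/measurable_EFinP.
apply/funext => x /=; rewrite fineK; last first.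
  by apply: integrable_fin_num => //; apply: bmeas_integrable => //; exact: bmeas_slice1.
rewrite (gE g)// integralE; congr (_ - _)%E; apply: eq_integral => y _.
  by rewrite !funeposE.
by rewrite !funenegE.
Qed.

Lemma bmeas_Rint2 f : bmeas f -> bmeas (fun y => \int[m1]_(x in D1) f (x, y)).
Proof.
move=> bf; have [_ [M fM]] := bf; split; last first.
  exists (M * fine (m1 D1)) => x; apply: Rint_le_cst => //.
  exact: bmeas_slice2.
apply/measurable_EFinP.
pose g p := f p * \1_D1 p.1.
have [mg _] : bmeas g by apply: bmeasM => //; apply: bmeas_fst (bmeas_indic R mD1).
have gE h y : (forall p, h p = g p) -> (\int[m1]_(x in D1) (f (x, y))%:E = \int[m1]_x (h (x, y))%:E)%E.
  move=> hg; rewrite integral_mkcond; apply: eq_integral => x _.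
  by rewrite patchE hg /g/= indicE; case: (x \in D1); rewrite ?(mulr1, mulr0).
rewrite (_ : _ \o _ = fun y => (\int[m1]_x (EFin \o g)^\+ (x, y) - \int[m1]_x (EFin \o g)^\- (x, y))%E).
  by apply: emeasurable_funB; apply: measurable_fun_fubini_tonelli_G => //;
    [apply: measurable_funepos | apply: measurable_funeneg]; exact/measurable_EFinP.
apply/funext => y /=; rewrite fineK; last first.
  by apply: integrable_fin_num => //; apply: bmeas_integrable => //; exact: bmeas_slice2.
rewrite (gE g)// integralE; congr (_ - _)%E; apply: eq_integral => x _.
  by rewrite !funeposE.
by rewrite !funenegE.
Qed.

End fubini_bounded.

(** * Total families of test functions *)

Section total_families.
Context (R : realType).

(** Phi separates bounded functions on D, up to null sets. *)
Definition total_on d (T : measurableType d) (mu : {measure set T -> \bar R})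
    (D : set T) (Phi : set (T -> R)) :=
  forall h, bmeas h -> (forall g, Phi g -> \int[mu]_(x in D) (h x * g x) = 0) ->
  {ae mu, forall x, D x -> h x = 0}.

Lemma ae0_of_Rint d (T : measurableType d) (mu : {measure set T -> \bar R})
    (D : set T) (h : T -> R) : measurable D -> (mu D < +oo)%E -> bmeas h ->
  (forall A, measurable A -> \int[mu]_(x in D) (h x * \1_A x) = 0) ->
  {ae mu, forall x, D x -> h x = 0}.
Proof.
move=> mD Dfin bh h0.
have : ae_eq mu D (EFin \o h) (cst 0%E).
  apply: integral_ae_eq => //; first exact: bmeas_integrable.
  move=> E ED mE; rewrite integral0.
  have bE : bmeas (fun x => h x * \1_E x) := bmeasM bh (bmeas_indic R mE).
  have /eqP := h0 E mE; rewrite /Rintegral.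
  rewrite (_ : \int[mu]_(x in D) _ = \int[mu]_(x in E) (EFin \o h) x)%E.
    rewrite fine_eq0 => [/eqP //|].
    apply: integrable_fin_num => //; apply: integrableS ED _ => //.
    exact: bmeas_integrable.
  rewrite [LHS]integral_mkcond [RHS]integral_mkcond; apply: eq_integral => x _.
  rewrite !patchE indicE; case: ifPn => Dx; case: ifPn => Ex; rewrite ?(mulr1, mulr0)//.
  by exfalso; move/negP : Dx; apply; apply/mem_set/ED/set_mem.
by apply: filterS => x + Dx => /(_ Dx)/= [].
Qed.

(** Totality passes to products: for a measurable B, the integral of h over B in
    the second variable is orthogonal to Phi1, because the integral of h against
    g1 in the first variable vanishes almost everywhere by totality of Phi2.
    Hence h is orthogonal to the indicators of rectangles, and these generate the
    product sigma-algebra. *)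
Lemma total_prod d1 d2 (T1 : measurableType d1) (T2 : measurableType d2)
    (m1 : {sigma_finite_measure set T1 -> \bar R})
    (m2 : {sigma_finite_measure set T2 -> \bar R})
    (D1 : set T1) (D2 : set T2) Phi1 Phi2 :
  measurable D1 -> measurable D2 -> (m1 D1 < +oo)%E -> (m2 D2 < +oo)%E ->
  Phi1 `<=` bmeas (R := R) -> Phi2 `<=` bmeas (R := R) ->
  total_on m1 D1 Phi1 -> total_on m2 D2 Phi2 ->
  total_on (m1 \x m2)%E (D1 `*` D2)
    [set g | exists2 g1, Phi1 g1 & exists2 g2, Phi2 g2 &
       g = fun p : T1 * T2 => g1 p.1 * g2 p.2].
Proof.
move=> mD1 mD2 f1 f2 b1 b2 t1 t2 h bh h0.
have key A B : measurable A -> measurable B ->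
    \int[(m1 \x m2)%E]_(p in D1 `*` D2) (h p * \1_(A `*` B) p) = 0.
  move=> mA mB.
  have bA := bmeas_indic R mA; have bB := bmeas_indic R mB.
  pose v x := \int[m2]_(y in D2) (h (x, y) * \1_B y).
  have bhB : bmeas (fun p : T1 * T2 => h p * \1_B p.2) := bmeasM bh (bmeas_snd _ bB).
  have bv : bmeas v by exact: (bmeas_Rint1 mD2 f2 bhB).
  have v0 : {ae m1, forall x, D1 x -> v x = 0}.
    apply: t1 => // g1 g1P; have bg1 := b1 _ g1P.
    have bhBg : bmeas (fun p : T1 * T2 => (h p * \1_B p.2) * g1 p.1).
      exact: bmeasM bhB (bmeas_fst _ bg1).
    transitivity (\int[m1]_(x in D1) \int[m2]_(y in D2) (h (x, y) * \1_B y * g1 x)).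
      by apply: eq_Rintegral => x _; rewrite RintZr//; exact: (bmeas_slice1 x bhB).
    rewrite -(Rint_prod1 mD1 mD2 f1 f2 bhBg) (Rint_prod2 mD1 mD2 f1 f2 bhBg)/=.
    pose u y := \int[m1]_(x in D1) (h (x, y) * g1 x).
    have bhg : bmeas (fun p : T1 * T2 => h p * g1 p.1) := bmeasM bh (bmeas_fst _ bg1).
    have bu : bmeas u by exact: (bmeas_Rint2 mD1 f1 bhg).
    have u0 : {ae m2, forall y, D2 y -> u y = 0}.
      apply: t2 => // g2 g2P; have bg2 := b2 _ g2P.
      rewrite -(h0 (fun p => g1 p.1 * g2 p.2)); last by exists g1 => //; exists g2.
      rewrite (Rint_prod2 mD1 mD2 f1 f2)/=; last first.
        by apply: bmeasM => //; apply: bmeasM; [exact: bmeas_fst | exact: bmeas_snd].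
      apply: eq_Rintegral => y _; rewrite -RintZr//; last exact: (bmeas_slice2 y bhg).
      by apply: eq_Rintegral => x _; rewrite mulrA.
    transitivity (\int[m2]_(y in D2) (u y * \1_B y)).
      apply: eq_Rintegral => y _; rewrite -RintZr//; last exact: (bmeas_slice2 y bhg).
      by apply: eq_Rintegral => x _; rewrite mulrAC.
    rewrite -(Rint0 m2 mD2); apply: ae_eq_Rint => //; first exact: bmeasM.
      exact: bmeas_cst.
    by apply: filterS u0 => y u0 Dy; rewrite u0// mul0r.
  rewrite (Rint_prod1 mD1 mD2 f1 f2); last first.
    by apply: bmeasM => //; apply: bmeas_indic; exact: measurableX.
  transitivity (\int[m1]_(x in D1) (v x * \1_A x)).
    apply: eq_Rintegral => x _; rewrite -RintZr//; last exact: (bmeas_slice1 x bhB).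
    apply: eq_Rintegral => y _; rewrite !indicE in_setX/=.
    by case: (x \in A); case: (y \in B); rewrite ?(mulr0, mulr1, mul0r).
  rewrite -(Rint0 m1 mD1); apply: ae_eq_Rint => //; first exact: bmeasM.
    exact: bmeas_cst.
  by apply: filterS v0 => x v0 Dx; rewrite v0// mul0r.
have mD := measurableX mD1 mD2; have fD := prod_fin mD1 mD2 f1 f2.
apply: ae0_of_Rint => //.
pose In A := \int[(m1 \x m2)%E]_(p in D1 `*` D2) (h p * \1_A p).
pose G := [set A `*` B | A in @measurable _ T1 & B in @measurable _ T2].
have GE : @measurable _ (T1 * T2)%type = <<s G >>.
  by rewrite measurable_prod_measurableType.
move=> S; rewrite GE; move: S.
apply: (@dynkin_induction _ (T1 * T2)%type G (fun A => In A = 0)) => //; rewrite /In.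
- move=> _ _ [A mA [B mB <-]] [A' mA' [B' mB' <-]].
  by exists (A `&` A'); [exact: measurableI|exists (B `&` B'); [exact: measurableI|rewrite setXI]].
- by have := key setT setT measurableT measurableT; rewrite setXTT.
- by move=> _ [A mA [B mB <-]]; exact: key.
- move=> S mS S0; have := key setT setT measurableT measurableT; rewrite setXTT => hT.
  transitivity (\int[(m1 \x m2)%E]_(p in D1 `*` D2) (h p * \1_setT p - h p * \1_S p)).
    apply: eq_Rintegral => p _; rewrite -mulrBr !indicE in_setC in_setT.
    by case: (p \in S); rewrite ?subrr ?subr0.
  rewrite RintB//; first by rewrite hT S0 subrr.
    by apply: bmeasM => //; apply: bmeas_indic.
  by apply: bmeasM => //; apply: bmeas_indic.
- move=> F mF tF F0.
  have [_ [M hM]] := bh.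
  have cv : (fun n => \int[(m1 \x m2)%E]_(p in D1 `*` D2)
      (\sum_(i < n) h p * \1_(F i) p)) @ \oo -->
      \int[(m1 \x m2)%E]_(p in D1 `*` D2) (h p * \1_(\bigcup_k F k) p).
    apply: (@cvg_Rint _ _ _ _ _ mD fD _ _ M) => //.
    + by move=> n; apply: bmeas_sum => i _; apply: bmeasM => //; apply: bmeas_indic.
    + by apply: bmeasM => //; apply: bmeas_indic; exact: bigcup_measurable.
    + move=> n p _; rewrite -mulr_sumr normrM -[leRHS]mulr1 ler_pM//.
      case: (pselect (exists k : 'I_n, F k p)) => [[k Fkp]|nF]; last first.
        rewrite big1 ?normr0// => i _; rewrite indicE memNset// => Fip.
        by apply: nF; exists i.
      rewrite (bigD1 k)//= big1 ?addr0 => [|i ik].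
        by rewrite indicE ger0_norm// lern1; case: (_ \in _).
      rewrite indicE memNset// => Fip.
      have /trivIsetP/(_ i k I I ik) := tF.
      by move=> /seteqP[+ _] => /(_ p (conj Fip Fkp)).
    + move=> p _; rewrite indicE; case: (boolP (p \in _)) => [|pF].
        move=> /set_mem[k _ Fkp]; apply/cvgrPdist_lt => e e0.
        exists k.+1 => // n /= kn; rewrite (bigD1 (Ordinal kn))//= big1 ?addr0.
          by rewrite indicE mem_set// subrr normr0.
        move=> i ik; rewrite indicE memNset ?mulr0// => Fip.
        have /trivIsetP/(_ i k I I) := tF.
        by move=> /(_ ik)/seteqP[+ _] => /(_ p (conj Fip Fkp)).
      rewrite mulr0 (_ : (fun _ => _) = cst 0); first exact: cvg_cst.
      apply/funext => n; rewrite big1// => i _; rewrite indicE memNset ?mulr0//.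
      by move=> Fip; move/negP : pF; apply; apply/mem_set; exists i.
  rewrite (_ : (fun _ => _) = cst 0) in cv; first by have /(cvg_lim (@Rhausdorff _)) := cv;
    rewrite lim_cst.
  apply/funext => n; rewrite Rint_sum//; first by rewrite big1.
  by move=> i _; apply: bmeasM => //; apply: bmeas_indic.
Qed.

End total_families.

(** * Almost everywhere statements *)

Section almost_everywhere_logic.
Context d (T : measurableType d) (R : realType) (mu : {measure set T -> \bar R}).

Lemma ae_mono (P Q : T -> Prop) :
  (forall x, P x -> Q x) -> {ae mu, forall x, P x} -> {ae mu, forall x, Q x}.
Proof. exact: filterS. Qed.

Lemma ae_mono2 (P Q S : T -> Prop) :
  (forall x, P x -> Q x -> S x) ->
  {ae mu, forall x, P x} -> {ae mu, forall x, Q x} -> {ae mu, forall x, S x}.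
Proof. exact: filterS2. Qed.

Lemma ae_countable (P : nat -> T -> Prop) :
  (forall n, {ae mu, forall x, P n x}) -> {ae mu, forall x, forall n, P n x}.
Proof. by move=> h; exact: ae_foralln. Qed.

Lemma ae_ord n (P : 'I_n -> T -> Prop) :
  (forall i, {ae mu, forall x, P i x}) -> {ae mu, forall x, forall i, P i x}.
Proof.
move=> h; pose Q m x := forall hm : (m < n)%N, P (Ordinal hm) x.
have : {ae mu, forall x, forall m, Q m x}.
  apply: ae_countable => m; case: (ltnP m n) => [mn|nm].
    by apply: ae_mono (h (Ordinal mn)) => x Px hm; rewrite (_ : Ordinal hm = Ordinal mn)//;
      exact: val_inj.
  by apply: aeW => x hm; exfalso; move: hm; rewrite ltnNge nm.
by apply: ae_mono => x Qx [m hm]; exact: Qx.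
Qed.

End almost_everywhere_logic.

(** * Directional derivatives *)

Section directional.
Context (R : realType) (V : normedModType R).
Implicit Types (f : V -> R) (x v : V).

(** Directional derivatives are one-variable derivatives along a line, which
    gives access to the one-variable chain rule. *)
Lemma is_deriveDirP f x v df :
  is_derive x v f df <-> is_derive (0 : R) 1 (fun h : R => f (h *: v + x)) df.
Proof.
have e : (fun h : R => h^-1 *: ((fun h : R => f (h *: v + x)) (h *: 1 + 0) -
    (fun h : R => f (h *: v + x)) 0)) = (fun h : R => h^-1 *: (f (h *: v + x) - f x)).
  by apply/funext => h /=; rewrite [h *: 1]mulr1 addr0 scale0r add0r.
split => -[d1 d2]; apply: DeriveDef.
- by move: d1; rewrite /derivable /= e.
- by move: d2; rewrite /derive /= e.
- by move: d1; rewrite /derivable /= e.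
- by move: d2; rewrite /derive /= e.
Qed.

Lemma is_derive_dir_comp f (g : R -> R) x v df dg :
  is_derive (f x) 1 g dg -> is_derive x v f df -> is_derive x v (g \o f) (dg * df).
Proof.
move=> dg' /is_deriveDirP df'; apply/is_deriveDirP.
apply: (@is_derive1_comp _ g) df'; by rewrite scale0r add0r.
Qed.

Lemma is_derive_affine f x v df :
  (forall h, f (h *: v + x) = h * df + f x) -> is_derive x v f df.
Proof.
move=> fE; apply/is_deriveDirP.
rewrite (_ : (fun h => _) = (fun h => h * df + f x)); last exact/funext.
have := @is_deriveD R R R (fun h : R => h * df) (cst (f x)) 0 1 df 0.
by rewrite addr0; apply => //; apply: is_derive_eq; rewrite scaler0 add0r /GRing.scale/= mulr1.
Qed.

Lemma is_derive_inv f x v df : f x != 0 -> is_derive x v f df ->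
  is_derive x v (fun y => (f y)^-1) (- (f x) ^- 2 * df).
Proof.
move=> fx0 [d1 d2]; apply: DeriveDef; first exact: derivableV.
by rewrite deriveV// d2.
Qed.

Lemma is_derive_uniq f x v d1 d2 :
  is_derive x v f d1 -> is_derive x v f d2 -> d1 = d2.
Proof. by move=> [_ <-] [_ <-]. Qed.

End directional.

(** * Smooth functions of one variable *)

Section smooth1.
Context (R : realType).
Implicit Types (g : R -> R) (F : nat -> R -> R).

(** Smoothness is witnessed by the sequence of all the derivatives, which is
    explicit for the functions used here and avoids iterated differentiation
    operators. *)
Definition smooth1 g :=
  exists2 F, F 0%N = g & forall n (x : R), is_derive x 1 (F n) (F n.+1 x).

Lemma smooth1_derive g :
  smooth1 g -> exists2 dg, smooth1 dg & forall x : R, is_derive x 1 g (dg x).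
Proof.
move=> [F <- dF]; exists (F 1%N); last exact: dF.
by exists (fun n => F n.+1).
Qed.

Lemma is_derive_continuous g dg : (forall x : R, is_derive x 1 g (dg x)) -> continuous g.
Proof.
move=> d x; apply: differentiable_continuous.
by apply/derivable1_diffP; case: (d x).
Qed.

Lemma smooth1_continuous g : smooth1 g -> continuous g.
Proof. by move=> /smooth1_derive[dg _]; exact: is_derive_continuous. Qed.

Lemma smooth1_cos : smooth1 (@cos R).
Proof.
exists (fun n x => cos (x + n%:R * (pi / 2))).
  by apply/funext => x; rewrite mul0r addr0.
move=> n x.
have -> : x + n.+1%:R * (pi / 2) = x + n%:R * (pi / 2) + pi / 2 by rewrite -natr1; ring.
rewrite cosDpihalf.
have -> : - sin (x + n%:R * (pi / 2)) = - sin (x + n%:R * (pi / 2)) * (1 + 0) by rewrite addr0 mulr1.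
exact: is_derive1_comp.
Qed.

Lemma smooth1_sin : smooth1 (@sin R).
Proof.
exists (fun n x => sin (x + n%:R * (pi / 2))).
  by apply/funext => x; rewrite mul0r addr0.
move=> n x.
have -> : x + n.+1%:R * (pi / 2) = x + n%:R * (pi / 2) + pi / 2 by rewrite -natr1; ring.
rewrite sinDpihalf.
have -> : cos (x + n%:R * (pi / 2)) = cos (x + n%:R * (pi / 2)) * (1 + 0) by rewrite addr0 mulr1.
exact: is_derive1_comp.
Qed.

Lemma smooth1_scale g a : smooth1 g -> smooth1 (fun x => g (a * x)).
Proof.
move=> [F <- dF]; exists (fun n x => a ^+ n * F n (a * x)).
  by apply/funext => x; rewrite expr0 mul1r.
move=> n x.
have h : is_derive x 1 (fun x => a * x) a.
  by apply: is_derive_affine => h; rewrite /GRing.scale/= mulr1 mulrDr mulrC.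
have := is_deriveM (is_derive_cst (a ^+ n) x 1) (is_derive1_comp (dF n (a * x)) h).
by move/is_derive_eq; apply; rewrite scaler0 addr0 /GRing.scale/= exprSr; ring.
Qed.

(** * The flat function exp(-1/t) *)

(** The derivatives of exp(-1/t), extended by 0, are all of this form, and
    flatD computes the next polynomial in 1/t. *)
Definition flatpoly (p : {poly R}) (t : R) : R :=
  if 0 < t then p.[t^-1] * expR (- t^-1) else 0.

Definition flatD (p : {poly R}) : {poly R} := 'X^2 * (p - p^`()).

Let expR_bound j (x : R) : 0 <= x -> x ^+ j * expR (- x) <= j`!%:R.
Proof.
move=> x0; rewrite expRN ler_pdivrMr ?expR_gt0//.
case: j => [|j]; first by rewrite fact0 mul1r expr0 (le_trans _ (expR_ge1Dx x))// lerDl.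
have f0 : 0 < (j.+1)`!%:R :> R by rewrite ltr0n fact_gt0.
rewrite mulrC -ler_pdivrMr//; apply: le_trans (expR_ge1Dxn j x0).
by rewrite lerDr.
Qed.

Let poly_bound (p : {poly R}) j :
  exists2 C, 0 <= C & forall x, 0 <= x -> `|p.[x] * x ^+ j * expR (- x)| <= C.
Proof.
elim/poly_ind : p j => [j|p c IH j].
  by exists 0 => // x _; rewrite horner0 !mul0r normr0.
have [C C0 pC] := IH j.+1; exists (C + `|c| * j`!%:R); first by rewrite addr_ge0 ?mulr_ge0.
move=> x x0; rewrite hornerMXaddC.
have -> : (p.[x] * x + c) * x ^+ j * expR (- x) =
    p.[x] * x ^+ j.+1 * expR (- x) + c * (x ^+ j * expR (- x)) by rewrite exprS; ring.
rewrite (le_trans (ler_normD _ _))// lerD ?pC// normrM ler_wpM2l//.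
by rewrite ger0_norm ?expR_bound// mulr_ge0 ?exprn_ge0 ?expR_ge0.
Qed.

(** The quadratic bound gives at once continuity and a zero derivative at the
    origin; it holds because x^j exp(-x) is bounded for every j. *)
Lemma flatpoly_small p : exists2 C, 0 <= C & forall t, `|flatpoly p t| <= C * t ^+ 2.
Proof.
have [C C0 pC] := poly_bound p 2; exists C => // t; rewrite /flatpoly.
case: ifPn => t0; last by rewrite normr0 mulr_ge0 ?sqr_ge0.
have := pC t^-1; rewrite invr_ge0 => /(_ (ltW t0)) h.
have tn0 : t != 0 by rewrite gt_eqF.
have -> : p.[t^-1] * expR (- t^-1) = (p.[t^-1] * t^-1 ^+ 2 * expR (- t^-1)) * t ^+ 2.
  by move: p.[_] (expR _) => P E; field.
by rewrite normrM [X in _ * X]ger0_norm ?sqr_ge0// ler_wpM2r ?sqr_ge0.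
Qed.

Let is_derive_flat_pos p (t : R) : 0 < t ->
  is_derive t 1 (fun t => p.[t^-1] * expR (- t^-1)) ((flatD p).[t^-1] * expR (- t^-1)).
Proof.
move=> t0; have tn0 : t != 0 by rewrite gt_eqF.
have dV : is_derive t 1 (fun t : R => t^-1) (- t ^- 2).
  have := is_derive_inv (f := id) tn0 (is_derive_id t 1).
  by rewrite mulr1.
have d1 := is_derive1_comp (is_derive_poly p t^-1) dV.
have d2 := @is_derive1_comp _ expR (fun t : R => - t^-1) t _ _ (is_derive_expR _) (is_deriveN dV).
have := is_deriveM d1 d2; move/is_derive_eq; apply.
rewrite /flatD hornerM hornerXn hornerD hornerN /GRing.scale/=.
by rewrite exprVn; field.
Qed.

Lemma is_derive_flatpoly p (t : R) : is_derive t 1 (flatpoly p) (flatpoly (flatD p) t).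
Proof.
have [t0|t0|->] := ltgtP t 0.
- rewrite /flatpoly [in X in is_derive _ _ _ X]ltNge ltW//=.
  apply: (@near_eq_is_derive _ _ _ (cst 0)) => //.
    by near=> s; rewrite ltNge ltW//; near: s; exact: lt_nbhsl.
- rewrite {2}/flatpoly t0; apply: near_eq_is_derive (is_derive_flat_pos p t0).
  by near=> s; rewrite /flatpoly ifT//; near: s; exact: lt_nbhsr.
- rewrite {2}/flatpoly ltxx.
  have [C C0 fC] := flatpoly_small p.
  have cv : (fun h : R => h^-1 *: (flatpoly p (h *: 1 + 0) - flatpoly p 0)) @ 0^' --> (0 : R).
    apply/cvgrPdist_le => e e0; near=> h.
    rewrite sub0r normrN /GRing.scale/= mulr1 addr0 {2}/flatpoly ltxx subr0 normrM.
    have h0 : h != 0 by near: h; exact: nbhs_dnbhs_neq.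
    rewrite normfV ler_pdivrMl ?normr_gt0// (le_trans (fC h))//.
    rewrite -[h ^+ 2]ger0_norm ?sqr_ge0// normrX expr2 mulrCA ler_wpM2l//.
    have : `|h| <= e / (C + 1).
      near: h; apply: nbhs_dnbhs; exists (e / (C + 1)) => /=; first by rewrite divr_gt0// ltr_wpDl.
      by move=> h /=; rewrite sub0r normrN => /ltW.
    rewrite ler_pdivlMr ?ltr_wpDl// mulrDr mulr1 mulrC; apply: le_trans.
    by rewrite lerDl.
  by apply: DeriveDef; [apply: cvgP cv | exact: cvg_lim cv].
Unshelve. all: by end_near. Qed.

Definition flat : R -> R := flatpoly 1.

Lemma flatE t : flat t = if 0 < t then expR (- t^-1) else 0.
Proof. by rewrite /flat /flatpoly hornerC mul1r. Qed.

Lemma smooth1_flat : smooth1 flat.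
Proof.
exists (fun n => flatpoly (iter n flatD 1)) => // n x; exact: is_derive_flatpoly.
Qed.

Lemma flat_ge0 t : 0 <= flat t.
Proof. by rewrite flatE; case: ifP => // _; rewrite expR_ge0. Qed.

Lemma flat_le1 t : flat t <= 1.
Proof.
rewrite flatE; case: ifP => // t0.
by rewrite expR_le1 oppr_le0 invr_ge0 ltW.
Qed.

Lemma cvg_invSn (s : R) : (fun n : nat => (n.+1%:R * s)^-1) @ \oo --> (0 : R).
Proof.
rewrite (_ : (fun _ => _) = (fun n : nat => s^-1 * harmonic n)); last first.
  by apply/funext => n; rewrite invfM mulrC.
rewrite -[X in _ --> X](mulr0 s^-1); apply: cvgM; first exact: cvg_cst.
exact: cvg_harmonic.
Qed.

(** Composed with flat, large multiples of a function approximate the indicator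
    of the set where it is positive: this is how smooth test functions reach
    indicators of intervals. *)
Lemma cvg_flat s :
  (fun n : nat => flat (n.+1%:R * s)) @ \oo --> (if 0 < s then 1 else 0 : R).
Proof.
case: ifPn => s0; last first.
  rewrite (_ : (fun _ => _) = cst 0); first exact: cvg_cst.
  apply/funext => n; rewrite flatE ifN// -leNgt mulr_ge0_le0//; by rewrite leNgt.
rewrite (_ : (fun _ => _) = (fun n : nat => expR (- (n.+1%:R * s)^-1))); last first.
  by apply/funext => n; rewrite flatE ifT// mulr_gt0.
rewrite -[X in _ --> X]expR0.
have u0 : (fun n : nat => - (n.+1%:R * s)^-1) @ \oo --> (0 : R).
  by rewrite -[X in _ --> X]oppr0; apply: cvgN; exact: cvg_invSn.
exact: (cvg_comp _ _ u0 (@continuous_expR R 0)).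
Qed.

End smooth1.

(** * Closure properties of C^m functions *)

Section space_time_smooth.
Context (R : realType).
Implicit Types (f g : spacetime R -> R).

Lemma Cm_continuous m f : Cm m f -> continuous f.
Proof. by case: m => [|m] []. Qed.

Lemma Cm_pred m f : Cm m.+1 f -> Cm m f.
Proof.
elim: m f => [|m IH] f /= [cf df]; first by split.
by split=> // v; have [dfv Cv] := df v; split=> //; exact: IH.
Qed.

Lemma Cm_cst m r : Cm m (cst r : spacetime R -> R).
Proof.
elim: m r => [|m IH] r /=; split=> //; try by move=> x; exact: cvg_cst.
move=> v; split; first by move=> p; exact: derivable_cst.
rewrite (_ : 'D_v _ = cst 0); first exact: IH.
by apply/funext => p; rewrite derive_cst.
Qed.

Lemma CmD m f g : Cm m f -> Cm m g -> Cm m (fun p => f p + g p).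
Proof.
elim: m f g => [|m IH] f g /= [cf df] [cg dg]; split=> //;
  try by move=> x; apply: cvgD; [exact: cf | exact: cg].
move=> v; have [dfv Cf] := df v; have [dgv Cg] := dg v; split.
  by move=> p; exact: derivableD.
rewrite (_ : 'D_v _ = fun p => 'D_v f p + 'D_v g p); first exact: IH.
by apply/funext => p; rewrite deriveD.
Qed.

Lemma CmM m f g : Cm m f -> Cm m g -> Cm m (fun p => f p * g p).
Proof.
elim: m f g => [|m IH] f g Cmf Cmg; have cf := Cm_continuous Cmf;
  have cg := Cm_continuous Cmg; split=> //;
  try by move=> x; apply: cvgM; [exact: cf | exact: cg].
move=> v; have [_ /(_ v) [dfv Cf]] := Cmf; have [_ /(_ v) [dgv Cg]] := Cmg; split.
  by move=> p; exact: derivableM.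
rewrite (_ : 'D_v _ = fun p => f p * 'D_v g p + g p * 'D_v f p).
  by apply: CmD; apply: IH => //; exact: Cm_pred.
by apply/funext => p; rewrite deriveM.
Qed.

Lemma Cm_comp m (h : R -> R) f : smooth1 h -> Cm m f -> Cm m (h \o f).
Proof.
elim: m h f => [|m IH] h f sh Cmf; have cf := Cm_continuous Cmf;
  have ch := smooth1_continuous sh; split=> //;
  try by move=> x; apply: continuous_comp; [exact: cf | exact: ch].
move=> v; have [_ /(_ v) [dfv Cf]] := Cmf; have [dh sdh hd] := smooth1_derive sh.
have D p : is_derive p v (h \o f) (dh (f p) * 'D_v f p).
  by apply: is_derive_dir_comp => //; exact: derivableP.
split; first by move=> p; case: (D p).
rewrite (_ : 'D_v _ = fun p => (dh \o f) p * 'D_v f p).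
  by apply: CmM => //; apply: IH => //; exact: Cm_pred.
by apply/funext => p; case: (D p).
Qed.

Lemma Cm_linear m f : continuous f ->
  (forall v p h, f (h *: v + p) = h * f v + f p) -> Cm m f.
Proof.
move=> cf fE; case: m => [|m]; split=> // v.
have D p : is_derive p v f (f v) by exact: is_derive_affine.
split; first by move=> p; case: (D p).
rewrite (_ : 'D_v _ = cst (f v)); first exact: Cm_cst.
by apply/funext => p; case: (D p).
Qed.

End space_time_smooth.

(** * Smooth functions on the torus built from sines and cosines *)

Section coordinates.
Context (R : realType).
Implicit Types (x y : space3 R) (j k : 'I_3).

Definition coord j x : R :=
  if j == 0 then x.1.1 else if j == 1 then x.1.2 else x.2.

Lemma coord_axis j k : coord j (axis R k) = (j == k)%:R.
Proof. by case: j => [[|[|[|j]]] hj] //; case: k => [[|[|[|k]]] hk]. Qed.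

Lemma coordDZ j h x y : coord j (h *: x + y) = h * coord j x + coord j y.
Proof. by rewrite /coord; case: ifP => // _; case: ifP. Qed.

Lemma coordD j x y : coord j (x + y) = coord j x + coord j y.
Proof. by rewrite /coord; case: ifP => // _; case: ifP. Qed.

Lemma continuous_coord j : continuous (coord j).
Proof.
move=> x; rewrite /coord; case: (j == 0); last case: (j == 1).
- by apply: (@continuous_comp _ _ _ fst fst); [exact: cvg_fst | exact: cvg_fst].
- by apply: (@continuous_comp _ _ _ fst snd); [exact: cvg_fst | exact: cvg_snd].
- exact: cvg_snd.
Qed.

Lemma measurable_coord j : measurable_fun [set: mspace3 R] (coord j : mspace3 R -> measurableTypeR R).
Proof.
rewrite /coord; case: (j == 0); last case: (j == 1).
- exact: (measurableT_comp measurable_fst measurable_fst).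
- exact: (measurableT_comp measurable_snd measurable_fst).
- exact: measurable_snd.
Qed.

End coordinates.

Section smooth_periodic.
Context (R : realType).
Implicit Types (f g : space3 R -> R) (j k : 'I_3).

(** A class of smooth periodic functions given by expressions, so that each
    property is proved by induction on the expression. It contains the
    mollification kernels and sufficiently many bumps. *)
Inductive sm : (space3 R -> R) -> Prop :=
| sm_cst r : sm (cst r)
| sm_cos k : sm (fun x => cos (2 * pi * coord k x))
| sm_sin k : sm (fun x => sin (2 * pi * coord k x))
| smD f g : sm f -> sm g -> sm (fun x => f x + g x)
| smM f g : sm f -> sm g -> sm (fun x => f x * g x)
| sm_comp h f : smooth1 h -> sm f -> sm (h \o f).

Lemma smZ r f : sm f -> sm (fun x => r * f x).
Proof. by move=> sf; exact: smM (sm_cst r) sf. Qed.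

Lemma sm_sum (I : Type) (s : seq I) (P : pred I) (h : I -> space3 R -> R) :
  (forall i, sm (h i)) -> sm (fun x => \sum_(i <- s | P i) h i x).
Proof.
move=> sh; rewrite (_ : (fun _ => _) = \sum_(i <- s | P i) h i); last first.
  by apply/funext => x; rewrite fct_sumE.
elim/big_rec : _ => [|i f Pi bf]; first exact: sm_cst.
exact: (smD (sh i) bf).
Qed.

Lemma is_derive_trig (h dh : R -> R) j k x :
  (forall t : R, is_derive t 1 h (dh t)) ->
  is_derive x (axis R k) (fun x => h (2 * pi * coord j x))
    (dh (2 * pi * coord j x) * (2 * pi * (j == k)%:R)).
Proof.
move=> dhP; apply: is_derive_dir_comp => //.
by apply: is_derive_affine => t; rewrite coordDZ coord_axis; ring.
Qed.

Lemma sm_derive f : sm f ->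
  forall k, exists2 df, sm df & forall x, is_derive x (axis R k) f (df x).
Proof.
elim=> [r|j|j|{}f g sf IHf sg IHg|{}f g sf IHf sg IHg|h {}f sh sf IHf] k.
- by exists (cst 0); [exact: sm_cst | move=> x; exact: is_derive_cst].
- exists (fun x => - sin (2 * pi * coord j x) * (2 * pi * (j == k)%:R)).
    rewrite (_ : (fun _ => _) = fun x =>
      (- (2 * pi * (j == k)%:R)) * sin (2 * pi * coord j x)).
      exact: smZ (sm_sin j).
    by apply/funext => x; ring.
  by move=> x; apply: (is_derive_trig (dh := fun t => - sin t)) => t; exact: is_derive_cos.
- exists (fun x => cos (2 * pi * coord j x) * (2 * pi * (j == k)%:R)).
    rewrite (_ : (fun _ => _) = fun x =>
      (2 * pi * (j == k)%:R) * cos (2 * pi * coord j x)).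
      exact: smZ (sm_cos j).
    by apply/funext => x; ring.
  by move=> x; apply: is_derive_trig => t; exact: is_derive_sin.
- have [df sdf dfP] := IHf k; have [dg sdg dgP] := IHg k.
  by exists (fun x => df x + dg x); [exact: smD | move=> x; exact: is_deriveD].
- have [df sdf dfP] := IHf k; have [dg sdg dgP] := IHg k.
  exists (fun x => f x * dg x + g x * df x); first by apply: smD; exact: smM.
  by move=> x; exact: is_deriveM.
- have [df sdf dfP] := IHf k; have [dh sdh dhP] := smooth1_derive sh.
  exists (fun x => (dh \o f) x * df x); first by apply: smM => //; exact: sm_comp.
  by move=> x; exact: is_derive_dir_comp.
Qed.

Lemma sm_continuous f : sm f -> continuous f.
Proof.
elim=> [r|j|j|{}f g sf IHf sg IHg|{}f g sf IHf sg IHg|h {}f sh sf IHf] x.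
- exact: cvg_cst.
- apply: (@continuous_comp _ _ _ (fun x => 2 * pi * coord j x) cos); last exact: continuous_cos.
  by apply: cvgM; [exact: cvg_cst | exact: continuous_coord].
- apply: (@continuous_comp _ _ _ (fun x => 2 * pi * coord j x) sin); last exact: continuous_sin.
  by apply: cvgM; [exact: cvg_cst | exact: continuous_coord].
- by apply: cvgD; [exact: IHf | exact: IHg].
- by apply: cvgM; [exact: IHf | exact: IHg].
- by apply: continuous_comp; [exact: IHf | exact: smooth1_continuous].
Qed.

Lemma sm_bmeas f : sm f -> @bmeas _ (mspace3 R) R f.
Proof.
have mc j : measurable_fun [set: mspace3 R] (fun x : mspace3 R => 2 * pi * coord j x :
  measurableTypeR R).
  by apply: measurable_funM; [exact: measurable_cst | exact: measurable_coord].
elim=> [r|j|j|{}f g sf IHf sg IHg|{}f g sf IHf sg IHg|h {}f sh sf IHf].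
- exact: bmeas_cst.
- split; last by exists 1 => x; rewrite ler_norml cos_geN1 cos_le1.
  apply: (measurableT_comp _ (mc j)); apply: continuous_measurable_fun; exact: continuous_cos.
- split; last by exists 1 => x; rewrite ler_norml sin_geN1 sin_le1.
  apply: (measurableT_comp _ (mc j)); apply: continuous_measurable_fun; exact: continuous_sin.
- exact: bmeasD.
- exact: bmeasM.
- have [mf [M fM]] := IHf; have ch := smooth1_continuous sh; split.
    by apply: measurableT_comp => //; exact: continuous_measurable_fun.
  have M0 : - M <= M by rewrite ge0_cp// (le_trans _ (fM 0)).
  have cwh : {within `[- M, M], continuous (Num.norm \o h)}.
    apply: continuous_subspaceT => x; apply: continuous_comp; first exact: ch.
    exact: norm_continuous.
  have [c _ cP] := EVT_max M0 cwh.
  by exists (`|h c|) => x; apply: cP; rewrite in_itv/= -ler_norml fM.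
Qed.

Lemma sm_periodic f : sm f -> Zperiodic f.
Proof.
have per1 (h : R -> R) (b : bool) (t : R) : (forall u, h (u + pi *+ 2) = h u) ->
    h (2 * pi * (t + b%:R)) = h (2 * pi * t).
  move=> ph; case: b; last by rewrite addr0.
  by rewrite -[in RHS]ph; congr h; rewrite mulrDr -(mulr_natl pi 2) [true%:R]/(1%:R) mulr1.
elim=> [r|j|j|{}f g sf IHf sg IHg|{}f g sf IHf sg IHg|h {}f sh sf IHf] k x //=.
- by rewrite coordD coord_axis (per1 cos)//; exact: cosD2pi.
- by rewrite coordD coord_axis (per1 sin)//; exact: sinD2pi.
- by rewrite IHf IHg.
- by rewrite IHf IHg.
- by rewrite IHf.
Qed.

(** Frozen-time expressions are C^m on space-time for every m, because the
    class of C^m functions is closed under the constructors of sm. *)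
Lemma sm_Cm f m : sm f -> Cm m (fun p : spacetime R => f p.1).
Proof.
have lin j : Cm m (fun p : spacetime R => 2 * pi * coord j p.1).
  apply: CmM; first exact: Cm_cst.
  apply: Cm_linear; last by move=> v p h; rewrite -coordDZ.
  move=> p; apply: (@continuous_comp _ _ _ fst (coord j)); first exact: cvg_fst.
  exact: continuous_coord.
elim=> [r|j|j|{}f g sf IHf sg IHg|{}f g sf IHf sg IHg|h {}f sh sf IHf].
- exact: Cm_cst.
- exact: (Cm_comp (smooth1_cos R) (lin j)).
- exact: (Cm_comp (smooth1_sin R) (lin j)).
- exact: CmD.
- exact: CmM.
- exact: Cm_comp sh IHf.
Qed.

Lemma smooth_tensor f (h : R -> R) : sm f ->
  (forall m, Cm m (fun p : spacetime R => h p.2)) ->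
  smooth (fun p : spacetime R => f p.1 * h p.2).
Proof.
move=> sf Ch; split => [m|t k x]; last by rewrite /= sm_periodic.
by apply: CmM; [exact: sm_Cm | exact: Ch].
Qed.

Lemma dx_tensor f (h : R -> R) k df x t : is_derive x (axis R k) f df ->
  dx k (fun p : spacetime R => f p.1 * h p.2) (x, t) = df * h t.
Proof.
move=> /is_deriveDirP d; rewrite /dx.
have : is_derive (x, t) (axis R k, 0) (fun p : spacetime R => f p.1 * h p.2) (df * h t).
  apply/is_deriveDirP.
  rewrite (_ : (fun r : R => _) = (fun r : R => f (r *: axis R k + x)) * cst (h t)).
    by apply: is_derive_eq; rewrite scaler0 add0r /GRing.scale/= mulrC.
  by apply/funext => r /=; rewrite scaler0 add0r.
by case.
Qed.

Lemma dt_tensor f (h : R -> R) dh x (t : R) : is_derive t 1 h dh ->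
  dt (fun p : spacetime R => f p.1 * h p.2) (x, t) = f x * dh.
Proof.
move=> /is_deriveDirP d; rewrite /dt.
have : is_derive (x, t) ((0, 1) : spacetime R) (fun p : spacetime R => f p.1 * h p.2) (f x * dh).
  apply/is_deriveDirP.
  rewrite (_ : (fun r : R => _) = cst (f x) * (fun r : R => h (r *: 1 + t))).
    by apply: is_derive_eq; rewrite scaler0 addr0.
  by apply/funext => r /=; rewrite scaler0 add0r.
by case.
Qed.

End smooth_periodic.

(** * Integration on the line *)

Section line_integrals.
Context (R : realType).
Notation leb := (@lebesgue_measure R).
Notation unit_itv := (`[0, 1[%classic : set R).

Lemma leb_itv_fin (a b : R) b0 b1 :
  (leb [set` Interval (BSide b0 a) (BSide b1 b)] < +oo)%E.
Proof. by rewrite lebesgue_measure_itv/=; case: ifP => _; rewrite ?ltry. Qed.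

Lemma leb_unit : leb unit_itv = 1%E.
Proof. by rewrite lebesgue_measure_itv/= lte_fin ltr01 oppr0 adde0. Qed.

Lemma leb_unit_fin : (leb unit_itv < +oo)%E. Proof. exact: leb_itv_fin. Qed.

Lemma Rint_derive (F f : R -> R) (a b : R) : a < b -> continuous f ->
  (forall t : R, is_derive t 1 F (f t)) ->
  \int[leb]_(t in `[a, b]) f t = F b - F a.
Proof.
move=> ab cf dF; have cF : continuous F by exact: is_derive_continuous dF.
rewrite /Rintegral (@continuous_FTC2 _ f F)//.
- exact: continuous_subspaceT.
- split; first by move=> t _; case: (dF t).
    exact/cvg_at_right_filter/cF.
  exact/cvg_at_left_filter/cF.
- by move=> t _; rewrite derive1E; case: (dF t).
Qed.

Lemma Rint_unit_cc (f : R -> R) : bmeas (f : measurableTypeR R -> R) ->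
  \int[leb]_(t in unit_itv) f t = \int[leb]_(t in `[0, 1]) f t.
Proof.
move=> bf; apply: Rintegral_itv_bndo_bndc; apply: bmeas_integrable => //.
exact: leb_itv_fin.
Qed.

Lemma Rint_unit_derive (F f : R -> R) : continuous f ->
  bmeas (f : measurableTypeR R -> R) ->
  (forall t : R, is_derive t 1 F (f t)) ->
  \int[leb]_(t in unit_itv) f t = F 1 - F 0.
Proof. by move=> cf bf dF; rewrite Rint_unit_cc//; exact: Rint_derive. Qed.

Lemma bmeas_locally_integrable (f : R -> R) :
  bmeas (f : measurableTypeR R -> R) -> locally_integrable [set: R] f.
Proof.
move=> bf; split; [by case: bf | exact: openT | move=> K _ cK].
have Kfin := compact_finite_measure cK; have mK := compact_measurable cK.
by case/integrableP : (@bmeas_integrable _ (measurableTypeR R) R leb K mK Kfin f bf).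
Qed.

Lemma ae_derive_primitive (f : R -> R) (a : R) :
  bmeas (f : measurableTypeR R -> R) ->
  {ae leb, forall x, a < x ->
    is_derive x 1 (fun x => \int[leb]_(t in `[a, x]) f t) (f x)}.
Proof.
move=> bf.
have bi y : leb.-integrable [set` Interval (BLeft a) (BRight y)] (EFin \o f).
  by apply: (@bmeas_integrable _ (measurableTypeR R)) => //; exact: leb_itv_fin.
have := FTC1 bi (bmeas_locally_integrable bf).
apply: filterS; first exact: (ae_filter_ringOfSetsType leb).
move=> x h ax; have [|d1 d2] := h; first by rewrite /= lte_fin.
by apply: DeriveDef; [exact: d1 | rewrite -derive1E; exact: d2].
Qed.

(** By Lebesgue's differentiation theorem, f is almost everywhere the
    derivative of its primitive. *)
Lemma ae0_of_primitive (f : R -> R) (a : R) (U : set R) :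
  bmeas (f : measurableTypeR R -> R) -> open U -> (forall x, U x -> a < x) ->
  (forall x, U x -> \int[leb]_(t in `[a, x]) f t = 0) ->
  {ae leb, forall x, U x -> f x = 0}.
Proof.
move=> bf oU Ua F0; apply: ae_mono (ae_derive_primitive a bf) => x dF Ux.
have [_ <-] := dF (Ua _ Ux); set F := (X in 'D_1 X x).
suff : is_derive x (1 : R) F (0 : R) by case.
have c0 : is_derive x (1 : R) (cst (0 : R) : R -> R) 0 by exact: is_derive_cst.
apply: near_eq_is_derive c0.
have : \forall y \near x, U y by exact: open_nbhs_nbhs.
by apply: filterS => y /F0 Fy; rewrite /F/= Fy.
Qed.

(** * A total family of bumps on the circle *)

(** By bumpE this is flat (n.+1 * sin (pi x) sin (pi (b - x))), where the
    product of sines is, for 0 < b < 1, positive on ]0, b[ and nonpositive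
    elsewhere in [0, 1[.
    The expanded form is polynomial in cos (2 pi x) and sin (2 pi x), hence
    1-periodic. *)
Definition bump (b : R) (n : nat) (x : R) : R :=
  flat (n.+1%:R * ((cos (2 * pi * x) * cos (pi * b) + sin (2 * pi * x) * sin (pi * b)
                   - cos (pi * b)) / 2)).

Lemma bumpE b n x : bump b n x = flat (n.+1%:R * (sin (pi * x) * sin (pi * (b - x)))).
Proof.
rewrite /bump; congr (flat (_ * _)).
have -> : 2 * pi * x = pi * x + pi * x by ring.
have -> : pi * (b - x) = pi * b - pi * x by ring.
rewrite cosD sinD sinB; have := cos2Dsin2 (pi * x).
move: (cos (pi * x)) (sin (pi * x)) (cos (pi * b)) (sin (pi * b)) => c s C S h.
apply/eqP; rewrite -subr_eq0.
have -> : ((c * c - s * s) * C + (s * c + c * s) * S - C) / 2 - s * (S * c - C * s) =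
   (c ^+ 2 + s ^+ 2 - 1) * C / 2 by field.
by rewrite h subrr !mul0r.
Qed.

Lemma continuous_flat : continuous (@flat R).
Proof. exact/smooth1_continuous/smooth1_flat. Qed.

Lemma bmeas_bump b n : bmeas (bump b n : measurableTypeR R -> R).
Proof.
split; last by exists 1 => x; rewrite ger0_norm ?flat_ge0 ?flat_le1.
have mcos : measurable_fun setT (fun x : measurableTypeR R => cos (2 * pi * x)).
  apply: measurableT_comp => //; apply: continuous_measurable_fun; exact: continuous_cos.
have msin : measurable_fun setT (fun x : measurableTypeR R => sin (2 * pi * x)).
  apply: measurableT_comp => //; apply: continuous_measurable_fun; exact: continuous_sin.
apply: (measurableT_comp (continuous_measurable_fun continuous_flat)).
apply: measurable_funM => //; apply: measurable_funM => //.
apply: measurable_funB => //; apply: measurable_funD; exact: measurable_funM.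
Qed.

(** The bumps converge to the indicators of the intervals ]0, b[, so that a
    function orthogonal to them has a vanishing primitive. *)
Lemma total_bump :
  total_on leb unit_itv
    [set g : measurableTypeR R -> R | exists b n, g = bump b n].
Proof.
move=> h bh h0.
have key b : 0 < b -> b < 1 -> \int[leb]_(x in unit_itv) (h x * \1_(`]0, b[%classic) x) = 0.
  move=> b0 b1; have [_ [M hM]] := bh.
  have : (fun n => \int[leb]_(x in unit_itv) (h x * bump b n x)) @ \oo -->
      \int[leb]_(x in unit_itv) (h x * \1_(`]0, b[%classic) x).
    apply: (@cvg_Rint _ _ _ _ _ _ leb_unit_fin _ _ M) => //.
    - by move=> n; apply: bmeasM => //; exact: bmeas_bump.
    - by apply: bmeasM => //; exact: bmeas_indic.
    - move=> n x _; rewrite normrM -[leRHS]mulr1 ler_pM//.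
      by rewrite ger0_norm ?flat_ge0 ?flat_le1.
    - move=> x /=; rewrite in_itv/= => /andP[x0 x1]; apply: cvgM; first exact: cvg_cst.
      rewrite (_ : bump b ^~ x = fun n => flat (n.+1%:R * (sin (pi * x) * sin (pi * (b - x)))));
        last first.
        by apply/funext => n; rewrite bumpE.
      have := @cvg_flat R (sin (pi * x) * sin (pi * (b - x))).
      rewrite (_ : (if _ then _ else _) = \1_(`]0, b[%classic) x)//.
      rewrite indicE; have p0 := pi_gt0 R.
      have [xe|xn0] := eqVneq x 0.
        by rewrite xe mulr0 sin0 mul0r ltxx memNset//= in_itv/= ltxx.
      have {}x0 : 0 < x by rewrite lt_neqAle eq_sym xn0.
      have sx : 0 < sin (pi * x).
        by apply: sin_gt0_pi; rewrite mulr_gt0//= gtr_pMr.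
      rewrite pmulr_rgt0//; have [xb|bx] := ltP x b.
        rewrite mem_set/= ?in_itv/= ?x0//.
        rewrite sin_gt0_pi// mulr_gt0 ?subr_gt0//= gtr_pMr//; lra.
      have xbF : (x < b) = false by apply/negbTE; rewrite -leNgt.
      rewrite memNset; last by rewrite /= in_itv/= xbF andbF.
      rewrite ifN//; rewrite -leNgt -(opprB x b) mulrN sinN oppr_le0 sin_ge0_pi//.
      by apply/andP; split; [rewrite mulr_ge0 ?subr_ge0// ltW | rewrite ger_pMr//; lra].
  rewrite (_ : (fun _ => _) = cst 0); first by move=> /(cvg_lim (@Rhausdorff _)); rewrite lim_cst.
  by apply/funext => n; apply: h0; exists b, n.
have : {ae leb, forall x, `]0%R, 1%R[%classic x -> h x = 0}.
  apply: (@ae0_of_primitive _ 0) => //; first by move=> x /=; rewrite in_itv/= => /andP[].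
  move=> x /=; rewrite in_itv/= => /andP[x0 x1].
  apply: etrans (key x x0 x1); rewrite /Rintegral.
  have bhx : bmeas (fun t => h t * \1_(`]0, x[%classic) t) by apply: bmeasM => //; exact: bmeas_indic.
  rewrite -integral_itv_obnd_cbnd; last first.
    by apply/measurable_EFinP/measurable_funTS; case: bh.
  rewrite -integral_itv_bndo_bndc; last first.
    by apply/measurable_EFinP/measurable_funTS; case: bh.
  congr fine; rewrite [LHS]integral_mkcond [RHS]integral_mkcond; apply: eq_integral => t _.
  case: (pselect (`]0, x[%classic t)) => tx.
    rewrite !patchE/= indicE (mem_set tx) mulr1 mem_set//.
    move: tx; rewrite /= !in_itv/= => /andP[t0 tx].
    by rewrite ltW//= (lt_trans tx).
  by rewrite !patchE/= indicE memNset// mulr0 if_same.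
move=> h01.
have n0 : {ae leb, forall x, x != 0 :> R}.
  exists [set 0]; split => //; first by rewrite lebesgue_measure_set1.
  by move=> x /= /negP; rewrite negbK => /eqP.
apply: ae_mono2 h01 n0 => x h01 xn0 /=; rewrite in_itv/= => /andP[x0 x1].
by apply: h01; rewrite /= in_itv/= x1 andbT lt_neqAle eq_sym xn0.
Qed.

End line_integrals.

(** * Means over the cell *)

Lemma Rint_eq0 d (T : measurableType d) (R : realType)
    (mu : {measure set T -> \bar R}) (D : set T) (f : T -> R) :
  measurable D -> (forall x, f x = 0) -> \int[mu]_(x in D) f x = 0.
Proof.
by move=> mD f0; rewrite -(Rint0 mu mD); apply: eq_Rintegral => x _.
Qed.

Section cell_mean.
Context (R : realType).
Notation leb := (@lebesgue_measure R).
Notation unit_itv := (`[0, 1[%classic : set R).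
Notation cell := (@cell R : set (mspace3 R)).
Notation square := (unit_itv `*` unit_itv).
Implicit Types (f g h : space3 R -> R).

Definition bm f := @bmeas _ (mspace3 R) R f.

(** The cell has measure 1, hence the name; see ave_cst. *)
Definition ave f : R := \int[mu_space R]_(x in cell) f x.

Lemma measurable_square : measurable (square : set (measurableTypeR R * measurableTypeR R)).
Proof. by apply: measurableX. Qed.

Lemma measurable_cell : measurable cell.
Proof. by apply: measurableX => //; exact: measurable_square. Qed.

Lemma square_fin : (mu_plane R square < +oo)%E.
Proof. by apply: prod_fin => //; exact: leb_unit_fin. Qed.

Lemma cell_fin : (mu_space R cell < +oo)%E.
Proof.
apply: prod_fin => //; [exact: measurable_square| exact: square_fin | exact: leb_unit_fin].
Qed.

Lemma mu_cell : mu_space R cell = 1%E.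
Proof.
have e2 : mu_plane R square = 1%E.
  have := product_measure1E leb leb (measurable_itv `[0%R, 1%R[) (measurable_itv `[0%R, 1%R[).
  by move=> e; exact: (etrans e (etrans (congr2 mule (leb_unit R) (leb_unit R)) (mule1 _))).
have := product_measure1E (mu_plane R) leb measurable_square (measurable_itv `[0%R, 1%R[).
by move=> e; exact: (etrans e (etrans (congr2 mule e2 (leb_unit R)) (mule1 _))).
Qed.

Lemma ave_iter2 f : bm f ->
  ave f = \int[leb]_(z in unit_itv) \int[mu_plane R]_(p in square) f (p, z).
Proof.
move=> bf; exact: (@Rint_prod2 _ _ _ _ R (mu_plane R) leb square unit_itv measurable_square
  (measurable_itv _) square_fin (leb_unit_fin R) f bf).
Qed.

Lemma ave_iter1 f : bm f ->
  ave f = \int[mu_plane R]_(p in square) \int[leb]_(z in unit_itv) f (p, z).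
Proof.
move=> bf; exact: (@Rint_prod1 _ _ _ _ R (mu_plane R) leb square unit_itv measurable_square
  (measurable_itv _) square_fin (leb_unit_fin R) f bf).
Qed.

Lemma plane_iter1 (f : R * R -> R) :
  @bmeas _ (measurableTypeR R * measurableTypeR R)%type R f ->
  \int[mu_plane R]_(p in square) f p =
  \int[leb]_(x in unit_itv) \int[leb]_(y in unit_itv) f (x, y).
Proof.
move=> bf; exact: (@Rint_prod1 _ _ _ _ R leb leb unit_itv unit_itv (measurable_itv _)
  (measurable_itv _) (leb_unit_fin R) (leb_unit_fin R) f bf).
Qed.

Lemma plane_iter2 (f : R * R -> R) :
  @bmeas _ (measurableTypeR R * measurableTypeR R)%type R f ->
  \int[mu_plane R]_(p in square) f p =
  \int[leb]_(y in unit_itv) \int[leb]_(x in unit_itv) f (x, y).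
Proof.
move=> bf; exact: (@Rint_prod2 _ _ _ _ R leb leb unit_itv unit_itv (measurable_itv _)
  (measurable_itv _) (leb_unit_fin R) (leb_unit_fin R) f bf).
Qed.

Lemma aveD f g : bm f -> bm g -> ave (fun x => f x + g x) = ave f + ave g.
Proof. exact: RintD measurable_cell cell_fin _ _. Qed.
Lemma aveB f g : bm f -> bm g -> ave (fun x => f x - g x) = ave f - ave g.
Proof. exact: RintB measurable_cell cell_fin _ _. Qed.
Lemma aveN f : bm f -> ave (fun x => - f x) = - ave f.
Proof. exact: RintN measurable_cell cell_fin _. Qed.
Lemma aveZl r f : bm f -> ave (fun x => r * f x) = r * ave f.
Proof. exact: RintZl measurable_cell cell_fin _ _. Qed.
Lemma aveZr r f : bm f -> ave (fun x => f x * r) = ave f * r.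
Proof. exact: RintZr measurable_cell cell_fin _ _. Qed.
Lemma ave_sum (I : Type) (s : seq I) (P : pred I) (F : I -> space3 R -> R) :
  (forall i, P i -> bm (F i)) ->
  ave (fun x => \sum_(i <- s | P i) F i x) = \sum_(i <- s | P i) ave (F i).
Proof. exact: Rint_sum measurable_cell cell_fin _ _ _ _. Qed.
Lemma ave_le f g : bm f -> bm g -> (forall x, f x <= g x) -> ave f <= ave g.
Proof. by move=> bf bg fg; exact: (@le_Rint _ _ _ _ _ measurable_cell cell_fin _ _ bf bg (fun x
  _ => fg x)). Qed.
Lemma ave_cst r : ave (cst r) = r.
Proof.
have e := Rintegral_cst (mu_space R) measurable_cell r.
exact: (etrans e (etrans (congr1 (fun t => r * fine t) mu_cell) (mulr1 r))).
Qed.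
Lemma ave_ge0 f : (forall x, 0 <= f x) -> 0 <= ave f.
Proof. by move=> f0; apply: Rintegral_ge0 => x _. Qed.
Lemma ave_norm_le f g : bm f -> bm g -> (forall x, `|f x| <= g x) -> `|ave f| <= ave g.
Proof. by move=> bf bg fg; exact: (@le_Rint_norm _ _ _ _ _ measurable_cell cell_fin _ _ bf bg
  (fun x _ => fg x)). Qed.
Lemma cvg_ave (f_ : nat -> space3 R -> R) f M : (forall n, bm (f_ n)) -> bm f ->
  (forall n x, `|f_ n x| <= M) -> (forall x, f_ ^~ x @ \oo --> f x) ->
  (fun n => ave (f_ n)) @ \oo --> ave f.
Proof.
move=> bf_ bf fM ff; exact: (@cvg_Rint _ _ _ (mu_space R) _ measurable_cell cell_fin
  f_ f M bf_ bf (fun n x _ => fM n x) (fun x _ => ff x)).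
Qed.
Lemma eq_ave f g : f =1 g -> ave f = ave g.
Proof. by move=> fg; congr ave; exact/funext. Qed.

(** * Functions of class C^1 on the torus *)

Definition grad (k : 'I_3) f : space3 R -> R := 'D_(axis R k) f.

Record C1p f : Prop := {
  C1p_per : Zperiodic f ;
  C1p_cont : continuous f ;
  C1p_bm : bm f ;
  C1p_der : forall k x, is_derive x (axis R k) f (grad k f x) ;
  C1p_gcont : forall k, continuous (grad k f) ;
  C1p_gbm : forall k, bm (grad k f) }.

Lemma gradE k f df : (forall x, is_derive x (axis R k) f (df x)) -> grad k f = df.
Proof. by move=> d; apply/funext => x; case: (d x). Qed.

Lemma C1pI f (df : 'I_3 -> space3 R -> R) : Zperiodic f -> continuous f -> bm f ->
  (forall k x, is_derive x (axis R k) f (df k x)) -> (forall k, continuous (df k)) ->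
  (forall k, bm (df k)) -> C1p f.
Proof.
move=> pf cf bf d cd bd; have e k := gradE (d k).
by split=> // k; rewrite e.
Qed.

Lemma grad_sm k f : sm f -> sm (grad k f).
Proof. by move=> sf; have [df sdf d] := sm_derive sf k; rewrite (gradE d). Qed.

Lemma sm_is_derive k f x : sm f -> is_derive x (axis R k) f (grad k f x).
Proof. by move=> sf; have [df sdf d] := sm_derive sf k; rewrite (gradE d). Qed.

Lemma sm_C1p f : sm f -> C1p f.
Proof.
move=> sf; split; [exact: sm_periodic|exact: sm_continuous|exact: sm_bmeas|..] => k.
- by move=> x; exact: sm_is_derive.
- exact/sm_continuous/grad_sm.
- exact/sm_bmeas/grad_sm.
Qed.

Lemma gradD k f g : C1p f -> C1p g ->
  grad k (fun x => f x + g x) = fun x => grad k f x + grad k g x.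
Proof.
by move=> cf cg; apply: gradE => x; apply: is_deriveD; exact: C1p_der.
Qed.

Lemma gradM k f g : C1p f -> C1p g ->
  grad k (fun x => f x * g x) = fun x => f x * grad k g x + g x * grad k f x.
Proof.
by move=> cf cg; apply: gradE => x; apply: is_deriveM; exact: C1p_der.
Qed.

Lemma gradV k f : C1p f -> (forall x, f x != 0) ->
  grad k (fun x => (f x)^-1) = fun x => - (f x) ^- 2 * grad k f x.
Proof.
by move=> cf f0; apply: gradE => x; apply: is_derive_inv => //; exact: C1p_der.
Qed.

Lemma C1pD f g : C1p f -> C1p g -> C1p (fun x => f x + g x).
Proof.
move=> cf cg; apply: (C1pI (df := fun k x => grad k f x + grad k g x)).
- by move=> k x; rewrite !C1p_per.
- by move=> x; apply: cvgD; exact: C1p_cont.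
- by apply: bmeasD; exact: C1p_bm.
- by move=> k x; apply: is_deriveD; exact: C1p_der.
- by move=> k x; apply: cvgD; exact: C1p_gcont.
- by move=> k; apply: bmeasD; exact: C1p_gbm.
Qed.

Lemma C1pM f g : C1p f -> C1p g -> C1p (fun x => f x * g x).
Proof.
move=> cf cg; apply: (C1pI (df := fun k x => f x * grad k g x + g x * grad k f x)).
- by move=> k x; rewrite !C1p_per.
- by move=> x; apply: cvgM; exact: C1p_cont.
- by apply: bmeasM; exact: C1p_bm.
- by move=> k x; apply: is_deriveM; exact: C1p_der.
- by move=> k x; apply: cvgD; (apply: cvgM; [exact: C1p_cont | exact: C1p_gcont]).
- by move=> k; apply: bmeasD; (apply: bmeasM; [exact: C1p_bm | exact: C1p_gbm]).
Qed.

Lemma C1p_cst r : C1p (cst r). Proof. exact/sm_C1p/sm_cst. Qed.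

Lemma C1pZ r f : C1p f -> C1p (fun x => r * f x).
Proof. by move=> cf; exact: C1pM (C1p_cst r) cf. Qed.

Lemma C1pN f : C1p f -> C1p (fun x => - f x).
Proof.
by move=> /(C1pZ (-1)); rewrite (_ : (fun _ => _) = fun x => - f x)//; apply/funext => x;
  rewrite mulN1r.
Qed.

Lemma gradN k f : C1p f -> grad k (fun x => - f x) = fun x => - grad k f x.
Proof. by move=> cf; apply: gradE => x; apply: is_deriveN; exact: C1p_der. Qed.

Lemma bm_inv f e : 0 < e -> bm f -> (forall x, e <= f x) -> bm (fun x => (f x)^-1).
Proof.
move=> e0 [mf _] fe; split; last first.
  exists e^-1 => x; have f0 := lt_le_trans e0 (fe x).
  by rewrite ger0_norm ?lef_pV2 ?posrE// invr_ge0 ltW.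
rewrite (_ : (fun _ => _) = (fun t => (Num.max t e)^-1) \o f); last first.
  by apply/funext => x /=; rewrite max_l.
apply: measurableT_comp => //; apply: continuous_measurable_fun => t.
apply: cvgV; first by rewrite gt_eqF// lt_max e0 orbT.
by apply: (@continuous_max _ _ id (cst e)) => //; exact: cvg_cst.
Qed.

Lemma C1pV f e : 0 < e -> C1p f -> (forall x, e <= f x) -> C1p (fun x => (f x)^-1).
Proof.
move=> e0 cf fe.
have f0 x : f x != 0 by rewrite gt_eqF// (lt_le_trans e0).
have bfV : bm (fun x => (f x)^-1) by exact: bm_inv e0 (C1p_bm cf) fe.
have cV x : {for x, continuous (fun x => (f x)^-1)} by apply: cvgV => //; exact: C1p_cont.
apply: (C1pI (df := fun k x => - (f x) ^- 2 * grad k f x)) => //.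
- by move=> k x; rewrite !C1p_per.
- by move=> k x; apply: is_derive_inv => //; exact: C1p_der.
- move=> k x; rewrite (_ : (fun x => _) = fun x => - ((f x)^-1 * (f x)^-1) * grad k f x); last first.
    by apply/funext => y; rewrite expr2 invfM.
  by apply: cvgM; [apply: cvgN; apply: cvgM; exact: cV | exact: C1p_gcont].
- move=> k; rewrite (_ : (fun x => _) = fun x => - ((f x)^-1 * (f x)^-1) * grad k f x); last first.
    by apply/funext => y; rewrite expr2 invfM.
  by apply: bmeasM; [apply: bmeasN; exact: bmeasM | exact: C1p_gbm].
Qed.

(** * Integration by parts *)

Lemma is_derive_line f k (x : space3 R) (df : space3 R -> R) (s : R) :
  (forall x, is_derive x (axis R k) f (df x)) ->
  is_derive s 1 (fun s : R => f (s *: axis R k + x)) (df (s *: axis R k + x)).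
Proof.
move=> d; apply/is_deriveDirP; have /is_deriveDirP := d (s *: axis R k + x).
rewrite (_ : (fun h : R => f (h *: axis R k + (s *: axis R k + x))) =
  (fun h : R => f ((h *: 1 + s) *: axis R k + x)))//.
by apply/funext => h; rewrite [h *: 1]mulr1 scalerDl addrA.
Qed.

Lemma continuous_line k (x : space3 R) : continuous (fun s : R => s *: axis R k + x).
Proof. by move=> s; apply: cvgD; [apply: cvgZr_tmp | exact: cvg_cst]. Qed.

Lemma line0 (s y z : R) : (s, y, z) = s *: axis R 0 + ((0, y), z) :> space3 R.
Proof.
by congr (_, _, _); rewrite /= ?[_ *: 1]mulr1 ?[_ *: 0]mulr0 ?addr0 ?add0r.
Qed.
Lemma line1 (s x z : R) : (x, s, z) = s *: axis R 1 + ((x, 0), z) :> space3 R.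
Proof.
by congr (_, _, _); rewrite /= ?[_ *: 1]mulr1 ?[_ *: 0]mulr0 ?addr0 ?add0r.
Qed.
Lemma line2 (s x y : R) : (x, y, s) = s *: axis R 2 + ((x, y), 0) :> space3 R.
Proof.
by congr (_, _, _); rewrite /= ?[_ *: 1]mulr1 ?[_ *: 0]mulr0 ?addr0 ?add0r.
Qed.

(** Integrating first in the direction of the derivative, the boundary terms
    cancel by periodicity. *)
Lemma ave_grad k f : C1p f -> ave (grad k f) = 0.
Proof.
move=> cf; have bg := C1p_gbm cf k.
have line (x : space3 R) : bmeas (fun s : measurableTypeR R => grad k f (s *: axis R k + x)) ->
    \int[leb]_(s in unit_itv) grad k f (s *: axis R k + x) = 0.
  move=> bl.
  have cl : continuous (fun s : R => grad k f (s *: axis R k + x)).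
    move=> s; apply: (@continuous_comp _ _ _ (fun s : R => s *: axis R k + x)).
      exact: continuous_line.
    exact: (C1p_gcont cf).
  have dl (s : R) := is_derive_line x s (C1p_der cf k).
  have -> := Rint_unit_derive cl bl dl.
  by rewrite scale1r scale0r add0r [axis R k + x]addrC (C1p_per cf) subrr.
have kE : [\/ k = 0, k = 1 | k = 2].
  case: k {bg line} => [[|[|[|//]]] hk]; [apply: Or31|apply: Or32|apply: Or33]; exact: val_inj.
case: kE => ke; subst k.
- rewrite ave_iter2//; apply: Rint_eq0 => // z.
  have bz := bmeas_slice2 z bg; rewrite plane_iter2//.
  apply: Rint_eq0 => // y.
  have by_ := bmeas_slice2 y bz; have e (s : R) : grad 0 f ((s, y), z) = grad 0 f (s *: axis R 0
    + ((0, y), z)).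
    by rewrite -line0.
  transitivity (\int[leb]_(s in unit_itv) grad 0 f (s *: axis R 0 + ((0, y), z))).
    by apply: eq_Rintegral => s _; exact: e.
  apply: line; rewrite (_ : (fun s => _) = (fun s => grad 0 f ((s, y), z))); first exact: by_.
  by apply/funext => s; rewrite -e.
- rewrite ave_iter2//; apply: Rint_eq0 => // z.
  have bz := bmeas_slice2 z bg; rewrite plane_iter1//.
  apply: Rint_eq0 => // x.
  have by_ := bmeas_slice1 x bz; have e (s : R) : grad 1 f ((x, s), z) = grad 1 f (s *: axis R 1
    + ((x, 0), z)).
    by rewrite -line1.
  transitivity (\int[leb]_(s in unit_itv) grad 1 f (s *: axis R 1 + ((x, 0), z))).
    by apply: eq_Rintegral => s _; exact: e.
  apply: line; rewrite (_ : (fun s => _) = (fun s => grad 1 f ((x, s), z))); first exact: by_.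
  by apply/funext => s; rewrite -e.
- rewrite ave_iter1//; apply: Rint_eq0 => [|[x y]]; first exact: measurable_square.
  have by_ := bmeas_slice1 (x, y) bg; have e (s : R) : grad 2 f ((x, y), s) = grad 2 f (s *:
    axis R 2 + ((x, y), 0)).
    by rewrite -line2.
  transitivity (\int[leb]_(s in unit_itv) grad 2 f (s *: axis R 2 + ((x, y), 0))).
    by apply: eq_Rintegral => s _; exact: e.
  apply: line; rewrite (_ : (fun s => _) = (fun s => grad 2 f ((x, y), s))); first exact: by_.
  by apply/funext => s; rewrite -e.
Qed.

Lemma ave_byparts k f g : C1p f -> C1p g ->
  ave (fun x => f x * grad k g x) = - ave (fun x => g x * grad k f x).
Proof.
move=> cf cg; have := ave_grad k (C1pM cf cg); rewrite gradM// aveD.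
- by move/eqP; rewrite addr_eq0 => /eqP.
- by apply: bmeasM; [exact: C1p_bm | exact: C1p_gbm].
- by apply: bmeasM; [exact: C1p_bm | exact: C1p_gbm].
Qed.

(** * Smooth periodic functions are total on the cell *)

Lemma sm_bump k (b : R) n : sm (fun x : space3 R => bump b n (coord k x)).
Proof.
have sh := smooth1_scale n.+1%:R (smooth1_flat R).
apply: (sm_comp (h := fun t => flat (n.+1%:R * t))
  (f := fun x => (cos (2 * pi * coord k x) * cos (pi * b) +
     sin (2 * pi * coord k x) * sin (pi * b) - cos (pi * b)) / 2)) => //.
apply: (@smM _ _ (cst 2^-1)); last exact: sm_cst.
apply: (@smD _ _ (cst (- cos (pi * b)))); last exact: sm_cst.
apply: smD.
- by apply: (@smM _ _ (cst (cos (pi * b)))); [exact: sm_cos | exact: sm_cst].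
- by apply: (@smM _ _ (cst (sin (pi * b)))); [exact: sm_sin | exact: sm_cst].
Qed.

Lemma sm_total (h : space3 R -> R) : bm h ->
  (forall g, sm g -> ave (fun x => h x * g x) = 0) ->
  {ae mu_space R, forall x, cell x -> h x = 0}.
Proof.
move=> bh h0.
pose B := [set g : measurableTypeR R -> R | exists b n, g = bump b n].
have bB : B `<=` bmeas (R := R) by move=> _ [b [n ->]]; exact: bmeas_bump.
have t1 := @total_bump R.
have t2 := @total_prod R _ _ _ _ leb leb unit_itv unit_itv _ _ (measurable_itv _)
  (measurable_itv _) (leb_unit_fin R) (leb_unit_fin R) bB bB t1 t1.
set B2 := (X in total_on _ _ X) in t2.
have bB2 : B2 `<=` bmeas (R := R).
  move=> _ [g1 /bB b1 [g2 /bB b2 ->]].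
  by apply: bmeasM; [exact: bmeas_fst | exact: bmeas_snd].
have t3 := @total_prod R _ _ _ _ (mu_plane R) leb square unit_itv _ _ measurable_square
  (measurable_itv _) square_fin (leb_unit_fin R) bB2 bB t2 t1.
apply: (t3 h bh) => _ [_ [_ [b1 [n1 ->]] [_ [b2 [n2 ->]] ->]]] [_ [b3 [n3 ->]] ->] /=.
apply: (h0 (fun x => bump b1 n1 (coord 0 x) * bump b2 n2 (coord 1 x) * bump b3 n3 (coord 2 x))).
by apply: smM; [apply: smM|]; exact: sm_bump.
Qed.

End cell_mean.

(** * A positive trigonometric kernel *)

Section kernel.
Context (R : realType).
Notation leb := (@lebesgue_measure R).
Notation unit_itv := (`[0, 1[%classic : set R).
Implicit Types (x y : space3 R) (z t : R).

(** This is cos (pi z)^2: it equals 1 exactly at the integers, so that its large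
    powers concentrate there. *)
Definition hump z : R := (1 + cos (2 * pi * z)) / 2.

(** The Wallis integrals of hump ^+ N over a period; see Rint_hump. *)
Fixpoint hump_mass (N : nat) : R :=
  if N is M.+1 then hump_mass M * ((2 * M%:R + 1) / (2 * M%:R + 2)) else 1.

Lemma hump_ge0 z : 0 <= hump z.
Proof. by rewrite /hump; have := cos_geN1 (2 * pi * z); lra. Qed.

Lemma hump_le1 z : hump z <= 1.
Proof. by rewrite /hump; have := cos_le1 (2 * pi * z); lra. Qed.

Lemma hump_mass_gt0 N : 0 < hump_mass N.
Proof.
elim: N => [|N IH] //=; have N0 : 0 <= N%:R :> R by [].
by rewrite mulr_gt0// divr_gt0//; lra.
Qed.

Lemma hump_massS N : hump_mass N - hump_mass N.+1 = hump_mass N / (2 * N%:R + 2).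
Proof.
have N0 : 0 <= N%:R :> R by [].
by rewrite /=; field; lra.
Qed.

Lemma humpD1 z : hump (z + 1) = hump z.
Proof.
rewrite /hump; congr ((1 + _) / 2); rewrite mulrDr mulr1 mulr_natl.
exact: cosD2pi.
Qed.

Lemma humpN z : hump (- z) = hump z.
Proof. by rewrite /hump mulrN cosN. Qed.

Lemma is_derive_hump z : is_derive z (1 : R) hump (- pi * sin (2 * pi * z)).
Proof.
have d1 : is_derive z (1 : R) (fun z : R => 2 * pi * z) (2 * pi).
  by apply: is_derive_affine => h; rewrite [h *: 1]mulr1; ring.
have d2 := is_derive1_comp (is_derive_cos (2 * pi * z)) d1.
have d3 := is_deriveM (is_deriveD (is_derive_cst (1 : R) z 1) d2) (is_derive_cst (2^-1 : R) z 1).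
apply: (is_derive_eq d3).
by rewrite scaler0 add0r /GRing.scale/=; field.
Qed.

(** The recursion of the Wallis integrals, in differential form. The function q
    is the periodic part of the antiderivative of hump ^+ N, whose linear part
    has slope hump_mass N. *)
Lemma hump_primitive N : exists2 q : R -> R, (forall z, q (z + 1) = q z) &
  forall z, is_derive z (1 : R) q (hump z ^+ N - hump_mass N).
Proof.
elim: N => [|N [q qper dq]].
  by exists (cst 0) => // z; rewrite expr0 subrr; exact: is_derive_cst.
have N0 : 0 <= N%:R :> R by [].
have p0 := pi_gt0 R.
exists (fun z => (2 * N%:R + 1) / (2 * N%:R + 2) * q z +
    (4 * pi * (N%:R + 1))^-1 * (sin (2 * pi * z) * hump z ^+ N)) => z.
  have -> : sin (2 * pi * (z + 1)) = sin (2 * pi * z).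
    by rewrite mulrDr mulr1 mulr_natl; exact: sinD2pi.
  by rewrite qper humpD1.
have d1 : is_derive z (1 : R) (fun z : R => 2 * pi * z) (2 * pi).
  by apply: is_derive_affine => h; rewrite [h *: 1]mulr1; ring.
have ds := is_derive1_comp (is_derive_sin (2 * pi * z)) d1.
have dX : is_derive z (1 : R) (fun z => hump z ^+ N) (N%:R * hump z ^+ N.-1 * (- pi * sin (2 *
  pi * z))).
  rewrite (_ : (fun z => _) = hump ^+ N); last by apply/funext => t; rewrite exprfctE.
  apply: (is_derive_eq (is_deriveX N (is_derive_hump z))).
  by rewrite /GRing.scale/= mulr_natl.
have d := is_deriveD (is_deriveZ ((2 * N%:R + 1) / (2 * N%:R + 2)) (dq z))
  (is_deriveZ ((4 * pi * (N%:R + 1))^-1) (is_deriveM ds dX)).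
apply: (is_derive_eq d); rewrite /GRing.scale/=.
have cE : cos (2 * pi * z) = 2 * hump z - 1 by rewrite /hump; field.
have sE : sin (2 * pi * z) * sin (2 * pi * z) = 4 * hump z * (1 - hump z).
  have := cos2Dsin2 (2 * pi * z); rewrite cE -expr2 => h.
  by rewrite -[LHS](addKr ((2 * hump z - 1) ^+ 2)) h; ring.
have -> : hump z ^+ N * (cos (2 * pi * z) * (2 * pi)) = (2 * pi) * (2 * hump z ^+ N.+1 - hump z ^+ N).
  by rewrite cE exprS; ring.
have -> : sin (2 * pi * z) * (N%:R * hump z ^+ N.-1 * (- pi * sin (2 * pi * z))) =
    - (4 * pi * N%:R) * (hump z ^+ N - hump z ^+ N.+1).
  transitivity (- (pi * N%:R) * hump z ^+ N.-1 * (sin (2 * pi * z) * sin (2 * pi * z))); first by ring.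
  rewrite sE; case: (N) => [|M]; first by rewrite !mulr0 oppr0 !mul0r.
  by rewrite /= !exprS; ring.
rewrite /=; move: (hump z ^+ N.+1) (hump z ^+ N) => B A.
field; apply/and3P; split; lra.
Qed.

Lemma bmeas_hump a N : bmeas (fun t : measurableTypeR R => hump (a - t) ^+ N).
Proof.
split; last first.
  by exists 1 => t; rewrite ger0_norm ?exprn_ge0 ?exprn_ile1 ?hump_ge0 ?hump_le1.
apply: continuous_measurable_fun => t.
apply: (@continuous_comp _ _ _ (fun t => hump (a - t)) (fun u => u ^+ N)).
  apply: (@continuous_comp _ _ _ (fun t : R => a - t) hump).
    by apply: cvgB; [exact: cvg_cst | exact: cvg_id].
  exact: (is_derive_continuous is_derive_hump).
exact: exprn_continuous.
Qed.

Lemma Rint_hump a N : \int[leb]_(t in unit_itv) hump (a - t) ^+ N = hump_mass N.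
Proof.
have [q qper dq] := hump_primitive N.
have ch : continuous hump by exact: is_derive_continuous is_derive_hump.
have ch' : continuous (fun t => hump (a - t) ^+ N).
  move=> t; apply: (@continuous_comp _ _ _ (fun t => hump (a - t)) (fun u => u ^+ N)).
    apply: (@continuous_comp _ _ _ (fun t : R => a - t) hump); last exact: ch.
    by apply: cvgB; [exact: cvg_cst | exact: cvg_id].
  exact: exprn_continuous.
have bh := bmeas_hump a N.
have dQ t : is_derive t (1 : R) (fun t => hump_mass N * t - q (a - t)) (hump (a - t) ^+ N).
  have d1 : is_derive t (1 : R) (fun t : R => a - t) (-1).
    by apply: is_derive_affine => h; rewrite [h *: 1]mulr1; ring.
  have d2 : is_derive t (1 : R) (fun t : R => hump_mass N * t) (hump_mass N).
    by apply: is_derive_affine => h; rewrite [h *: 1]mulr1; ring.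
  have d3 := @is_derive1_comp _ q (fun t : R => a - t) t _ _ (dq (a - t)) d1.
  by apply: (is_derive_eq (is_deriveB d2 d3)); ring.
rewrite (Rint_unit_derive ch' bh dQ) subr0 -{2}(subrK 1 a) qper.
by ring.
Qed.

Definition kern N z : R := hump z ^+ N / hump_mass N.

Lemma kern_ge0 N z : 0 <= kern N z.
Proof. by rewrite divr_ge0 ?exprn_ge0 ?hump_ge0// ltW// hump_mass_gt0. Qed.

Lemma bmeas_kern a N : bmeas (fun t : measurableTypeR R => kern N (a - t)).
Proof. exact: bmeasM (bmeas_hump a N) (bmeas_cst _ _). Qed.

Lemma Rint_kern a N : \int[leb]_(t in unit_itv) kern N (a - t) = 1.
Proof.
rewrite RintZr ?Rint_hump ?divff//; [|exact: leb_unit_fin|exact: bmeas_hump].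
by rewrite gt_eqF// hump_mass_gt0.
Qed.

(** This moment tends to 0 with no estimate of the tails of the kernel: it is a
    ratio of consecutive Wallis integrals. *)
Lemma Rint_kern_moment a N :
  \int[leb]_(t in unit_itv) (kern N (a - t) * (1 - hump (a - t))) = (2 * N%:R + 2)^-1.
Proof.
transitivity (\int[leb]_(t in unit_itv) ((hump (a - t) ^+ N - hump (a - t) ^+ N.+1) / hump_mass N)).
  by apply: eq_Rintegral => t _; rewrite /kern exprS; ring.
have h0 := hump_mass_gt0 N.
have bN := bmeas_hump a N; have bS := bmeas_hump a N.+1.
have -> := @RintZr _ _ _ leb unit_itv (measurable_itv _) (leb_unit_fin R) _ _ (bmeasB bN bS).
have -> := @RintB _ _ _ leb unit_itv (measurable_itv _) (leb_unit_fin R) _ _ bN bS.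
rewrite !Rint_hump hump_massS mulrAC divff ?mul1r// gt_eqF//.
Qed.

(** * The kernel on the torus *)

Lemma ave_prod (g : 'I_3 -> R -> R) : (forall j, bmeas (g j : measurableTypeR R -> R)) ->
  ave (fun x => \prod_(j < 3) g j (coord j x)) = \prod_(j < 3) \int[leb]_(t in unit_itv) g j t.
Proof.
move=> bg; rewrite !big_ord_recl !big_ord0 !mulr1.
set g0 := g _; set g1 := g (lift _ _); set g2 := g (lift _ (lift _ _)).
have b0 : bmeas (g0 : measurableTypeR R -> R) := bg _.
have b1 : bmeas (g1 : measurableTypeR R -> R) := bg _.
have b2 : bmeas (g2 : measurableTypeR R -> R) := bg _.
have bp : @bmeas _ (measurableTypeR R * measurableTypeR R)%type R (fun p => g0 p.1 * g1 p.2).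
  by apply: bmeasM; [exact: bmeas_fst | exact: bmeas_snd].
transitivity (ave (fun x : space3 R => g0 x.1.1 * g1 x.1.2 * g2 x.2)).
  by apply: eq_ave => x; rewrite !big_ord_recl big_ord0 mulr1 mulrA.
rewrite ave_iter2; last first.
  exact: (bmeasM (@bmeas_fst _ _ (measurableTypeR R * measurableTypeR R)%type
    (measurableTypeR R) R _ bp) (@bmeas_snd _ _ (measurableTypeR R * measurableTypeR R)%type
    (measurableTypeR R) R _ b2)).
transitivity (\int[leb]_(z in unit_itv) ((\int[mu_plane R]_(p in (unit_itv `*` unit_itv)) (g0
  p.1 * g1 p.2)) * g2 z)).
  apply: eq_Rintegral => z _; rewrite /= RintZr//.
    exact: measurable_square.
  exact: square_fin.
rewrite RintZl ?leb_unit_fin//.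
rewrite plane_iter1// mulrA; congr (_ * _).
transitivity (\int[leb]_(x in unit_itv) (g0 x * \int[leb]_(y in unit_itv) g1 y)).
  by apply: eq_Rintegral => z _; rewrite /= RintZl ?leb_unit_fin.
by rewrite RintZr ?leb_unit_fin.
Qed.

Definition K N x y : R := \prod_(j < 3) kern N (coord j y - coord j x).

Lemma K_ge0 N x y : 0 <= K N x y.
Proof. by apply: prodr_ge0 => j _; exact: kern_ge0. Qed.

Lemma KC N x y : K N x y = K N y x.
Proof. by apply: eq_bigr => j _; rewrite /kern -humpN opprB. Qed.

Lemma ave_K N y : ave (fun x => K N x y) = 1.
Proof.
rewrite (ave_prod (g := fun j t => kern N (coord j y - t))); last by move=> j; exact: bmeas_kern.
by rewrite big1// => j _; rewrite Rint_kern.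
Qed.

Lemma ave_K_moment N k y :
  ave (fun x => K N x y * (1 - hump (coord k y - coord k x))) = (2 * N%:R + 2)^-1.
Proof.
pose g j t := kern N (coord j y - t) * (if j == k then 1 - hump (coord k y - t) else 1).
have bg j : bmeas (g j : measurableTypeR R -> R).
  apply: bmeasM; first exact: bmeas_kern.
  case: (j == k); last exact: bmeas_cst.
  by apply: bmeasB; [exact: bmeas_cst | exact: (bmeas_hump _ 1)].
transitivity (ave (fun x => \prod_(j < 3) g j (coord j x))).
  apply: eq_ave => x; rewrite big_split/=; congr (_ * _).
  by rewrite (bigD1 k)//= eqxx big1 ?mulr1// => j /negbTE ->.
rewrite ave_prod// (bigD1 k)//= big1 ?mulr1 => [|j /negbTE jk].
  apply: etrans _ (Rint_kern_moment (coord k y) N); apply: eq_Rintegral => t _.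
  by rewrite /g eqxx.
apply: etrans _ (Rint_kern (coord j y) N); apply: eq_Rintegral => t _.
by rewrite /g jk mulr1.
Qed.

(** * Separation of variables *)

(** Kernels of finite rank. Mollification with such a kernel only involves the
    integrals of the function against finitely many test functions. *)
Inductive sep : (space3 R -> space3 R -> R) -> Prop :=
| sep1 e f : sm e -> sm f -> sep (fun x y => e x * f y)
| sepD k1 k2 : sep k1 -> sep k2 -> sep (fun x y => k1 x y + k2 x y).

Lemma sepM k1 k2 : sep k1 -> sep k2 -> sep (fun x y => k1 x y * k2 x y).
Proof.
move=> s1; elim: s1 k2 => [e f se sf|{}k1 k1' _ IH1 _ IH1'] k2 s2; last first.
  rewrite (_ : (fun _ _ => _) = fun x y => k1 x y * k2 x y + k1' x y * k2 x y).
    by apply: sepD; [exact: IH1 | exact: IH1'].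
  by apply/funext => x; apply/funext => y; rewrite mulrDl.
elim: s2 => [e' f' se' sf'|{}k2 k2' _ IH2 _ IH2'].
  rewrite (_ : (fun _ _ => _) = fun x y => (e x * e' x) * (f y * f' y)).
    by apply: (sep1 (e := fun x => e x * e' x) (f := fun y => f y * f' y)); exact: smM.
  by apply/funext => x; apply/funext => y; ring.
rewrite (_ : (fun _ _ => _) = fun x y => e x * f y * k2 x y + e x * f y * k2' x y).
  exact: sepD.
by apply/funext => x; apply/funext => y; rewrite mulrDr.
Qed.

Lemma sep_cst r : sep (fun _ _ => r).
Proof.
rewrite (_ : (fun _ _ => _) = fun x y => (cst r x : R) * cst 1 y).
  by apply: sep1; exact: sm_cst.
by apply/funext => x; apply/funext => y; rewrite /= mulr1.
Qed.

Lemma sep_hump k : sep (fun x y => hump (coord k y - coord k x)).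
Proof.
rewrite (_ : (fun _ _ => _) = fun x y : space3 R => 2^-1 * (1 +
   (cos (2 * pi * coord k x) * cos (2 * pi * coord k y) +
    sin (2 * pi * coord k x) * sin (2 * pi * coord k y)))).
  apply: sepM; first exact: sep_cst.
  apply: sepD; first exact: sep_cst.
  apply: sepD.
    exact: (@sep1 _ _ (sm_cos R k) (sm_cos R k)).
  exact: (@sep1 _ _ (sm_sin R k) (sm_sin R k)).
apply/funext => x; apply/funext => y; rewrite /hump mulrBr cosB.
by ring.
Qed.

Lemma sep_K N : sep (K N).
Proof.
have sX k M : sep (fun x y => hump (coord k y - coord k x) ^+ M).
  elim: M => [|M IH]; first exact: sep_cst.
  rewrite (_ : (fun _ _ => _) = fun x y : space3 R => hump (coord k y - coord k x) *
      hump (coord k y - coord k x) ^+ M); first exact: sepM (sep_hump k) IH.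
  by apply/funext => x; apply/funext => y; rewrite exprS.
have sk j : sep (fun x y => kern N (coord j y - coord j x)).
  exact: sepM (sX j N) (sep_cst _).
rewrite (_ : K N = fun x y => kern N (coord ord0 y - coord ord0 x) *
    (kern N (coord (lift ord0 ord0) y - coord (lift ord0 ord0) x) *
     kern N (coord (lift ord0 (lift ord0 ord0)) y - coord (lift ord0 (lift ord0 ord0)) x))).
  by apply: sepM => //; exact: sepM.
by apply/funext => x; apply/funext => y; rewrite /K !big_ord_recl big_ord0 mulr1.
Qed.

Lemma sep_sum k : sep k -> exists m (e f : nat -> space3 R -> R),
  [/\ forall i, sm (e i), forall i, sm (f i) &
      forall x y, k x y = \sum_(i < m) e i x * f i y].
Proof.
elim=> [e f se sf|{}k k' _ [m [e [f [se sf kE]]]] _ [m' [e' [f' [se' sf' kE']]]]].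
  exists 1%N, (fun=> e), (fun=> f); split=> // x y.
  by rewrite big_ord1.
exists (m + m')%N, (fun i => if (i < m)%N then e i else e' (i - m)%N),
  (fun i => if (i < m)%N then f i else f' (i - m)%N); split.
- by move=> i; case: ifP.
- by move=> i; case: ifP.
- move=> x y; rewrite kE kE' big_split_ord/=; congr (_ + _); apply: eq_bigr => i _.
    by rewrite ltn_ord.
  by rewrite ltnNge leq_addr/= addKn.
Qed.

Lemma sm_K N y : sm (fun x => K N x y).
Proof.
have [m [e [f [se sf kE]]]] := sep_sum (sep_K N).
rewrite (_ : (fun _ => _) = fun x => \sum_(i < m) f i y * e i x).
  by apply: sm_sum => i; exact: smZ.
by apply/funext => x; rewrite kE; apply: eq_bigr => i _; rewrite mulrC.
Qed.

Lemma bm_K N y : bm (fun x => K N x y).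
Proof. exact/sm_bmeas/sm_K. Qed.

(** The kernel only depends on y - x. *)
Lemma grad_KC N k x y : grad k (fun y => K N x y) y = - grad k (fun x => K N x y) x.
Proof.
have d : is_derive x (axis R k) (fun x => K N x y) (grad k (fun x => K N x y) x).
  exact: sm_is_derive (sm_K N y).
suff : is_derive y (axis R k) (fun y => K N x y) (- grad k (fun x => K N x y) x) by case.
apply/is_deriveDirP; move/is_deriveDirP : d => d.
rewrite (_ : (fun h : R => _) = (fun h => K N (h *: axis R k + x) y) \o (fun h : R => - h)).
  have dN : is_derive (0 : R) (1 : R) (fun h : R => - h) (-1).
    by apply: is_derive_affine => h; rewrite [h *: 1]mulr1 mulrN1 oppr0 !addr0.
  rewrite -mulrN1; apply: is_derive1_comp dN.
  by rewrite oppr0.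
apply/funext => h /=; apply: eq_bigr => j _; congr (kern N _).
by rewrite !coordDZ; ring.
Qed.

End kernel.

(** * Lipschitz functions and the moments of the kernel *)

Section mollification.
Context (R : realType).
Implicit Types (x y : space3 R) (f g h : space3 R -> R).

Lemma derive_lip (F : R -> R) L : (forall s : R, exists2 d, is_derive s 1 F d & `|d| <= L) ->
  forall s t, `|F t - F s| <= L * `|t - s|.
Proof.
move=> dF s t; have [f fP] := choice (fun s => (let: ex_intro2 d d1 d2 := dF s in ex_intro _ d
  (conj d1 d2))).
wlog st : s t / s <= t => [wh|].
  have [|/ltW] := leP s t; first exact: wh.
  by move=> /wh; rewrite distrC [X in L * X]distrC.
have dF' (x : R) : x \in `]s, t[ -> is_derive x 1 F (f x) by move=> _; case: (fP x).
have cF : {within `[s, t], continuous F}.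
  by apply: continuous_subspaceT; apply: (@is_derive_continuous _ F f) => u; case: (fP u).
have [c _ ->] := MVT_segment st dF' cF.
by rewrite normrM ler_wpM2r//; case: (fP c).
Qed.

Lemma periodic_int (F : R -> R) : (forall s, F (s + 1) = F s) ->
  forall (m : int) s, F (s + m%:~R) = F s.
Proof.
move=> pF; have pn (n : nat) s : F (s + n%:R) = F s.
  by elim: n s => [|n IH] s; rewrite ?addr0// -[n.+1%:R]natr1 addrA pF IH.
case=> n s; first exact: pn.
by rewrite NegzE mulrNz -[LHS](pn n.+1) subrK.
Qed.

Lemma hump_lt1 (e : R) : 0 < e -> e <= 2^-1 -> hump e < 1.
Proof.
move=> e0 e1; have p0 := pi_gt0 R.
have : cos (2 * pi * e) < cos 0.
  rewrite ltr_cos ?in_itv/=; first by rewrite !mulr_gt0.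
  - by rewrite lexx ltW.
  - by apply/andP; split; nra.
by rewrite cos0 /hump; lra.
Qed.

Lemma hump_anti (e z : R) : 0 < e -> e <= `|z| -> `|z| <= 2^-1 -> hump z <= hump e.
Proof.
move=> e0 ez z1; have p0 := pi_gt0 R.
have -> : hump z = hump `|z| by case: (ger0P z) => // _; rewrite humpN.
rewrite /hump ler_pM2r ?invr_gt0// lerD2l.
move: ez; rewrite le_eqVlt => /predU1P[<-//|ez].
by rewrite ltW// ltr_cos ?in_itv/=; nra.
Qed.

(** The oscillation of a periodic Lipschitz function is bounded by the distance
    to the integers. The function 1 - hump is only quadratic in this distance;
    at distances larger than e it is bounded below by 1 - hump e, whence the
    bound up to the additive error e. *)
Lemma lip_gauge1 (F : R -> R) L e : 0 <= L -> 0 < e -> e <= 2^-1 ->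
  (forall s, F (s + 1) = F s) ->
  (forall s : R, exists2 d, is_derive s 1 F d & `|d| <= L) ->
  forall s t, `|F t - F s| <= L * (e + (1 - hump e)^-1 * (1 - hump (t - s))).
Proof.
move=> L0 e0 e1 pF dF s t.
(* z is the representative of t - s in [-1/2, 1/2[ *)
pose m := Num.floor (t - s + 2^-1); pose z := t - s - m%:~R.
have mP := floor_itv (t - s + 2^-1); rewrite -/m in mP.
have z1 : `|z| <= 2^-1.
  by rewrite ler_norml /z; move: mP; rewrite intrD => /andP[]; lra.
have zE : t = (s + z) + m%:~R by rewrite /z; lra.
have hz : hump (t - s) = hump z.
  rewrite (_ : t - s = z + m%:~R); last by rewrite /z; lra.
  by apply: (periodic_int (@humpD1 R)).
have -> : F t = F (s + z) by rewrite zE periodic_int.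
have h1 := hump_lt1 e0 e1.
apply: (le_trans (derive_lip dF _ _)); rewrite addrAC subrr add0r hz ler_wpM2l//.
have hz1 := hump_le1 z.
have [ze|/ltW ez] := leP `|z| e.
  by rewrite (le_trans ze)// lerDl mulr_ge0 ?invr_ge0; lra.
have := hump_anti e0 ez z1 => hh.
have : 1 <= (1 - hump e)^-1 * (1 - hump z).
  by rewrite mulrC ler_pdivlMr ?mul1r; lra.
lra.
Qed.

Definition gauge (e : R) x y : R :=
  \sum_(k < 3) (e + (1 - hump e)^-1 * (1 - hump (coord k y - coord k x))).

Lemma lip_gauge f L e x y : C1p f -> (forall k x, `|grad k f x| <= L) ->
  0 < e -> e <= 2^-1 -> `|f x - f y| <= L * gauge e x y.
Proof.
move=> cf fL e0 e1; have L0 : 0 <= L by rewrite (le_trans _ (fL 0 0)).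
have l1 k p s t : `|f (t *: axis R k + p) - f (s *: axis R k + p)| <=
    L * (e + (1 - hump e)^-1 * (1 - hump (t - s))).
  apply: (lip_gauge1 (F := fun s => f (s *: axis R k + p)) L0 e0 e1) => [u|u].
    by rewrite scalerDl scale1r addrAC (C1p_per cf).
  exists (grad k f (u *: axis R k + p)); last exact: fL.
  exact: (is_derive_line p u (C1p_der cf k)).
case: x y => [[x0 x1] x2] [[y0 y1] y2].
have a0 := l1 0 ((0, y1), y2) x0 y0; have a1 := l1 1 ((x0, 0), y2) x1 y1.
have a2 := l1 2 ((x0, x1), 0) x2 y2; rewrite -!line0 in a0; rewrite -!line1 in a1; rewrite
  -!line2 in a2.
rewrite distrC (_ : f _ - f _ = (f (y0, y1, y2) - f (x0, y1, y2)) +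
  ((f (x0, y1, y2) - f (x0, x1, y2)) + (f (x0, x1, y2) - f (x0, x1, x2)))); last by ring.
rewrite /gauge !big_ord_recl big_ord0 addr0; apply: (le_trans (ler_normD _ _)).
by apply: (le_trans (lerD a0 (le_trans (ler_normD _ _) (lerD a1 a2)))); rewrite -!mulrDr.
Qed.

(** A bound of the first moment of the kernel, tested on Lipschitz functions;
    no distance on the torus has to be defined. *)
Definition moment_le N (e : R) := forall f L, C1p f -> (forall k x, `|grad k f x| <= L) ->
  forall y, ave (fun x => K N x y * `|f x - f y|) <= L * e.

(** The mean of the gauge is 3 d + 3 / ((1 - hump d) (2 N + 2)):
    choose d first, and then N. *)
Lemma moment_small (e : R) : 0 < e -> exists N0, forall N, (N0 <= N)%N -> moment_le N e.
Proof.
move=> e0; pose d := Num.min (e / 6) 2^-1.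
have d0 : 0 < d by rewrite lt_min divr_gt0/= ?invr_gt0.
have d1 : d <= 2^-1 by rewrite ge_min lexx orbT.
have d2 : d <= e / 6 by rewrite ge_min lexx.
pose C := (1 - hump d)^-1; have h1 := hump_lt1 d0 d1.
have C0 : 0 <= C by rewrite invr_ge0; lra.
exists (Num.truncn (3 * C / e)).+1 => N N0 f L cf fL y.
have L0 : 0 <= L by rewrite (le_trans _ (fL 0 0)).
have N1 : 3 * C / e <= N%:R.
  apply/ltW/(lt_le_trans (truncnS_gt _)); by rewrite ler_nat.
have bK := bm_K N y.
have bg k : bm (fun x : space3 R => 1 - hump (coord k y - coord k x)).
  have [m [e_ [f_ [se sf hE]]]] := sep_sum (@sep_hump R k).
  have bh : bm (fun x : space3 R => hump (coord k y - coord k x)).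
    rewrite (_ : (fun _ => _) = fun x => \sum_(i < m) e_ i x * f_ i y); last exact/funext.
    by apply: bmeas_sum => i _; apply: bmeasM (bmeas_cst _ _); exact: sm_bmeas.
  exact: bmeasB (bmeas_cst _ 1) bh.
have bKg k : bm (fun x => K N x y * (d + C * (1 - hump (coord k y - coord k x)))).
  exact: bmeasM bK (bmeasD (bmeas_cst _ d) (bmeasM (bmeas_cst _ C) (bg k))).
have bS : bm (fun x => \sum_(k < 3) K N x y * (d + C * (1 - hump (coord k y - coord k x)))).
  by apply: bmeas_sum => i _; exact: bKg.
have bL : bm (fun x => K N x y * `|f x - f y|).
  by apply: bmeasM => //; apply: bmeas_norm; apply: bmeasB (C1p_bm cf) (bmeas_cst _ _).
apply: (@le_trans _ _ (ave (fun x => L * \sum_(k < 3) K N x y * (d + C * (1 - hump (coord k y -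
  coord k x)))))).
  apply: ave_le => //; first exact: bmeasM (bmeas_cst _ _) bS.
  move=> x; rewrite -mulr_sumr mulrCA ler_wpM2l ?K_ge0//.
  exact: lip_gauge.
rewrite aveZl// ler_wpM2l// ave_sum//.
apply: (@le_trans _ _ (\sum_(k < 3) (d + C * (2 * N%:R + 2)^-1))).
  apply: ler_sum => k _; rewrite le_eqVlt; apply/orP; left; apply/eqP.
  transitivity (ave (fun x => K N x y * d + C * (K N x y * (1 - hump (coord k y - coord k x))))).
    by apply: eq_ave => x; ring.
  rewrite aveD; [|exact: bmeasM bK (bmeas_cst _ _)|exact: bmeasM (bmeas_cst _ _) (bmeasM bK (bg k))].
  by rewrite aveZr// aveZl ?ave_K ?ave_K_moment ?mul1r//; exact: bmeasM bK (bg k).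
rewrite sumr_const card_ord -[_ *+ 3]mulr_natl.
have hC : C * (2 * N%:R + 2)^-1 <= e / 6.
  rewrite ler_pdivrMr; last by have : 0 <= N%:R :> R by []; lra.
  move: N1; rewrite ler_pdivrMr//; lra.
move: (C * _) hC => X hX; lra.
Qed.

(** * Convolution with the kernel *)

Definition conv N h y : R := ave (fun x => h x * K N x y).

Lemma conv_sum N h m (e f : nat -> space3 R -> R) : bm h -> (forall i, sm (e i)) ->
  (forall x y, K N x y = \sum_(i < m) e i x * f i y) ->
  forall y, conv N h y = \sum_(i < m) ave (fun x => h x * e i x) * f i y.
Proof.
move=> bh se KE y; have bhe i : bm (fun x => h x * e i x) by apply: bmeasM => //; exact: sm_bmeas.
transitivity (ave (fun x => \sum_(i < m) (h x * e i x) * f i y)).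
  by apply: eq_ave => x; rewrite KE mulr_sumr; apply: eq_bigr => i _; rewrite mulrA.
rewrite ave_sum; last by move=> i _; exact: bmeasM (bhe i) (bmeas_cst _ _).
by apply: eq_bigr => i _; rewrite aveZr.
Qed.

Lemma sm_conv N h : bm h -> sm (conv N h).
Proof.
move=> bh; have [m [e [f [se sf KE]]]] := sep_sum (sep_K R N).
rewrite (_ : conv N h = fun y => \sum_(i < m) ave (fun x => h x * e i x) * f i y).
  by apply: sm_sum => i; exact: smZ.
by apply/funext => y; exact: conv_sum.
Qed.

Lemma grad_sum k m (a : nat -> R) (f : nat -> space3 R -> R) y : (forall i, sm (f i)) ->
  grad k (fun y => \sum_(i < m) a i * f i y) y = \sum_(i < m) a i * grad k (f i) y.
Proof.
move=> sf; suff : is_derive y (axis R k) (fun y => \sum_(i < m) a i * f i y)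
   (\sum_(i < m) a i * grad k (f i) y) by case.
rewrite (_ : (fun y => _) = \sum_(i < m) (fun y => a i * f i y)); last first.
  by apply/funext => z; rewrite fct_sumE.
apply: is_derive_sum => i; apply: is_deriveZ; exact: sm_is_derive.
Qed.

Lemma bm_gradK N k y : bm (fun x => grad k (fun x => K N x y) x).
Proof. by apply: sm_bmeas; apply: grad_sm; exact: sm_K. Qed.

Lemma grad_conv N h k y : bm h ->
  grad k (conv N h) y = - ave (fun x => h x * grad k (fun x => K N x y) x).
Proof.
move=> bh; have [m [e [f [se sf KE]]]] := sep_sum (sep_K R N).
have bhe i : bm (fun x => h x * e i x) by apply: bmeasM => //; exact: sm_bmeas.
rewrite (_ : conv N h = fun y => \sum_(i < m) ave (fun x => h x * e i x) * f i y); last first.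
  by apply/funext => z; exact: conv_sum.
rewrite (grad_sum k m (fun i => ave (fun x => h x * e i x)) y sf).
transitivity (ave (fun x => \sum_(i < m) (h x * e i x) * grad k (f i) y)).
  rewrite ave_sum; last by move=> i _; exact: bmeasM (bhe i) (bmeas_cst _ _).
  by apply: eq_bigr => i _; rewrite aveZr.
rewrite -aveN; last exact: bmeasM bh (bm_gradK _ _ _).
apply: eq_ave => x; rewrite -mulrN -grad_KC.
rewrite (_ : (fun y => K N x y) = fun y => \sum_(i < m) e i x * f i y); last first.
  by apply/funext => z; rewrite KE.
rewrite (grad_sum k m (fun i => e i x) y sf) mulr_sumr.
by apply: eq_bigr => i _; rewrite mulrA.
Qed.

Lemma bm_hK N h y : bm h -> bm (fun x => h x * K N x y).
Proof. by move=> bh; exact: bmeasM bh (bm_K _ _). Qed.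

Lemma conv_le N h M y : bm h -> (forall x, h x <= M) -> conv N h y <= M.
Proof.
move=> bh hM; rewrite -[leRHS]mulr1 -(ave_K N y) -aveZl; last exact: bm_K.
apply: ave_le => [||x]; first exact: bm_hK.
  exact: bmeasM (bmeas_cst _ _) (bm_K _ _).
by rewrite ler_wpM2r ?K_ge0.
Qed.

Lemma convN N h y : bm h -> conv N (fun x => - h x) y = - conv N h y.
Proof.
move=> bh; rewrite /conv -aveN; last exact: bm_hK.
by apply: eq_ave => x; rewrite mulNr.
Qed.

Lemma conv_norm N h M y : bm h -> (forall x, `|h x| <= M) -> `|conv N h y| <= M.
Proof.
move=> bh hM; rewrite ler_norml lerNl -convN//; apply/andP; split.
  by apply: conv_le => [|x]; [exact: bmeasN | have := hM x; rewrite ler_norml => /andP[]; lra].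
by apply: conv_le => // x; have := hM x; rewrite ler_norml => /andP[].
Qed.

Lemma convD N h g y : bm h -> bm g ->
  conv N (fun x => h x + g x) y = conv N h y + conv N g y.
Proof.
move=> bh bg; rewrite /conv -aveD; [|exact: bm_hK|exact: bm_hK].
by apply: eq_ave => x; rewrite mulrDl.
Qed.

Lemma convZ N r h y : bm h -> conv N (fun x => r * h x) y = r * conv N h y.
Proof.
move=> bh; rewrite /conv -aveZl; last exact: bm_hK.
by apply: eq_ave => x; rewrite mulrA.
Qed.

Lemma conv_csum N (I : Type) (s : seq I) (P : pred I) (h : I -> space3 R -> R) y :
  (forall i, bm (h i)) ->
  conv N (fun x => \sum_(i <- s | P i) h i x) y = \sum_(i <- s | P i) conv N (h i) y.
Proof.
move=> bh; rewrite /conv -ave_sum; last by move=> i _; exact: bm_hK.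
by apply: eq_ave => x; rewrite mulr_suml.
Qed.

Lemma conv_near N e f L y : moment_le N e -> C1p f -> (forall k x, `|grad k f x| <= L) ->
  `|conv N f y - f y| <= L * e.
Proof.
move=> me cf fL; apply: le_trans (me f L cf fL y).
have bf := C1p_bm cf; have bK := bm_K N y.
rewrite (_ : _ - _ = ave (fun x => K N x y * (f x - f y))); last first.
  rewrite -[in LHS](mulr1 (f y)) -(ave_K N y) /conv -aveZl// -aveB//; last 2 first.
    exact: bm_hK.
    exact: bmeasM (bmeas_cst _ _) bK.
  by apply: eq_ave => x; ring.
have bKf : bm (fun x => K N x y * (f x - f y)).
  exact: bmeasM bK (bmeasB bf (bmeas_cst _ _)).
apply: ave_norm_le => //.
  exact: bmeasM bK (bmeas_norm (bmeasB bf (bmeas_cst _ _))).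
by move=> x; rewrite normrM [`|K _ _ _|]ger0_norm ?K_ge0.
Qed.

Lemma conv_adj N h g : bm h -> bm g ->
  ave (fun y => conv N h y * g y) = ave (fun x => h x * conv N g x).
Proof.
move=> bh bg; have [m [e [f [se sf KE]]]] := sep_sum (sep_K R N).
have KE' x y : K N x y = \sum_(i < m) f i x * e i y.
  by rewrite KC KE; apply: eq_bigr => i _; rewrite mulrC.
have be i : bm (e i) by exact/sm_bmeas.
have bf i : bm (f i) by exact/sm_bmeas.
transitivity (\sum_(i < m) ave (fun x => h x * e i x) * ave (fun x => g x * f i x)).
  transitivity (ave (fun y => \sum_(i < m) ave (fun x => h x * e i x) * (g y * f i y))).
    apply: eq_ave => y; rewrite (conv_sum bh se KE) mulr_suml.
    by apply: eq_bigr => i _; ring.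
  rewrite ave_sum; last by move=> i _; exact: bmeasM (bmeas_cst _ _) (bmeasM bg (bf i)).
  by apply: eq_bigr => i _; rewrite aveZl//; exact: bmeasM bg (bf i).
transitivity (ave (fun x => \sum_(i < m) (h x * e i x) * ave (fun x => g x * f i x))).
  rewrite ave_sum; last by move=> i _; exact: bmeasM (bmeasM bh (be i)) (bmeas_cst _ _).
  by apply: eq_bigr => i _; rewrite aveZr//; exact: bmeasM bh (be i).
apply: eq_ave => x; rewrite (conv_sum bg sf KE') mulr_sumr.
by apply: eq_bigr => i _; ring.
Qed.

Lemma sm_grad_bounded f : sm f -> exists L, forall k x, `|grad k f x| <= L.
Proof.
move=> sf; have h k : exists M, forall x, `|grad k f x| <= M.
  by have [_] := sm_bmeas (grad_sm k sf).
have [M MP] := choice h; exists (\sum_k `|M k|) => k x.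
rewrite (le_trans (MP k x))// (le_trans (ler_norm _))// (bigD1 k)//= lerDl.
by rewrite sumr_ge0.
Qed.

Lemma cvg_ave_conv f g : bm f -> sm g ->
  (fun M => ave (fun x => conv M f x * g x)) @ \oo --> ave (fun x => f x * g x).
Proof.
move=> bf sg; have bg := sm_bmeas sg; have [_ [B fB]] := bf.
have B0 : 0 <= B by rewrite (le_trans _ (fB 0)).
have [L gL] := sm_grad_bounded sg.
have L0 : 0 <= L by rewrite (le_trans _ (gL 0 0)).
apply/cvgrPdist_le => e e0.
have [|N0 N0P] := @moment_small (e / (B * L + 1)).
  by rewrite divr_gt0// ltr_wpDl// mulr_ge0.
exists N0 => // M /= NM; have me := N0P M NM.
rewrite conv_adj// -aveB; [|exact: bmeasM|apply: bmeasM => //; exact/sm_bmeas/sm_conv].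
rewrite -[leRHS](ave_cst e); apply: ave_norm_le.
- by apply: bmeasB; apply: bmeasM => //; exact/sm_bmeas/sm_conv.
- exact: bmeas_cst.
move=> x; rewrite -mulrBr normrM distrC.
have := conv_near x me (sm_C1p sg) gL => h1.
rewrite (le_trans (ler_pM _ _ (fB x) h1))// mulrA mulrCA ger_pMr// ler_pdivrMr.
  by rewrite mul1r lerDl.
by rewrite ltr_wpDl// mulr_ge0.
Qed.

(** The witness f' is the pointwise limit of the mollifications, which exists
    because conv N (conv M f) is close to conv M f, by the Lipschitz bound on the
    latter, and tends to conv N f as M grows. It plays the part of a Lipschitz
    representative of f, of which only the distance to the mollifications is
    used. *)
Lemma conv_close f L : bm f -> (forall N k y, `|grad k (conv N f) y| <= L) ->
  exists2 f' : space3 R -> R, {ae mu_space R, forall x, cell x -> f x = f' x} &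
    bm f' /\ forall N e, moment_le N e -> forall x, `|f' x - conv N f x| <= L * e.
Proof.
move=> bf fL; have [_ [B fB]] := bf.
have L0 : 0 <= L by rewrite (le_trans _ (fL 0%N 0 0)).
have step N e y : moment_le N e -> 0 < e ->
    \forall M \near \oo, `|conv M f y - conv N f y| <= L * e + e.
  move=> me e0.
  have := @cvg_ave_conv f (fun x => K N x y) bf (sm_K N y).
  move=> /cvgrPdist_le/(_ e e0); apply: filterS => M hM.
  have h1 := conv_near y me (sm_C1p (sm_conv M bf)) (fL M).
  rewrite (_ : conv M f y - conv N f y = - (conv N (conv M f) y - conv M f y) -
     (conv N f y - conv N (conv M f) y)); last by ring.
  by rewrite (le_trans (ler_normB _ _))// normrN lerD.
have cv y : cvgn (fun M => conv M f y).
  apply/cauchy_cvgP/cauchyP => e e0.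
  have d0 : 0 < e / (2 * (L + 1)) by rewrite divr_gt0// mulr_gt0// ltr_wpDl.
  have [N0 N0P] := moment_small d0.
  exists (conv N0 f y); have := step N0 _ y (N0P N0 (leqnn _)) d0.
  rewrite /nbhs/=; apply: filterS => M; rewrite /ball/= distrC => /le_lt_trans; apply.
  have -> : L * (e / (2 * (L + 1))) + e / (2 * (L + 1)) = e / 2 by field; lra.
  lra.
pose f' y := limn (fun M => conv M f y).
have cv' y : (fun M => conv M f y) @ \oo --> f' y by exact: cv.
have bc M : bm (conv M f) by exact/sm_bmeas/sm_conv.
have bf' : bm f'.
  split; last first.
    exists B => x; apply: (cvgr_to_le (cvg_norm (cv' x))).
    by apply: nearW => M; exact: conv_norm.
  apply: (measurable_fun_cvg (h := fun M => conv M f)) => [M|x _]; first by case: (bc M).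
  exact: cv'.
exists f'; last first.
  split=> // N e me x.
  have c : (fun M => conv M f x - conv N (conv M f) x) @ \oo --> f' x - conv N f x.
    by apply: cvgB; [exact: cv' | exact: cvg_ave_conv bf (sm_K N x)].
  apply: (cvgr_to_le (cvg_norm c)); apply: nearW => M; rewrite distrC.
  exact: conv_near x me (sm_C1p (sm_conv M bf)) (fL M).
have : {ae mu_space R, forall x, cell x -> f x - f' x = 0}.
  apply: sm_total => [|g sg]; first exact: bmeasB.
  have bg := sm_bmeas sg; have [_ [G gG]] := bg.
  rewrite (_ : (fun x => _) = fun x => f x * g x - f' x * g x); last first.
    by apply/funext => x; rewrite mulrBl.
  rewrite aveB; [|exact: bmeasM|exact: bmeasM].
  have c1 := cvg_ave_conv bf sg.
  have c2 : (fun M => ave (fun x => conv M f x * g x)) @ \oo --> ave (fun x => f' x * g x).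
    apply: (cvg_ave (M := B * G)) => [M||M x|x].
    - exact: bmeasM (bc M) bg.
    - exact: bmeasM bf' bg.
    - by rewrite normrM ler_pM// conv_norm.
    - by apply: cvgM; [exact: cv' | exact: cvg_cst].
  by apply/eqP; rewrite subr_eq0; apply/eqP; exact: (cvg_unique (@Rhausdorff R) c1 c2).
by apply: ae_mono => x h cx; apply/eqP; rewrite -subr_eq0; apply/eqP; exact: h.
Qed.

End mollification.

(** * The Maxwell-Stefan operator at a point *)

Section algebra.
Context (R : realFieldType) (n : nat).
Variables (d : 'I_n -> 'I_n -> R) (dl dL : R).
Hypotheses (dl0 : 0 < dl) (d_ge : forall i j, dl <= d i j) (d_le : forall i j, d i j <= dL).
Hypothesis d_sym : forall i j, d i j = d j i.
Implicit Types (a k v w J : 'I_n -> R).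

(** Up to the sign, the left-hand side of the Maxwell-Stefan system for
    concentrations a and one component k of the fluxes, with d i j = 1 / D_ij
    for i != j. The terms of the diagonal vanish, so that d i i may be chosen to
    satisfy the same bounds as the other coefficients. *)
Definition ms a k i := \sum_j d i j * (a j * k i - a i * k j).

Lemma sum_sqr v : (\sum_i v i) ^+ 2 <= n%:R * \sum_i v i ^+ 2.
Proof.
have h : 0 <= \sum_i \sum_j (v i - v j) ^+ 2.
  by apply: sumr_ge0 => i _; apply: sumr_ge0 => j _; exact: sqr_ge0.
have e : \sum_i \sum_j (v i - v j) ^+ 2 = 2 * (n%:R * \sum_i v i ^+ 2) - 2 * (\sum_i v i) ^+ 2.
  transitivity (\sum_i \sum_j (v i ^+ 2 + v j ^+ 2 - 2 * (v i * v j))).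
    by apply: eq_bigr => i _; apply: eq_bigr => j _; ring.
  transitivity (\sum_i (n%:R * v i ^+ 2 + \sum_j v j ^+ 2 - 2 * (v i * \sum_j v j))).
    apply: eq_bigr => i _; rewrite sumrB big_split/= sumr_const card_ord -[_ *+ n]mulr_natl.
    by rewrite -mulr_sumr -mulr_sumr.
  rewrite sumrB big_split/= sumr_const card_ord -[_ *+ n]mulr_natl -!mulr_sumr -mulr_suml expr2.
  by ring.
by move: h; rewrite e; lra.
Qed.

Lemma dL0 : (0 < n)%N -> 0 < dL.
Proof.
move=> n0; pose i := Ordinal n0.
exact: lt_le_trans dl0 (le_trans (d_ge i i) (d_le i i)).
Qed.

(** Put v_i = k_i / (a_i + e). For e = 0 the quadratic form is
      1/2 sum_(i, j) d_ij a_i a_j (v_i - v_j)^2,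
    and the factor a_i a_j degenerates where concentrations vanish. For e > 0
    there are the additional terms e sum d_ij a_j v_i^2, which is at least
    e dl sum v_i^2, and - e sum d_ij a_i v_i v_j, which has no sign and is
    controlled by the two others. *)
Lemma ms_coercive e a k : 0 < e -> e <= 1 ->
  e * n%:R * dL ^+ 2 <= dl ^+ 2 -> 4 * e * n%:R <= 1 ->
  (forall i, 0 <= a i) -> \sum_i a i = 1 -> \sum_i k i = 0 ->
  e * dl / 8 * \sum_i k i ^+ 2 <= \sum_i k i / (a i + e) * ms a k i.
Proof.
move=> e0 e1 he1 he2 a0 a1 k0.
have n0 : (0 < n)%N.
  by case: (posnP n) a1 => // n0; rewrite big1 => [/eqP|[i hi]]; [rewrite eq_sym
    oner_eq0|exfalso; rewrite n0 in hi].
have L0 := dL0 n0.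
have p0 i : 0 < a i + e by rewrite ltr_wpDl.
have ale1 i : a i <= 1.
  by rewrite -a1 (bigD1 i)//= lerDl sumr_ge0.
pose v i := k i / (a i + e).
have kE i : k i = (a i + e) * v i by rewrite mulrC divfK// gt_eqF.
pose A := \sum_i a i * v i ^+ 2; pose b := \sum_i v i ^+ 2; pose V := \sum_i v i.
have b0 : 0 <= b by apply: sumr_ge0 => i _; exact: sqr_ge0.
have A0 : 0 <= A by apply: sumr_ge0 => i _; rewrite mulr_ge0 ?sqr_ge0.
have kb : \sum_i k i ^+ 2 <= 4 * b.
  rewrite mulr_sumr; apply: ler_sum => i _; rewrite kE exprMn ler_wpM2r ?sqr_ge0//.
  have := ale1 i; have := p0 i => h1 h2.
  have -> : 4 = 2 ^+ 2 :> R by ring.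
  by rewrite ler_sqr ?nnegrE; lra.
(* The constraint on the fluxes: the mean of v with weights a is O(e). *)
have aV : \sum_i a i * v i = - e * V.
  have : \sum_i (a i * v i + e * v i) = 0.
    by apply: etrans k0; apply: eq_bigr => i _; rewrite kE mulrDl.
  by rewrite big_split/= -mulr_sumr -/V; lra.
have Vb : V ^+ 2 <= n%:R * b by exact: sum_sqr.
pose Q1 := \sum_i \sum_j d i j * (a i * a j * (v i ^+ 2 - v i * v j)).
pose Q2 := \sum_i \sum_j d i j * (a j * v i ^+ 2).
pose Q3 := \sum_i \sum_j d i j * (a i * v i * v j).
have QE : \sum_i k i / (a i + e) * ms a k i = Q1 + e * Q2 - e * Q3.
  transitivity (\sum_i (\sum_j d i j * (a i * a j * (v i ^+ 2 - v i * v j)) +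
      e * \sum_j d i j * (a j * v i ^+ 2) - e * \sum_j d i j * (a i * v i * v j))); last first.
    by rewrite sumrB big_split/= -!mulr_sumr.
  apply: eq_bigr => i _; rewrite /ms -/(v i).
  transitivity (\sum_j (d i j * (a i * a j * (v i ^+ 2 - v i * v j)) +
      e * (d i j * (a j * v i ^+ 2)) - e * (d i j * (a i * v i * v j)))); last first.
    by rewrite sumrB big_split/= -!mulr_sumr.
  rewrite mulr_sumr; apply: eq_bigr => j _.
  by rewrite (kE i) (kE j); ring.
(* Q1 is at least dl times the variance of v with respect to the weights a. *)
have h1 : dl * (A - (e * V) ^+ 2) <= Q1.
  have sw : Q1 = \sum_i \sum_j d i j * (a i * a j * (v j ^+ 2 - v i * v j)).
    rewrite /Q1 exchange_big/=; apply: eq_bigr => i _; apply: eq_bigr => j _.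
    by rewrite d_sym; ring.
  have Q1E : 2 * Q1 = \sum_i \sum_j d i j * (a i * a j * (v i - v j) ^+ 2).
    rewrite mulr2n mulrDl mul1r {2}sw -big_split/=; apply: eq_bigr => i _.
    by rewrite -big_split/=; apply: eq_bigr => j _; ring.
  have : dl * \sum_i \sum_j a i * a j * (v i - v j) ^+ 2 <= 2 * Q1.
    rewrite Q1E mulr_sumr; apply: ler_sum => i _; rewrite mulr_sumr; apply: ler_sum => j _.
    by rewrite ler_wpM2r// mulr_ge0 ?sqr_ge0// mulr_ge0.
  have -> : \sum_i \sum_j a i * a j * (v i - v j) ^+ 2 = 2 * (A - (e * V) ^+ 2); last by lra.
  transitivity (\sum_i (a i * v i ^+ 2 + a i * A - 2 * (a i * v i * (- e * V)))).
    apply: eq_bigr => i _.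
    transitivity (\sum_j (a i * v i ^+ 2 * a j + a i * (a j * v j ^+ 2) - 2 * (a i * v i) * (a j
      * v j))).
      by apply: eq_bigr => j _; ring.
    rewrite sumrB big_split/= -!mulr_sumr a1 aV -/A; ring.
  rewrite sumrB big_split/= -mulr_suml a1 -mulr_sumr -mulr_suml aV -/A; ring.
have h2 : dl * b <= Q2.
  rewrite mulr_sumr; apply: ler_sum => i _.
  rewrite -[X in dl * X]mul1r -a1 mulr_suml mulr_sumr; apply: ler_sum => j _.
  by rewrite ler_wpM2r// mulr_ge0 ?sqr_ge0.
(* Young's inequality; the part in A will be absorbed by Q1, the one in b by Q2. *)
have h3 : Q3 <= n%:R * dL ^+ 2 / dl * A + dl / 4 * b.
  have -> : n%:R * dL ^+ 2 / dl * A + dl / 4 * b =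
     \sum_i \sum_j a i * (dL ^+ 2 / dl * v i ^+ 2 + dl / 4 * v j ^+ 2).
    transitivity (\sum_i (n%:R * (dL ^+ 2 / dl) * (a i * v i ^+ 2) + dl / 4 * b * a i)).
      rewrite big_split/= -!mulr_sumr a1 -/A; ring.
    apply: eq_bigr => i _.
    rewrite -mulr_sumr big_split/= sumr_const card_ord -[_ *+ n]mulr_natl -mulr_sumr -/b; ring.
  apply: ler_sum => i _; apply: ler_sum => j _.
  rewrite (_ : d i j * _ = a i * (d i j * (v i * v j))); last by ring.
  rewrite ler_wpM2l//.
  have dij0 : 0 <= d i j by rewrite (le_trans _ (d_ge i j))// ltW.
  apply: (@le_trans _ _ (dL * `|v i * v j|)).
    by rewrite (le_trans (ler_norm _))// normrM (ger0_norm dij0) ler_wpM2r.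
  rewrite normrM -[v i ^+ 2]real_normK ?num_real// -[v j ^+ 2]real_normK ?num_real//.
  move: `|v i| `|v j| => x y.
  have : 0 <= dl * (dL / dl * x - y / 2) ^+ 2 by rewrite mulr_ge0 ?sqr_ge0// ltW.
  have -> : dl * (dL / dl * x - y / 2) ^+ 2 = dL ^+ 2 / dl * x ^+ 2 + dl / 4 * y ^+ 2 - dL * (x * y).
    by field; rewrite gt_eqF.
  lra.
rewrite QE.
have c1 : e * (n%:R * dL ^+ 2 / dl * A) <= dl * A.
  have -> : e * (n%:R * dL ^+ 2 / dl * A) = (e * n%:R * dL ^+ 2) / dl * A by ring.
  by rewrite ler_wpM2r// ler_pdivrMr// -expr2.
have c2 : dl * (e * V) ^+ 2 <= e * dl * b / 4.
  rewrite exprMn; apply: (@le_trans _ _ (dl * (e ^+ 2 * (n%:R * b)))).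
    by rewrite ler_wpM2l ?(ltW dl0)// ler_wpM2l ?sqr_ge0.
  have : dl * e * b * (4 * e * n%:R) <= dl * e * b * 1.
    by rewrite ler_wpM2l// !mulr_ge0// ltW.
  rewrite expr2; nra.
have c3 : e * (dl * b) <= e * Q2 by rewrite ler_wpM2l// ltW.
have c4 : e * Q3 <= e * (n%:R * dL ^+ 2 / dl * A) + e * (dl / 4 * b).
  by rewrite -mulrDr ler_wpM2l// ltW.
have c5 : e * dl / 8 * \sum_i k i ^+ 2 <= e * dl / 8 * (4 * b).
  by rewrite ler_wpM2l// !mulr_ge0 ?invr_ge0// ltW.
move: c1 c2 c3 c4 c5 h1; rewrite [dl * (A - _)]mulrBr.
move: (dl * A) (dl * (e * V) ^+ 2) (e * (n%:R * dL ^+ 2 / dl * A)) (e * Q2) (e * Q3) => x1 x2 x3 x4 x5.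
move: (e * dl / 8 * _) => x6; nra.
Qed.

Lemma ms_norm a k i :
  `|ms a k i| <= dL * ((\sum_j `|a j|) * `|k i| + `|a i| * \sum_j `|k j|).
Proof.
rewrite mulr_suml mulr_sumr -big_split/= mulr_sumr.
apply: (le_trans (ler_norm_sum _ _ _)); apply: ler_sum => j _.
have dij0 : 0 <= d i j by rewrite (le_trans _ (d_ge i j))// ltW.
rewrite normrM (ger0_norm dij0) ler_pM//.
by rewrite (le_trans (ler_normB _ _))// !normrM.
Qed.

Lemma msB a b J K i :
  ms a J i - ms b K i =
  ms a (fun j => J j - K j) i + ms (fun j => a j - b j) K i.
Proof.
rewrite /ms -sumrB -big_split/=; apply: eq_bigr => j _; ring.
Qed.

Lemma le_sum_norm v i : `|v i| <= \sum_j `|v j|.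
Proof. by rewrite (bigD1 i)//= lerDl sumr_ge0. Qed.

(** The integrand of the derivative of the energy. Here ga and gb stand for the
    gradients of the two concentrations, known up to an error r to be
    - ms a J and - ms b K, and gz is the gradient of w / (a + e). Substituting
    these relations, gz contains - ms a (J - K) / (a + e); by ms_coercive its
    product with J - K is a negative multiple of |J - K|^2, which absorbs all
    the products of J - K with w and r by Young's inequality. The constant C
    does not depend on r. *)
Lemma energy_pointwise e G L : 0 < e -> e <= 1 ->
  e * n%:R * dL ^+ 2 <= dl ^+ 2 -> 4 * e * n%:R <= 1 -> 0 <= G -> 0 <= L ->
  exists2 C, 0 <= C & forall a b J K ga gb r, 0 <= r ->
    (forall i, 0 <= a i) -> \sum_i a i = 1 ->
    (forall i, 0 <= b i) -> \sum_i b i = 1 ->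
    \sum_i J i = 0 -> \sum_i K i = 0 ->
    (forall i, `|J i| <= L) -> (forall i, `|K i| <= L) -> (forall i, `|ga i| <= G) ->
    (forall i, `|ga i + ms a J i| <= r) -> (forall i, `|gb i + ms b K i| <= r) ->
    let w i := a i - b i in let p i := a i + e in
    let gz i := (ga i - gb i) / p i - w i * ga i / p i ^+ 2 in
    is_true (\sum_i (gz i * (J i - K i) - w i / p i * gz i * J i) <= C * (\sum_i w i ^+ 2 + r ^+ 2)).
Proof.
move=> e0 e1 he1 he2 G0 L0.
case: (posnP n) => [n0|n0].
  exists 0 => // a b J K ga gb r r0 _ a1; exfalso; move: a1.
  by rewrite big1 => [/eqP|[i hi]]; [rewrite eq_sym oner_eq0|exfalso; rewrite n0 in hi].
have D0 := dL0 n0.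
have N0 : 0 < n%:R :> R by rewrite ltr0n.
(* With S and T the l^1 norms of w and of J - K, the coefficients c1, c2, c3
   and c4 are those of S T, S^2, r T and r S, and q is the one of - T^2. *)
pose m := dL * (1 + n%:R); pose q := e * dl / 8 / n%:R.
pose c1 := m * L / e + G / e ^+ 2 + L * m / e ^+ 2.
pose c2 := L * (m * L) / e ^+ 2 + G * L / e ^+ 3.
pose c3 := 2 / e; pose c4 := 2 * L / e ^+ 2.
have m0 : 0 < m by rewrite mulr_gt0// ltr_pwDl.
have q0 : 0 < q by rewrite !mulr_gt0// ?invr_gt0.
have c10 : 0 <= c1 by rewrite !addr_ge0 ?divr_ge0 ?mulr_ge0 ?exprn_ge0// ltW.
have c20 : 0 <= c2 by rewrite !addr_ge0 ?divr_ge0 ?mulr_ge0 ?exprn_ge0// ltW.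
have c30 : 0 <= c3 by rewrite divr_ge0// ltW.
have c40 : 0 <= c4 by rewrite divr_ge0 ?mulr_ge0 ?exprn_ge0// ltW.
pose C0 := c2 + c1 ^+ 2 / (2 * q) + c3 ^+ 2 / (2 * q) + c4.
have C00 : 0 <= C0 by rewrite !addr_ge0// divr_ge0 ?sqr_ge0 ?mulr_ge0// ltW.
exists (C0 * (1 + n%:R)) => [|a b J K ga gb r r0 a0 a1 b0 b1 J0 K0 JL KL gaG ea eb w p gz].
  by rewrite mulr_ge0// addr_ge0.
pose k i := J i - K i; pose S := \sum_i `|w i|; pose T := \sum_i `|k i|.
have S0 : 0 <= S by apply: sumr_ge0.
have T0 : 0 <= T by apply: sumr_ge0.
have p0 i : 0 < p i by rewrite ltr_wpDl.
have pV0 i : 0 <= (p i)^-1 by rewrite invr_ge0 ltW.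
have pV i : (p i)^-1 <= e^-1 by rewrite lef_pV2 ?posrE// lerDr.
have sa : \sum_i `|a i| = 1 by rewrite -a1; apply: eq_bigr => i _; rewrite ger0_norm.
have ale1 i : `|a i| <= 1 by rewrite -sa le_sum_norm.
have mk i : `|ms a k i| <= m * T.
  apply: (le_trans (ms_norm _ _ _)); rewrite sa mul1r /m -mulrA ler_wpM2l ?(ltW D0)//.
  rewrite mulrDl mul1r lerD ?le_sum_norm//.
  apply: (@le_trans _ _ (1 * T)); first by rewrite ler_wpM2r.
  by rewrite ler_wpM2r// ler1n.
have mw i : `|ms w K i| <= m * L * S.
  apply: (le_trans (ms_norm _ _ _)); rewrite /m -!mulrA ler_wpM2l ?(ltW D0)//.
  rewrite mulrDl mul1r lerD//.
    by rewrite mulrC ler_wpM2r.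
  apply: (@le_trans _ _ (S * \sum_(j < n) L)).
    by apply: ler_pM => //; [exact: sumr_ge0|exact: le_sum_norm|apply: ler_sum].
  by rewrite sumr_const card_ord -[_ *+ n]mulr_natl le_eqVlt; apply/orP; left; apply/eqP; ring.
pose x i := ga i - gb i + ms a k i + ms w K i.
have xr i : `|x i| <= 2 * r.
  have -> : x i = (ga i + ms a J i) - (gb i + ms b K i).
    by have := msB a b J K i; rewrite /x /k /w => h; lra.
  by have := ler_normB (ga i + ms a J i) (gb i + ms b K i); have := ea i; have := eb i; lra.
have gw i : `|ga i - gb i| <= m * T + m * L * S + 2 * r.
  have -> : ga i - gb i = x i - ms a k i - ms w K i by rewrite /x; ring.
  have := ler_normB (x i - ms a k i) (ms w K i); have := ler_normB (x i) (ms a k i).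
  by have := xr i; have := mk i; have := mw i; lra.
have gzE i : gz i * k i = - (k i / p i * ms a k i) +
    ((x i - ms w K i) / p i - w i * ga i / p i ^+ 2) * k i.
  by rewrite /gz /x; ring.
have pV2 i : (p i ^+ 2)^-1 <= (e ^+ 2)^-1.
  by rewrite lef_pV2 ?posrE ?exprn_gt0// ler_sqr ?nnegrE ?(ltW e0) ?(ltW (p0 i))// lerDr.
have first i : ((x i - ms w K i) / p i - w i * ga i / p i ^+ 2) * k i <=
    ((m * L / e + G / e ^+ 2) * S + c3 * r) * `|k i|.
  apply: (le_trans (ler_norm _)); rewrite normrM ler_wpM2r//.
  apply: (le_trans (ler_normB _ _)); rewrite !normrM.
  rewrite [`|(p i)^-1|]ger0_norm// [`|(p i ^+ 2)^-1|]ger0_norm; last by rewrite invr_ge0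
    exprn_ge0// ltW.
  have h1 : `|x i - ms w K i| / p i <= (2 * r + m * L * S) / e.
    rewrite ler_pM// ?normr_ge0//; apply: (le_trans (ler_normB _ _)).
    by rewrite lerD.
  have h2 : `|w i| * `|ga i| / p i ^+ 2 <= S * G / e ^+ 2.
    by rewrite ler_pM ?mulr_ge0 ?invr_ge0 ?exprn_ge0 ?ler_pM ?le_sum_norm// ltW.
  apply: (le_trans (lerD h1 h2)); rewrite le_eqVlt; apply/orP; left; apply/eqP.
  by rewrite /c3; ring.
have second i : - (w i / p i * gz i * J i) <=
    `|w i| * (L / e * ((m * T + m * L * S + 2 * r) / e + S * G / e ^+ 2)).
  apply: (le_trans (ler_norm _)); rewrite normrN !normrM -!mulrA ler_wpM2l//.
  rewrite [`|(p i)^-1|]ger0_norm// [L * (e^-1 * _)]mulrCA ler_pM ?mulr_ge0//.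
  rewrite mulrC ler_pM//.
  apply: (le_trans (ler_normB _ _)); rewrite !normrM.
  rewrite [`|(p i)^-1|]ger0_norm// [`|(p i ^+ 2)^-1|]ger0_norm; last by rewrite invr_ge0
    exprn_ge0// ltW.
  apply: lerD; first by rewrite ler_pM// (le_trans (gw i))// /m !mulrA.
  have i0 : 0 <= (p i ^+ 2)^-1 by rewrite invr_ge0 exprn_ge0// ltW.
  rewrite -mulrA; apply: ler_pM; [exact: normr_ge0|exact: mulr_ge0|exact: le_sum_norm|].
  exact: ler_pM.
have k0 : \sum_i k i = 0 by rewrite sumrB J0 K0 subrr.
have coer := ms_coercive e0 e1 he1 he2 a0 a1 k0.
have T2 : q * T ^+ 2 <= e * dl / 8 * \sum_i k i ^+ 2.
  rewrite /q -mulrA ler_wpM2l//; first by rewrite !mulr_ge0 ?invr_ge0// ltW.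
  rewrite mulrC ler_pdivrMr// mulrC; apply: le_trans (sum_sqr (fun i => `|k i|)) _.
  by rewrite ler_wpM2l//; apply: ler_sum => i _; rewrite real_normK ?num_real.
have S2 : S ^+ 2 <= n%:R * \sum_i w i ^+ 2.
  apply: le_trans (sum_sqr (fun i => `|w i|)) _.
  by rewrite ler_wpM2l//; apply: ler_sum => i _; rewrite real_normK ?num_real.
have main : \sum_i (gz i * (J i - K i) - w i / p i * gz i * J i) <=
    - (q * T ^+ 2) + c1 * (S * T) + c2 * S ^+ 2 + c3 * (r * T) + c4 * (r * S).
  apply: (@le_trans _ _ (- (\sum_i k i / p i * ms a k i) +
     ((m * L / e + G / e ^+ 2) * S + c3 * r) * T +
     S * (L / e * ((m * T + m * L * S + 2 * r) / e + S * G / e ^+ 2)))).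
    rewrite -sumrN [_ * T]mulr_sumr [S * _]mulr_suml -!big_split/=; apply: ler_sum => i _.
    by rewrite lerD// gzE lerD.
  have -> : S * (L / e * ((m * T + m * L * S + 2 * r) / e + S * G / e ^+ 2)) =
     (L * m / e ^+ 2) * (S * T) + c2 * S ^+ 2 + c4 * (r * S).
    by rewrite /c2 /c4; field; rewrite gt_eqF.
  have -> : ((m * L / e + G / e ^+ 2) * S + c3 * r) * T =
     (m * L / e + G / e ^+ 2) * (S * T) + c3 * (r * T) by ring.
  by rewrite {1}/c1 [(_ + L * m / e ^+ 2) * (S * T)]mulrDl; move: coer T2; lra.
apply: (le_trans main).
have y1 : c1 * (S * T) <= q / 2 * T ^+ 2 + c1 ^+ 2 / (2 * q) * S ^+ 2.
  have : 0 <= q / 2 * (T - c1 / q * S) ^+ 2 by rewrite mulr_ge0 ?sqr_ge0// divr_ge0// ltW.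
  have -> : q / 2 * (T - c1 / q * S) ^+ 2 =
     q / 2 * T ^+ 2 + c1 ^+ 2 / (2 * q) * S ^+ 2 - c1 * (S * T) by field; rewrite gt_eqF.
  lra.
have y2 : c3 * (r * T) <= q / 2 * T ^+ 2 + c3 ^+ 2 / (2 * q) * r ^+ 2.
  have : 0 <= q / 2 * (T - c3 / q * r) ^+ 2 by rewrite mulr_ge0 ?sqr_ge0// divr_ge0// ltW.
  have -> : q / 2 * (T - c3 / q * r) ^+ 2 =
     q / 2 * T ^+ 2 + c3 ^+ 2 / (2 * q) * r ^+ 2 - c3 * (r * T) by field; rewrite gt_eqF.
  lra.
have y3 : c4 * (r * S) <= c4 * (S ^+ 2 + r ^+ 2).
  by rewrite ler_wpM2l//; have := sqr_ge0 (r - S); have := sqr_ge0 r; have := sqr_ge0 S; nra.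
have y4 : C0 * S ^+ 2 <= C0 * (n%:R * \sum_i w i ^+ 2) by rewrite ler_wpM2l.
have W0 : 0 <= \sum_i w i ^+ 2 by apply: sumr_ge0 => i _; exact: sqr_ge0.
have r20 := sqr_ge0 r; have S20 := sqr_ge0 S.
apply: (@le_trans _ _ (C0 * (S ^+ 2 + r ^+ 2))).
  have z1 : 0 <= c1 ^+ 2 / (2 * q) * r ^+ 2.
    by rewrite mulr_ge0// divr_ge0 ?sqr_ge0 ?mulr_ge0// ltW.
  have z2 : 0 <= c3 ^+ 2 / (2 * q) * S ^+ 2.
    by rewrite mulr_ge0// divr_ge0 ?sqr_ge0 ?mulr_ge0// ltW.
  have z3 : 0 <= c2 * r ^+ 2 by rewrite mulr_ge0.
  move: y1 y2 z1 z2; rewrite /C0.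
  move: (c1 ^+ 2 / (2 * q)) (c3 ^+ 2 / (2 * q)) => X1 X3 y1 y2 z1 z2.
  by lra.
rewrite mulrDr -[leRHS]mulrA [(1 + _) * _]mulrDl mul1r [leRHS]mulrDr.
have z4 : 0 <= C0 * \sum_i w i ^+ 2 by rewrite mulr_ge0.
have z5 : 0 <= C0 * (n%:R * r ^+ 2) by rewrite !mulr_ge0.
rewrite !mulrDr; lra.
Qed.

End algebra.

(** * A discrete Gronwall lemma *)

Section energy.
Context (R : realType) (n : nat).
Variable d : 'I_n -> 'I_n -> R.

(** With N steps of size t / N the quadratic errors add up to O(1 / N), which
    is why the constant D does not appear in the conclusion. *)
Lemma discrete_gronwall (E : R -> R) (kap rho D : R) : 0 <= kap -> 0 <= rho -> 0 <= D ->
  (forall t t', 0 <= t -> t < t' -> t' <= t + 1 ->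
     E t' <= E t + kap * (t' - t) * (E t + rho) + D * (t' - t) ^+ 2) ->
  E 0 = 0 -> forall t, 0 <= t -> E t <= rho * expR (kap * t).
Proof.
move=> kap0 rho0 D0 step E0 t; rewrite le_eqVlt => /predU1P[<-|t0].
  by rewrite E0 mulr_ge0// expR_ge0.
have it s k : 0 < s -> s <= 1 ->
    E (k%:R * s) + rho <= (1 + kap * s) ^+ k * (rho + k%:R * (D * s ^+ 2)).
  move=> s0 s1; have ks : 0 <= kap * s by rewrite mulr_ge0// ltW.
  have Ds : 0 <= D * s ^+ 2 by rewrite mulr_ge0// sqr_ge0.
  elim: k => [|k IH]; first by rewrite !mul0r E0 expr0 mul1r add0r addr0.
  have ks0 : 0 <= k%:R * s by rewrite mulr_ge0// ltW.
  have := step (k%:R * s) (k%:R * s + s) ks0; rewrite ltrDl lerD2l => /(_ s0 s1).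
  rewrite [k%:R * s + s - _]addrAC subrr add0r => h.
  have -> : k.+1%:R * s = k%:R * s + s by rewrite -natr1 mulrDl mul1r.
  have h1 : (1 + kap * s) * (E (k%:R * s) + rho) <=
      (1 + kap * s) * ((1 + kap * s) ^+ k * (rho + k%:R * (D * s ^+ 2))).
    by rewrite ler_wpM2l// addr_ge0.
  have h2 : D * s ^+ 2 <= (1 + kap * s) * (1 + kap * s) ^+ k * (D * s ^+ 2).
    by rewrite -exprS ler_peMl// exprn_ege1// lerDl.
  rewrite -natr1 [_ ^+ k.+1]exprS; move: h h1 h2.
  move: (E (k%:R * s + s)) (E (k%:R * s)) ((1 + kap * s) ^+ k) (D * s ^+ 2) => e1 e2 X Q h h1 h2.
  have -> : (1 + kap * s) * X * (rho + (k%:R + 1) * Q) =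
    (1 + kap * s) * (X * (rho + k%:R * Q)) + (1 + kap * s) * X * Q by ring.
  apply: (le_trans _ (lerD h1 h2)); rewrite mulrDl mul1r; lra.
have bnd N : t <= N.+1%:R -> E t + rho <= expR (kap * t) * (rho + D * t ^+ 2 / N.+1%:R).
  move=> tN; have N0 : 0 < N.+1%:R :> R by [].
  have N1 : N.+1%:R != 0 :> R by rewrite gt_eqF.
  have := it (t / N.+1%:R) N.+1; rewrite mulrCA mulfV// mulr1.
  rewrite divr_gt0// ler_pdivrMr// mul1r tN => /(_ isT isT) h.
  apply: (le_trans h); apply: ler_pM.
  - by rewrite exprn_ge0// addr_ge0// mulr_ge0// divr_ge0// ltW.
  - by rewrite addr_ge0// mulr_ge0// mulr_ge0// sqr_ge0.
  - have -> : kap * t = N.+1%:R * (kap * (t / N.+1%:R)) by field.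
    rewrite expRM_natl lerXn2r ?nnegrE ?expR_ge0 ?expR_ge1Dx//.
    by rewrite addr_ge0// mulr_ge0// divr_ge0// ltW.
  - by rewrite lerD2l le_eqVlt; apply/orP; left; apply/eqP; field.
have c : (fun N : nat => expR (kap * t) * (rho + D * t ^+ 2 / N.+1%:R)) @ \oo -->
    expR (kap * t) * (rho + D * t ^+ 2 * 0).
  apply: cvgM; first exact: cvg_cst.
  apply: cvgD; first exact: cvg_cst.
  by apply: cvgM; [exact: cvg_cst | exact: cvg_harmonic].
have : E t + rho <= expR (kap * t) * (rho + D * t ^+ 2 * 0).
  apply: (cvgr_to_ge c); near=> N; apply: bnd.
  apply/ltW/(lt_le_trans (truncnS_gt _)); rewrite ler_nat ltnS.
  near: N; exact: nbhs_infty_ge.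
by rewrite mulr0 addr0 mulrC; apply: le_trans; rewrite lerDl.
Unshelve. all: by end_near. Qed.

(** * The energy inequality *)

(** What the mollified solutions satisfy. Between two times t < t', the flux is
    a mean over [t, t'], so that the conservation of mass is exact, whereas the
    Maxwell-Stefan relation links the concentrations at time t to the mean flux,
    with a commutator error r and an error D (t' - t) due to the time variation.
    The constant D depends on the scale of mollification, G and L do not. *)
Record approx (G L r D : R) (C : R -> 'I_n -> space3 R -> R)
    (J : R -> R -> 'I_n -> 'I_3 -> space3 R -> R) : Prop := {
  ap_C1p : forall t i, 0 <= t -> C1p (C t i) ;
  ap_ge0 : forall t i x, 0 <= t -> 0 <= C t i x ;
  ap_sum : forall t x, 0 <= t -> \sum_i C t i x = 1 ;
  ap_grad : forall t i k x, 0 <= t -> `|grad k (C t i) x| <= G ;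
  ap_fluxC1p : forall t t' i k, 0 <= t -> t < t' -> C1p (J t t' i k) ;
  ap_flux : forall t t' i k x, 0 <= t -> t < t' -> `|J t t' i k x| <= L ;
  ap_fluxsum : forall t t' k x, 0 <= t -> t < t' -> \sum_i J t t' i k x = 0 ;
  ap_fluxgrad : forall t t' i k x, 0 <= t -> t < t' -> `|grad k (J t t' i k) x| <= D ;
  ap_mass : forall t t' i x, 0 <= t -> t < t' ->
    C t' i x - C t i x = - (t' - t) * \sum_k grad k (J t t' i k) x ;
  ap_ms : forall t t' i k x, 0 <= t -> t < t' ->
    `|grad k (C t i) x + ms d (fun j => C t j x) (fun j => J t t' j k x) i| <=
      r + D * (t' - t) }.

Section step.
Variables (e G L Kap : R).
Hypotheses (e0 : 0 < e) (e1 : e <= 1) (Kap0 : 0 <= Kap).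
Hypothesis pointwise : forall a b J K ga gb r, 0 <= r ->
    (forall i, 0 <= a i) -> \sum_i a i = 1 ->
    (forall i, 0 <= b i) -> \sum_i b i = 1 ->
    \sum_i J i = 0 -> \sum_i K i = 0 ->
    (forall i, `|J i| <= L) -> (forall i, `|K i| <= L) -> (forall i, `|ga i| <= G) ->
    (forall i, `|ga i + ms d a J i| <= r) -> (forall i, `|gb i + ms d b K i| <= r) ->
    let w (i : 'I_n) := a i - b i in let p i := a i + e in
    let gz i := (ga i - gb i) / p i - w i * ga i / p i ^+ 2 in
    is_true (\sum_i (gz i * (J i - K i) - w i / p i * gz i * J i) <=
             Kap * (\sum_i w i ^+ 2 + r ^+ 2)).

Variables (r D : R) (C Cb : R -> 'I_n -> space3 R -> R).
Variables (J Jb : R -> R -> 'I_n -> 'I_3 -> space3 R -> R).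
Hypotheses (r0 : 0 <= r) (D0 : 0 <= D).
Hypotheses (apC : approx G L r D C J) (apCb : approx G L r D Cb Jb).

Let w t i x := C t i x - Cb t i x.
Let p t i x := C t i x + e.
Let z t i x := w t i x * (p t i x)^-1.
Let E t := ave (fun x => \sum_i w t i x * z t i x).

Let p_gt0 t i x : 0 <= t -> 0 < p t i x.
Proof. by move=> t0; rewrite ltr_wpDl//; exact: (ap_ge0 apC). Qed.

Let C1p_w t i : 0 <= t -> C1p (w t i).
Proof. by move=> t0; apply: C1pD (ap_C1p apC i t0) (C1pN (ap_C1p apCb i t0)). Qed.

Let C1p_p t i : 0 <= t -> C1p (p t i).
Proof. by move=> t0; exact: C1pD (ap_C1p apC i t0) (C1p_cst e). Qed.

Let C1p_pV t i : 0 <= t -> C1p (fun x => (p t i x)^-1).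
Proof.
move=> t0; apply: (C1pV e0 (C1p_p i t0)) => x.
by rewrite lerDr; exact: (ap_ge0 apC).
Qed.

Let C1p_z t i : 0 <= t -> C1p (z t i).
Proof. by move=> t0; exact: C1pM (C1p_w i t0) (C1p_pV i t0). Qed.

Let gradz t i k x : 0 <= t -> grad k (z t i) x =
  (grad k (C t i) x - grad k (Cb t i) x) / p t i x - w t i x * grad k (C t i) x / p t i x ^+ 2.
Proof.
move=> t0; have cw := C1p_w i t0; have cp := C1p_p i t0.
have pn0 y : p t i y != 0 by rewrite gt_eqF// p_gt0.
have gw : grad k (w t i) x = grad k (C t i) x - grad k (Cb t i) x.
  rewrite (gradD k (ap_C1p apC i t0) (C1pN (ap_C1p apCb i t0))).
  by rewrite (gradN k (ap_C1p apCb i t0)).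
have gp : grad k (p t i) x = grad k (C t i) x.
  have := gradD k (ap_C1p apC i t0) (C1p_cst e) => /(congr1 (fun f => f x)).
  rewrite (_ : grad k (cst e) x = 0) ?addr0//.
  exact: derive_cst.
rewrite (gradM k cw (C1p_pV i t0)) (gradV k cp pn0) gw gp.
by ring.
Qed.

Let C_le1 t i x : 0 <= t -> C t i x <= 1.
Proof.
move=> t0; rewrite -(ap_sum apC x t0) (bigD1 i)//= lerDl sumr_ge0// => j _.
exact: (ap_ge0 apC).
Qed.

Let Cb_le1 t i x : 0 <= t -> Cb t i x <= 1.
Proof.
move=> t0; rewrite -(ap_sum apCb x t0) (bigD1 i)//= lerDl sumr_ge0// => j _.
exact: ap_ge0 apCb _ _ _ t0.
Qed.

Let w_le1 t i x : 0 <= t -> `|w t i x| <= 1.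
Proof.
move=> t0; rewrite ler_norml /w.
have := ap_ge0 apC i x t0; have := ap_ge0 apCb i x t0.
by have := C_le1 i x t0; have := Cb_le1 i x t0; lra.
Qed.

Let w2_le t i x : 0 <= t -> w t i x ^+ 2 <= 2 * (w t i x * z t i x).
Proof.
move=> t0; have p0 := p_gt0 i x t0; have p2 : p t i x <= 2.
  by have := C_le1 i x t0; have := e1; rewrite /p; lra.
rewrite /z; have -> : 2 * (w t i x * (w t i x * (p t i x)^-1)) = 2 * w t i x ^+ 2 / p t i x by ring.
by rewrite ler_pdivlMr// mulrC ler_wpM2r// sqr_ge0.
Qed.

Let bmz t i : 0 <= t -> bm (z t i). Proof. by move=> t0; exact: C1p_bm (C1p_z i t0). Qed.
Let bmw t i : 0 <= t -> bm (w t i). Proof. by move=> t0; exact: C1p_bm (C1p_w i t0). Qed.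

(* The Lipschitz constant of z in time *)
Let Dz := 3 * D * (2 / e + (e ^+ 2)^-1).

Let incr_z t t' i x : 0 <= t -> t < t' -> `|z t' i x - z t i x| <= Dz * (t' - t).
Proof.
move=> t0 tt'; have t'0 : 0 <= t' by rewrite (le_trans t0)// ltW.
have s0 : 0 < t' - t by rewrite subr_gt0.
have dC f (apf : exists C' J', approx G L r D C' J' /\ f = fun t => C' t i x) :
    `|f t' - f t| <= 3 * D * (t' - t).
  move: apf => [C' [J' [ap ->]]].
  rewrite (ap_mass ap i x t0 tt') normrM normrN (gtr0_norm s0) mulrC ler_wpM2r ?(ltW s0)//.
  apply: (le_trans (ler_norm_sum _ _ _)).
  apply: (@le_trans _ _ (\sum_(k < 3) D)); first by apply: ler_sum => k _; exact: (ap_fluxgrad ap).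
  by rewrite sumr_const card_ord -[_ *+ 3]mulr_natl.
have h1 : `|C t' i x - C t i x| <= 3 * D * (t' - t).
  by apply: (dC (fun t => C t i x)); exists C, J.
have h2 : `|Cb t' i x - Cb t i x| <= 3 * D * (t' - t).
  by apply: (dC (fun t => Cb t i x)); exists Cb, Jb.
have p0 := p_gt0 i x t0; have p0' := p_gt0 i x t'0.
have -> : z t' i x - z t i x = (w t' i x - w t i x) * (p t' i x)^-1 -
    w t i x * (C t' i x - C t i x) * ((p t' i x)^-1 * (p t i x)^-1).
  rewrite /z (_ : C t' i x - C t i x = p t' i x - p t i x); last by rewrite /p; ring.
  by field; rewrite !gt_eqF.
have pV s : 0 <= s -> 0 <= (p s i x)^-1 <= e^-1.
  move=> s0'; have ps := p_gt0 i x s0'; rewrite invr_ge0 ltW//= lef_pV2 ?posrE// lerDr.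
  exact: (ap_ge0 apC).
have /andP[v0 v1] := pV t t0; have /andP[v0' v1'] := pV t' t'0.
apply: (le_trans (ler_normB _ _)); rewrite !normrM !(ger0_norm v0') (ger0_norm v0).
have -> : Dz * (t' - t) = (3 * D * (t' - t) + 3 * D * (t' - t)) * e^-1 +
    1 * (3 * D * (t' - t)) * (e^-1 * e^-1).
  by rewrite /Dz; field; rewrite gt_eqF.
apply: lerD.
  apply: ler_pM => //.
  rewrite (_ : w t' i x - w t i x = (C t' i x - C t i x) - (Cb t' i x - Cb t i x)); last by
    rewrite /w; ring.
  by apply: (le_trans (ler_normB _ _)); exact: lerD.
apply: ler_pM.
- exact: mulr_ge0.
- exact: mulr_ge0.
- by apply: ler_pM => //; exact: w_le1.
- exact: ler_pM.
Qed.

Let kapp := 12 * Kap.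
Let DE := 6 * Kap * (2 * r * D + D ^+ 2) + 2 * n%:R * Dz ^+ 2.

(** The convexity of (w, p) |-> w^2 / p is made quantitative by an exact second
    order expansion of w^2 / p, with first order coefficients 2 z and - z^2 and
    remainder p' (z' - z)^2, where primes denote values at time t'. Mass
    conservation turns the first order part into divergences, which are
    integrated by parts. *)
Let energy_step t t' : 0 <= t -> t < t' -> t' <= t + 1 ->
  E t' <= E t + kapp * (t' - t) * (E t + r ^+ 2) + DE * (t' - t) ^+ 2.
Proof.
move=> t0 tt' t'1; have t'0 : 0 <= t' by rewrite (le_trans t0)// ltW.
set s := t' - t; have s0 : 0 < s by rewrite subr_gt0.
have s1 : s <= 1 by rewrite /s; lra.
pose k i l x := J t t' i l x - Jb t t' i l x.
have C1pk i l : C1p (k i l).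
  exact: C1pD (ap_fluxC1p apC i l t0 tt') (C1pN (ap_fluxC1p apCb i l t0 tt')).
have gk i l x : grad l (k i l) x = grad l (J t t' i l) x - grad l (Jb t t' i l) x.
  rewrite (gradD l (ap_fluxC1p apC i l t0 tt') (C1pN (ap_fluxC1p apCb i l t0 tt'))).
  by rewrite (gradN l (ap_fluxC1p apCb i l t0 tt')).
pose T1 i l x := z t i x * grad l (k i l) x.
pose T2 i l x := (z t i x * z t i x) * grad l (J t t' i l) x.
have C1pJ i l : C1p (J t t' i l) by exact: (ap_fluxC1p apC i l t0 tt').
have bT1 i l : bm (T1 i l) by exact: bmeasM (bmz i t0) (C1p_gbm (C1pk i l) l).
have bT2 i l : bm (T2 i l) by exact: bmeasM (bmeasM (bmz i t0) (bmz i t0)) (C1p_gbm (C1pJ i l) l).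
have bE u : 0 <= u -> bm (fun x => \sum_i w u i x * z u i x).
  by move=> u0; apply: bmeas_sum => i _; exact: bmeasM (bmw i u0) (bmz i u0).
(* T1 and T2 collect the divergences of the mean fluxes with coefficients z and z^2. *)
have incr i x : w t' i x * z t' i x = w t i x * z t i x +
    (- s * \sum_l (2 * T1 i l x - T2 i l x) + p t' i x * (z t' i x - z t i x) ^+ 2).
  have mC := ap_mass apC i x t0 tt'; have mCb := ap_mass apCb i x t0 tt'.
  have sumE : - s * \sum_l (2 * T1 i l x - T2 i l x) =
     2 * z t i x * (w t' i x - w t i x) - z t i x ^+ 2 * (p t' i x - p t i x).
    have -> : w t' i x - w t i x = (C t' i x - C t i x) - (Cb t' i x - Cb t i x) by rewrite /w; ring.
    have -> : p t' i x - p t i x = C t' i x - C t i x by rewrite /p; ring.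
    rewrite mC mCb -/s.
    rewrite (eq_bigr (fun l => (2 * z t i x - z t i x ^+ 2) * grad l (J t t' i l) x
       - 2 * z t i x * grad l (Jb t t' i l) x)); last first.
      by move=> l _; rewrite /T1 /T2 gk; ring.
    by rewrite sumrB -!mulr_sumr; ring.
  rewrite sumE /z; have p0 := p_gt0 i x t0; have p0' := p_gt0 i x t'0.
  by field; rewrite !gt_eqF.
have bSum i : bm (fun x => \sum_l (2 * T1 i l x - T2 i l x)).
  by apply: bmeas_sum => l _; exact: bmeasB (bmeasM (bmeas_cst _ 2) (bT1 i l)) (bT2 i l).
have rem i x : p t' i x * (z t' i x - z t i x) ^+ 2 <= 2 * Dz ^+ 2 * s ^+ 2.
  have h := incr_z i x t0 tt'; rewrite -/s in h.
  rewrite -mulrA; apply: ler_pM; rewrite ?sqr_ge0 ?(ltW (p_gt0 i x t'0))//.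
    by have := C_le1 i x t'0; have := e1; rewrite /p; lra.
  rewrite -exprMn -[(z t' i x - z t i x) ^+ 2]real_normK ?num_real//.
  by rewrite ler_sqr ?nnegrE// (le_trans _ h).
pose Q x := \sum_i \sum_l (2 * T1 i l x - T2 i l x).
have bQ : bm Q by apply: bmeas_sum => i _; exact: bSum.
have h1 : E t' <= E t + (- s * ave Q + n%:R * (2 * Dz ^+ 2 * s ^+ 2)).
  rewrite -aveZl// -[X in _ + (_ + X)]ave_cst -aveD; last 2 first.
    exact: bmeasM (bmeas_cst _ _) bQ.
    exact: bmeas_cst.
  rewrite -aveD; [|exact: bE|]; last first.
    exact: bmeasD (bmeasM (bmeas_cst _ (- s)) bQ) (bmeas_cst _ (n%:R * (2 * Dz ^+ 2 * s ^+ 2))).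
  apply: ave_le => [||x]; first exact: bE.
    exact: bmeasD (bE _ t0) (bmeasD (bmeasM (bmeas_cst _ (- s)) bQ) (bmeas_cst _ (n%:R * (2 * Dz
      ^+ 2 * s ^+ 2)))).
  rewrite (eq_bigr _ (fun i _ => incr i x)) big_split/= lerD2l big_split/= /Q -mulr_sumr lerD2l.
  apply: (@le_trans _ _ (\sum_(i < n) (2 * Dz ^+ 2 * s ^+ 2))); first by apply: ler_sum.
  by rewrite sumr_const card_ord -[_ *+ n]mulr_natl.
pose P l x := \sum_i (grad l (z t i) x * k i l x - z t i x * grad l (z t i) x * J t t' i l x).
have bP l : bm (P l).
  apply: bmeas_sum => i _; have bg := C1p_gbm (C1p_z i t0) l.
  exact: bmeasB (bmeasM bg (C1p_bm (C1pk i l))) (bmeasM (bmeasM (bmz i t0) bg) (C1p_bm (C1pJ i l))).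
have h2 : - ave Q = 2 * \sum_l ave (P l).
  have aT1 i l : ave (T1 i l) = - ave (fun x => grad l (z t i) x * k i l x).
    rewrite (ave_byparts l (C1p_z i t0) (C1pk i l)); congr (- _).
    by apply: eq_ave => x; rewrite mulrC.
  have aT2 i l : ave (T2 i l) = - (2 * ave (fun x => z t i x * grad l (z t i) x * J t t' i l x)).
    rewrite (ave_byparts l (C1pM (C1p_z i t0) (C1p_z i t0)) (C1pJ i l)); congr (- _).
    rewrite -aveZl; last first.
      exact: bmeasM (bmeasM (bmz i t0) (C1p_gbm (C1p_z i t0) l)) (C1p_bm (C1pJ i l)).
    by apply: eq_ave => x; rewrite (gradM l (C1p_z i t0) (C1p_z i t0)); ring.
  have aQ : ave Q = \sum_i \sum_l (2 * ave (T1 i l) - ave (T2 i l)).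
    rewrite /Q ave_sum//; apply: eq_bigr => i _; rewrite ave_sum; last first.
      by move=> l _; exact: bmeasB (bmeasM (bmeas_cst _ 2) (bT1 i l)) (bT2 i l).
    apply: eq_bigr => l _; rewrite aveB//; last exact: bmeasM (bmeas_cst _ 2) (bT1 i l).
    by rewrite aveZl.
  rewrite aQ exchange_big/= -sumrN mulr_sumr; apply: eq_bigr => l _.
  rewrite /P ave_sum; last first.
    move=> i _; have bg := C1p_gbm (C1p_z i t0) l.
    exact: bmeasB (bmeasM bg (C1p_bm (C1pk i l))) (bmeasM (bmeasM (bmz i t0) bg) (C1p_bm (C1pJ i l))).
  rewrite -sumrN mulr_sumr; apply: eq_bigr => i _; rewrite aT1 aT2 aveB; last 2 first.
  - exact: bmeasM (C1p_gbm (C1p_z i t0) l) (C1p_bm (C1pk i l)).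
  - exact: bmeasM (bmeasM (bmz i t0) (C1p_gbm (C1p_z i t0) l)) (C1p_bm (C1pJ i l)).
  by ring.
have Ds0 : 0 <= r + D * s by rewrite addr_ge0// mulr_ge0// ltW.
have h3 l : ave (P l) <= Kap * (2 * E t + (r + D * s) ^+ 2).
  rewrite -[X in _ * (_ + X)]ave_cst -aveZl; last exact: bE.
  rewrite -aveD; [|exact: bmeasM (bmeas_cst _ 2) (bE _ t0)|exact: bmeas_cst].
  rewrite -aveZl; last exact: bmeasD (bmeasM (bmeas_cst _ 2) (bE _ t0)) (bmeas_cst _ ((r + D *
    s) ^+ 2)).
  apply: ave_le => [||x]; first exact: bP.
    exact: bmeasM (bmeas_cst _ Kap) (bmeasD (bmeasM (bmeas_cst _ 2) (bE _ t0)) (bmeas_cst _ ((r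
      + D * s) ^+ 2))).
  apply: (@le_trans _ _ (Kap * (\sum_i w t i x ^+ 2 + (r + D * s) ^+ 2))); last first.
    by rewrite ler_wpM2l// lerD2r mulr_sumr; apply: ler_sum => i _; exact: w2_le.
  have := @pointwise (fun i => C t i x) (fun i => Cb t i x) (fun i => J t t' i l x)
    (fun i => Jb t t' i l x) (fun i => grad l (C t i) x) (fun i => grad l (Cb t i) x)
    (r + D * s) Ds0 (fun i => ap_ge0 apC i x t0) (ap_sum apC x t0)
    (fun i => ap_ge0 apCb i x t0) (ap_sum apCb x t0)
    (ap_fluxsum apC l x t0 tt') (ap_fluxsum apCb l x t0 tt')
    (fun i => ap_flux apC i l x t0 tt') (fun i => ap_flux apCb i l x t0 tt')
    (fun i => ap_grad apC i l x t0) (fun i => ap_ms apC i l x t0 tt') (fun i => ap_ms apCb i l x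
      t0 tt').
  apply: le_trans; rewrite /P le_eqVlt; apply/orP; left; apply/eqP.
  by apply: eq_bigr => i _; rewrite gradz.
apply: (le_trans h1); rewrite -addrA lerD2l mulNr -mulrN h2.
have h4 : \sum_l ave (P l) <= 3 * (Kap * (2 * E t + (r + D * s) ^+ 2)).
  apply: (@le_trans _ _ (\sum_(l < 3) (Kap * (2 * E t + (r + D * s) ^+ 2)))); first by apply: ler_sum.
  by rewrite sumr_const card_ord -[_ *+ 3]mulr_natl.
have h5 : s * (2 * \sum_l ave (P l)) <= s * (2 * (3 * (Kap * (2 * E t + (r + D * s) ^+ 2)))).
  by rewrite ler_wpM2l ?(ltW s0)// ler_wpM2l.
have h6 : (r + D * s) ^+ 2 <= r ^+ 2 + (2 * r * D + D ^+ 2) * s.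
  rewrite sqrrD exprMn -addrA lerD2l mulrDl.
  have : D ^+ 2 * s ^+ 2 <= D ^+ 2 * s.
    by rewrite ler_wpM2l ?sqr_ge0// expr2 ger_pMr.
  rewrite -mulr_natl; lra.
have h7 : s * Kap * (r + D * s) ^+ 2 <= s * Kap * (r ^+ 2 + (2 * r * D + D ^+ 2) * s).
  by rewrite ler_wpM2l// mulr_ge0// ltW.
have h8 : 0 <= s * Kap * r ^+ 2 by rewrite mulr_ge0 ?sqr_ge0// mulr_ge0// ltW.
rewrite /kapp /DE; move: h5 h7 h8.
move: (E t) (\sum_l ave (P l)) (Dz ^+ 2) (D ^+ 2) ((r + D * s) ^+ 2) => e_ S_ Z2 D2 X.
rewrite !expr2; lra.
Qed.

Hypothesis init : forall i x, C 0 i x = Cb 0 i x.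

Lemma energy_bound t : 0 <= t ->
  ave (fun x => \sum_i (C t i x - Cb t i x) ^+ 2) <= 2 * (r ^+ 2 * expR (12 * Kap * t)).
Proof.
move=> t0; apply: (@le_trans _ _ (2 * E t)).
  have bE : bm (fun x => \sum_i w t i x * z t i x).
    by apply: bmeas_sum => i _; exact: bmeasM (bmw i t0) (bmz i t0).
  rewrite -aveZl//; apply: ave_le => [||x].
  - by apply: bmeas_sum => i _; rewrite (_ : (fun _ => _) = fun x => w t i x * w t i x);
      [exact: bmeasM (bmw i t0) (bmw i t0) | apply/funext => x; rewrite expr2].
  - exact: bmeasM (bmeas_cst _ 2) bE.
  - by rewrite mulr_sumr; apply: ler_sum => i _; exact: w2_le.
have kap0 : 0 <= kapp by rewrite /kapp mulr_ge0.
have DE0 : 0 <= DE.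
  have rD0 : 0 <= 2 * r * D by apply: mulr_ge0 => //; exact: mulr_ge0.
  have a1 : 0 <= 2 * r * D + D ^+ 2 by apply: addr_ge0 => //; exact: sqr_ge0.
  have a2 : 0 <= 2 * n%:R * Dz ^+ 2 by apply: mulr_ge0; [exact: mulr_ge0 | exact: sqr_ge0].
  by apply: addr_ge0 => //; apply: mulr_ge0 => //; exact: mulr_ge0.
have E0 : E 0 = 0.
  apply: etrans (ave_cst 0); apply: eq_ave => x.
  by rewrite big1// => i _; rewrite /w init subrr mul0r.
by rewrite ler_wpM2l//; exact: (discrete_gronwall kap0 (sqr_ge0 r) DE0 energy_step E0 t0).
Qed.

End step.

End energy.

Section time_slices.
Context (R : realType).
Notation leb := (@lebesgue_measure R).

(** * Test functions of time *)

(** As n grows, tbump a b n tends to the indicator of ]a, b[, and tramp T n to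
    the positive part of T - t, whose derivative dramp T n stays bounded. *)
Definition tbump (a b : R) n (t : R) : R := flat (n.+1%:R * ((t - a) * (b - t))).

Definition tramp (T : R) n (t : R) : R := (T - t) * flat (n.+1%:R * (T - t)).

Definition dramp (T : R) n (t : R) : R := - flatpoly ('X + 1) (n.+1%:R * (T - t)).

Lemma continuous_time_bmeas (h : R -> R) M : continuous h -> (forall t, `|h t| <= M) ->
  bmeas (h : measurableTypeR R -> R).
Proof. by move=> ch hM; split; [exact: continuous_measurable_fun | exists M]. Qed.

Lemma is_derive_subl (T t : R) : is_derive t (1 : R) (fun t : R => T - t) (-1).
Proof. by apply: is_derive_affine => h; rewrite [h *: 1]mulr1; ring. Qed.

Lemma is_derive_tramp T n (t : R) : is_derive t (1 : R) (tramp T n) (dramp T n t).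
Proof.
have d1 := is_derive_subl T t.
have d2 : is_derive t (1 : R) (fun t : R => n.+1%:R * (T - t)) (- n.+1%:R).
  by apply: is_derive_affine => h; rewrite [h *: 1]mulr1; ring.
have d3 := @is_derive1_comp R (@flat R) (fun t : R => n.+1%:R * (T - t)) t _ _
  (is_derive_flatpoly 1 (n.+1%:R * (T - t))) d2.
apply: (is_derive_eq (is_deriveM d1 d3)).
rewrite /dramp /GRing.scale/=; set u := n.+1%:R * (T - t).
have -> : (T - t) * (flatpoly (flatD 1) u * - n.+1%:R) = - (u * flatpoly (flatD 1) u) by rewrite
  /u; ring.
rewrite /flat /flatpoly; case: ifP => u0; last by rewrite !(mulr0, mul0r, oppr0, addr0).
have -> : (flatD (1 : {poly R})).[u^-1] = u^-1 ^+ 2.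
  by rewrite /flatD derivC subr0 mulr1 hornerXn.
rewrite hornerD hornerX !hornerC mul1r; move: (expR _) => X.
by field; rewrite gt_eqF.
Qed.

Lemma dramp_le1 T n t : `|dramp T n t| <= 1.
Proof.
rewrite normrN /flatpoly; case: ifP => u0; last by rewrite normr0.
set u := n.+1%:R * (T - t) in u0 *; have v0 : 0 < u^-1 by rewrite invr_gt0.
rewrite !hornerE ger0_norm; last by rewrite mulr_ge0 ?expR_ge0// addr_ge0// ltW.
by rewrite expRN ler_pdivrMr ?expR_gt0// mul1r addrC expR_ge1Dx.
Qed.

Lemma continuous_flatpoly (q : {poly R}) : continuous (flatpoly q).
Proof. by apply: is_derive_continuous => t; exact: is_derive_flatpoly. Qed.

Lemma continuous_tbump a b n : continuous (tbump a b n).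
Proof.
move=> t; apply: (@continuous_comp _ _ _ (fun t => n.+1%:R * ((t - a) * (b - t))) (@flat R)).
  apply: cvgM; first exact: cvg_cst.
  by apply: cvgM; apply: cvgB; (exact: cvg_cst || exact: cvg_id).
exact: continuous_flat.
Qed.

Lemma continuous_scaled_subl T n : continuous (fun t : R => n.+1%:R * (T - t)).
Proof. by move=> t; apply: cvgM; [exact: cvg_cst | apply: cvgB; (exact: cvg_cst || exact: cvg_id)]. Qed.

Lemma continuous_tramp T n : continuous (tramp T n).
Proof. by apply: is_derive_continuous => t; exact: is_derive_tramp. Qed.

Lemma continuous_dramp T n : continuous (dramp T n).
Proof.
move=> t; apply: cvgN; apply: (@continuous_comp _ _ _ (fun t => n.+1%:R * (T - t)) (flatpoly _)).
  exact: continuous_scaled_subl.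
exact: continuous_flatpoly.
Qed.

Lemma tbump_le1 a b n t : `|tbump a b n t| <= 1.
Proof. by rewrite ger0_norm ?flat_ge0 ?flat_le1. Qed.

Lemma bmeas_tbump a b n : bmeas (tbump a b n : measurableTypeR R -> R).
Proof. by apply: (continuous_time_bmeas (M := 1)); [exact: continuous_tbump | exact: tbump_le1]. Qed.

Lemma bmeas_dramp T n : bmeas (dramp T n : measurableTypeR R -> R).
Proof. by apply: (continuous_time_bmeas (M := 1)); [exact: continuous_dramp | exact: dramp_le1]. Qed.

Lemma tramp_le T n t : 0 <= t -> `|tramp T n t| <= `|T|.
Proof.
move=> t0; rewrite /tramp normrM; have [tT|Tt] := ltP t T.
  rewrite -[leRHS]mulr1 ler_pM//; last by rewrite ger0_norm ?flat_ge0 ?flat_le1.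
  by rewrite !ger0_norm; lra.
by rewrite flatE ifN ?normr0 ?mulr0// -leNgt pmulr_rle0//; lra.
Qed.

Lemma cvg_tbump a b t : a < t -> t < b -> tbump a b ^~ t @ \oo --> (1 : R).
Proof.
move=> at_ tb; have := @cvg_flat R ((t - a) * (b - t)).
by rewrite ifT// mulr_gt0// subr_gt0.
Qed.

Lemma cvg_tramp T t : t < T -> tramp T ^~ t @ \oo --> T - t.
Proof.
move=> tT; rewrite -[X in _ --> X]mulr1; apply: cvgM; first exact: cvg_cst.
by have := @cvg_flat R (T - t); rewrite ifT// subr_gt0.
Qed.

Lemma cvg_dramp T t : t < T -> dramp T ^~ t @ \oo --> (- 1 : R).
Proof.
move=> tT; have s0 : 0 < T - t by rewrite subr_gt0.
have c1 : (fun n : nat => (n.+1%:R * (T - t))^-1 + 1) @ \oo --> (0 + 1 : R).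
  by apply: cvgD; [exact: cvg_invSn | exact: cvg_cst].
have c2 := @cvg_flat R (T - t); rewrite ifT// in c2.
have c := cvgN (cvgM c1 c2); rewrite add0r mulr1 in c.
rewrite (_ : dramp T ^~ t = fun n : nat =>
   - (((n.+1%:R * (T - t))^-1 + 1) * flat (n.+1%:R * (T - t)))); first exact: c.
apply/funext => n; rewrite /dramp /flatpoly.
by rewrite flatE ifT ?mulr_gt0// hornerD hornerX hornerC.
Qed.

(** * From test functions of time to almost every time *)

Lemma itv_cc_oo (f : R -> R) (a b : R) : bmeas (f : measurableTypeR R -> R) ->
  \int[leb]_(t in `[a, b]) f t = \int[leb]_(t in `]a, b[) f t.
Proof.
move=> bf; have mf (D : set R) : measurable_fun (D : set (measurableTypeR R)) (EFin \o f).
  by apply/measurable_EFinP/measurable_funTS; case: bf.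
have e1 := @integral_itv_obnd_cbnd R a (BRight b) (EFin \o f) (mf _).
have e2 := @integral_itv_bndo_bndc R (BRight a) b (EFin \o f) (mf _).
by congr fine; exact: (etrans (esym e1) (esym e2)).
Qed.

Lemma ae_pos_of_all (P : R -> Prop) :
  (forall a, 0 < a -> {ae leb, forall t, a < t -> P t}) -> {ae leb, forall t, 0 < t -> P t}.
Proof.
move=> h; have : {ae leb, forall t, forall n : nat, n.+1%:R^-1 < t -> P t}.
  by apply: ae_countable => n; apply: h; rewrite invr_gt0.
apply: ae_mono => t Pt t0; apply: (Pt (Num.truncn t^-1)).
by rewrite -[ltRHS]invrK ltf_pV2 ?posrE ?invr_gt0 ?truncnS_gt.
Qed.

(** In the limit the bumps give int_a^b (A + B) = 0 for all 0 < a < b, and the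
    integrand is differentiated out of its primitive. *)
Lemma slice_stationary (A B : R -> R) :
  bmeas (A : measurableTypeR R -> R) -> bmeas (B : measurableTypeR R -> R) ->
  (forall a b n, 0 < a -> a < b -> \int[leb]_(t in `]a, b[) (A t * tbump a b n t) =
     - \int[leb]_(t in `]a, b[) (B t * tbump a b n t)) ->
  {ae leb, forall t, 0 < t -> A t = - B t}.
Proof.
move=> bA bB h; apply: ae_pos_of_all => a a0.
have bu : bmeas (fun t : measurableTypeR R => A t + B t) by exact: bmeasD.
have : {ae leb, forall t, [set t | a < t] t -> A t + B t = 0}.
  apply: (@ae0_of_primitive R (fun t => A t + B t) a _ bu (@open_gt R a)) => //.
  move=> b /= ab; rewrite itv_cc_oo//.
  have [_ [M uM]] := bu.
  have : (fun n => \int[leb]_(t in `]a, b[) ((A t + B t) * tbump a b n t)) @ \oo -->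
      \int[leb]_(t in `]a, b[) (A t + B t).
    apply: (@cvg_Rint _ _ _ _ _ _ (leb_itv_fin a b _ _) _ _ M) => //.
    - by move=> n; apply: bmeasM => //; exact: bmeas_tbump.
    - by move=> n t _; rewrite normrM -[leRHS]mulr1 ler_pM// tbump_le1.
    - move=> t /=; rewrite in_itv/= => /andP[at_ tb].
      rewrite -[X in _ --> X]mulr1; apply: cvgM; first exact: cvg_cst.
      exact: cvg_tbump.
  rewrite (_ : (fun _ => _) = cst 0); first by move=> /(cvg_lim (@Rhausdorff _)); rewrite lim_cst.
  apply/funext => n.
  rewrite (_ : (fun t => _) = fun t => A t * tbump a b n t + B t * tbump a b n t); last first.
    by apply/funext => t; rewrite mulrDl.
  rewrite RintD ?leb_itv_fin//; last 2 first.
    exact: bmeasM bA (bmeas_tbump _ _ _).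
    exact: bmeasM bB (bmeas_tbump _ _ _).
  by rewrite h// addNr.
by apply: ae_mono => t h' at_; apply/eqP; rewrite -addr_eq0; apply/eqP; exact: h'.
Qed.

(** In the limit the ramps give
      a0 T - int_0^T A + int_0^T (T - s) B(s) ds = 0,
    and differentiating in T yields the claim. Ramps rather than steps are used
    because their derivatives are bounded uniformly in n. *)
Lemma slice_evolution (A B : R -> R) (a0 : R) :
  bmeas (A : measurableTypeR R -> R) -> bmeas (B : measurableTypeR R -> R) ->
  (forall T n, 0 < T -> a0 * tramp T n 0 + \int[leb]_(t in `]0, T[) (A t * dramp T n t) +
     \int[leb]_(t in `]0, T[) (B t * tramp T n t) = 0) ->
  {ae leb, forall t, 0 < t -> A t = a0 + \int[leb]_(s in `[0, t]) B s}.
Proof.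
move=> bA bB h; have [_ [MA AM]] := bA; have [_ [MB BM]] := bB.
have lim T : 0 < T -> a0 * T - \int[leb]_(t in `]0, T[) A t +
    \int[leb]_(t in `]0, T[) (B t * ((T - t) * \1_(`[0, T]%classic) t)) = 0.
  move=> T0.
  have mI : measurable (`[0, T]%classic : set (measurableTypeR R)) by [].
  have bcut (q : R -> R) M : continuous q -> (forall t, t \in `[0, T] -> `|q t| <= M) ->
      bmeas (fun t : measurableTypeR R => q t * \1_(`[0, T]%classic) t).
    move=> cq qM; split.
      by apply: measurable_funM; [exact: continuous_measurable_fun | case: (bmeas_indic R mI)].
    exists `|M| => t; rewrite indicE; case: (boolP (t \in _)) => [tI|_].
      by rewrite mulr1 (le_trans _ (ler_norm M))// qM//; move: tI; rewrite inE.
    by rewrite mulr0 normr0.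
  have bh n : bmeas (fun t : measurableTypeR R => tramp T n t * \1_(`[0, T]%classic) t).
    apply: (bcut _ `|T|); first exact: continuous_tramp.
    by move=> t; rewrite in_itv/= => /andP[t0 _]; exact: tramp_le.
  have bl : bmeas (fun t : measurableTypeR R => (T - t) * \1_(`[0, T]%classic) t).
    apply: (bcut _ T); first by move=> t; apply: cvgB; [exact: cvg_cst | exact: cvg_id].
    by move=> t; rewrite in_itv/= => /andP[t0 tT]; rewrite ger0_norm; lra.
  have c1 : (fun n => \int[leb]_(t in `]0, T[) (A t * dramp T n t)) @ \oo -->
      \int[leb]_(t in `]0, T[) (- A t).
    apply: (@cvg_Rint _ _ _ _ _ _ (leb_itv_fin 0 T _ _) _ _ MA) => //.
    - by move=> n; apply: bmeasM => //; exact: bmeas_dramp.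
    - exact: bmeasN.
    - by move=> n t _; rewrite normrM -[leRHS]mulr1 ler_pM// dramp_le1.
    - move=> t /=; rewrite in_itv/= => /andP[t0 tT].
      by rewrite -mulrN1; apply: cvgM; [exact: cvg_cst | exact: cvg_dramp].
  have c2 : (fun n => \int[leb]_(t in `]0, T[) (B t * (tramp T n t * \1_(`[0, T]%classic) t))) @ \oo -->
      \int[leb]_(t in `]0, T[) (B t * ((T - t) * \1_(`[0, T]%classic) t)).
    apply: (@cvg_Rint _ _ _ _ _ _ (leb_itv_fin 0 T _ _) _ _ (MB * `|T|)) => //.
    - by move=> n; exact: bmeasM bB (bh n).
    - exact: bmeasM bB bl.
    - move=> n t /=; rewrite in_itv/= => /andP[t0 tT]; rewrite normrM ler_pM//.
      rewrite normrM -[leRHS]mulr1 ler_pM//; first by rewrite tramp_le// ltW.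
      by rewrite indicE ger0_norm// lern1; case: (_ \in _).
    - move=> t /=; rewrite in_itv/= => /andP[t0 tT]; apply: cvgM; first exact: cvg_cst.
      by apply: cvgM; [exact: cvg_tramp | exact: cvg_cst].
  have c0 : (fun n => a0 * tramp T n 0) @ \oo --> a0 * T.
    apply: cvgM; first exact: cvg_cst.
    by have := cvg_tramp T0; rewrite subr0.
  have c := cvgD (cvgD c0 c1) c2.
  have eN : \int[leb]_(t in `]0, T[) (- A t) = - \int[leb]_(t in `]0, T[) A t.
    by rewrite RintN ?leb_itv_fin.
  rewrite eN in c.
  have z : (fun n => a0 * tramp T n 0 + \int[leb]_(t in `]0, T[) (A t * dramp T n t) +
      \int[leb]_(t in `]0, T[) (B t * (tramp T n t * \1_(`[0, T]%classic) t))) @ \oo --> (0 : R).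
    rewrite (_ : (fun n => _) = cst 0); first exact: cvg_cst.
    apply/funext => n; apply: etrans (h T n T0); congr (_ + _).
    apply: eq_Rintegral => t; rewrite inE/= in_itv/= => /andP[t0 tT].
    by rewrite indicE mem_set ?mulr1//= in_itv/= !ltW.
  exact: (cvg_unique (@Rhausdorff R) (c _ _) z).
(* T - s is expanded, in order to differentiate integrals of fixed functions;
   the cut-off at m only makes s bounded. *)
have {}lim m T : 0 < T -> T < m -> a0 * T - \int[leb]_(t in `[0, T]) A t +
   (T * \int[leb]_(t in `[0, T]) B t - \int[leb]_(t in `[0, T]) (B t * (t * \1_(`[0, m]%classic)
     t))) = 0.
  move=> T0 Tm; rewrite -[RHS](lim T T0) itv_cc_oo//; congr (_ + _).
  have mI : measurable (`[0, m]%classic : set (measurableTypeR R)) by [].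
  have bid : bmeas (fun t : measurableTypeR R => t * \1_(`[0, m]%classic) t).
    split; first by apply: measurable_funM => //; case: (bmeas_indic R mI).
    exists m => t; rewrite indicE; case: (boolP (t \in _)) => [|_].
      by rewrite inE/= in_itv/= mulr1 => /andP[t0 tm]; rewrite ger0_norm.
    by rewrite mulr0 normr0 ltW// (lt_trans T0).
  rewrite !itv_cc_oo//; last exact: bmeasM.
  rewrite -RintZl ?leb_itv_fin// -RintB ?leb_itv_fin//; last 2 first.
    exact: bmeasM (bmeas_cst _ _) bB.
    exact: bmeasM bB bid.
  apply: eq_Rintegral => t; rewrite inE/= in_itv/= => /andP[t0 tT].
  rewrite !indicE !mem_set ?mulr1 ?in_itv/=; first by ring.
    by rewrite /= in_itv/= !ltW.
  by rewrite /= in_itv/= ltW// ltW// (lt_trans tT).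
have key (m : R) : {ae leb, forall t, 0 < t -> t < m -> A t = a0 + \int[leb]_(s in `[0, t]) B s}.
  have mI : measurable (`[0, m]%classic : set (measurableTypeR R)) by [].
  have bid : bmeas (fun t : measurableTypeR R => t * \1_(`[0, m]%classic) t).
    split; first by apply: measurable_funM => //; case: (bmeas_indic R mI).
    exists `|m| => t; rewrite indicE; case: (boolP (t \in _)) => [|_].
      rewrite inE/= in_itv/= mulr1 => /andP[t0 tm]; rewrite !ger0_norm//.
      exact: le_trans tm.
    by rewrite mulr0 normr0.
  have bBt := bmeasM bB bid.
  have dA := ae_derive_primitive 0 bA; have dB := ae_derive_primitive 0 bB.
  have dBt := ae_derive_primitive 0 bBt.
  have : {ae leb, forall t : R, (0 < t -> is_derive t 1 (fun x => \int[leb]_(s in `[0, x]) A s)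
    (A t)) /\
    (0 < t -> is_derive t 1 (fun x => \int[leb]_(s in `[0, x]) B s) (B t))}.
    by apply: ae_mono2 dA dB => t.
  apply: ae_mono2 dBt => t ht [hA hB] t0 tm.
  have {}hA := hA t0; have {}hB := hB t0; have {}ht := ht t0.
  pose F x := a0 * x - \int[leb]_(s in `[0, x]) A s +
   (x * \int[leb]_(s in `[0, x]) B s - \int[leb]_(s in `[0, x]) (B s * (s * \1_(`[0, m]%classic) s))).
  have d1 : is_derive t (1 : R) (fun x : R => a0 * x) a0.
    by apply: is_derive_affine => y; rewrite [y *: 1]mulr1; ring.
  have dF := is_deriveD (is_deriveB d1 hA) (is_deriveB (is_deriveM (is_derive_id t 1) hB) ht).
  have F0 : is_derive t (1 : R) F 0.
    have c0 : is_derive t (1 : R) (cst (0 : R) : R -> R) 0 by exact: is_derive_cst.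
    apply: near_eq_is_derive c0.
    have : \forall y \near t, (y \in `]0, m[).
      by apply: near_in_itvoo; rewrite in_itv/= t0.
    by apply: filterS => y; rewrite in_itv/= => /andP[y0 ym]; rewrite /F lim.
  have := is_derive_uniq dF F0; rewrite /GRing.scale/= indicE mem_set ?mulr1; last first.
    by rewrite /= in_itv/= !ltW.
  by move=> e; lra.
have : {ae leb, forall t, forall n : nat, 0 < t -> t < n%:R -> A t = a0 + \int[leb]_(s in `[0, t]) B s}.
  by apply: ae_countable => n; exact: key.
apply: ae_mono => t ht t0; apply: (ht (Num.truncn t).+1) => //.
exact: truncnS_gt.
Qed.

End time_slices.

(** * Restriction of the weak formulation to time slices *)

Section space_time_slices.
Context (R : realType).
Notation leb := (@lebesgue_measure R).
Notation cell := (@cell R : set (mspace3 R)).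
Implicit Types (c : spacetime R -> R) (g : space3 R -> R).

Definition bst c := @bmeas _ (mspacetime R) R c.

Lemma Cm_time m : Cm m (fun p : spacetime R => p.2).
Proof. by apply: Cm_linear => // p; exact: cvg_snd. Qed.

Lemma Cm_flat m (q : spacetime R -> R) : Cm m q -> Cm m (fun p => flat (q p)).
Proof. by move=> Cq; exact: (Cm_comp (smooth1_flat R) Cq). Qed.

Lemma Cm_subl m (a : R) : Cm m (fun p : spacetime R => a - p.2).
Proof.
have h := CmM (Cm_cst m (-1 : R)) (Cm_time m).
rewrite (_ : (fun p => _) = fun p : spacetime R => cst a p + cst (-1) p * p.2).
  exact: CmD (Cm_cst m a) h.
by apply/funext => p /=; rewrite mulN1r.
Qed.

Lemma Cm_subr m (a : R) : Cm m (fun p : spacetime R => p.2 - a).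
Proof. exact: CmD (Cm_time m) (Cm_cst m (- a)). Qed.

Lemma Cm_tbump (a b : R) n m : Cm m (fun p : spacetime R => tbump a b n p.2).
Proof.
apply: Cm_flat; apply: (CmM (Cm_cst m (n.+1%:R : R))).
by apply: CmM; [exact: Cm_subr | exact: Cm_subl].
Qed.

Lemma Cm_tramp (T : R) n m : Cm m (fun p : spacetime R => tramp T n p.2).
Proof.
apply: CmM; first exact: Cm_subl.
by apply: Cm_flat; apply: (CmM (Cm_cst m (n.+1%:R : R))); exact: Cm_subl.
Qed.

Lemma tbump0 (a b t : R) n : a < b -> ~~ (a < t < b) -> tbump a b n t = 0.
Proof.
move=> ab nt; rewrite /tbump flatE ifN// -leNgt pmulr_rle0//.
move: nt; rewrite negb_and -!leNgt => /orP[ta|bt].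
  by rewrite mulr_le0_ge0//; lra.
by rewrite mulr_ge0_le0//; lra.
Qed.

Lemma tramp0 (T t : R) n : T <= t -> tramp T n t = 0.
Proof.
by move=> tT; rewrite /tramp flatE ifN ?mulr0// -leNgt pmulr_rle0//; lra.
Qed.

Lemma dramp0 (T t : R) n : T <= t -> dramp T n t = 0.
Proof.
by move=> tT; rewrite /dramp /flatpoly ifN ?oppr0// -leNgt pmulr_rle0//; lra.
Qed.

Lemma test_open_tbump g (a b : R) n : sm g -> 0 < a -> a < b ->
  test_open (fun p : spacetime R => g p.1 * tbump a b n p.2).
Proof.
move=> sg a0 ab; split; first by apply: smooth_tensor => // m; exact: Cm_tbump.
exists a, b; split=> // x t nt; rewrite /= tbump0 ?mulr0//.
by apply: contra nt => /andP[? ?]; rewrite !ltW.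
Qed.

Lemma test_closed_tramp g (T : R) n : sm g ->
  test_closed (fun p : spacetime R => g p.1 * tramp T n p.2).
Proof.
move=> sg; split; first by apply: smooth_tensor => // m; exact: Cm_tramp.
by exists T => x t Tt; rewrite /= tramp0 ?mulr0.
Qed.

Lemma Rint_tensor c (h : R -> R) (a b : R) : bst c ->
  bmeas (fun t : measurableTypeR R => h t * \1_(`]a, b[%classic) t) -> 0 <= a ->
  (forall t, 0 < t -> ~~ (a < t < b) -> h t = 0) ->
  \int[mu_spacetime R]_(p in cyl `]0, +oo[) (c p * h p.2) =
  \int[leb]_(t in `]a, b[) (ave (fun x => c (x, t)) * h t).
Proof.
move=> bc bh a0 h0; set h' := fun t => _ in bh.
have hh' t : a < t -> t < b -> h t = h' t.
  by move=> at_ tb; rewrite /h' indicE mem_set ?mulr1//= in_itv/= at_.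
transitivity (\int[mu_spacetime R]_(p in cell `*` `]a, b[) (c p * h' p.2)).
  rewrite Rintegral_mkcond [RHS]Rintegral_mkcond; congr Rintegral.
  apply/funext => -[x t]; rewrite !patchE.
  case: (pselect (cell x)) => cx; last first.
    by rewrite !memNset// => -[].
  have [/andP[at_ tb]|nt] := boolP (a < t < b).
    rewrite !mem_set/= ?hh'//; split=> //=; rewrite in_itv/= ?at_//.
    by rewrite andbT (le_lt_trans a0).
  rewrite [in RHS]memNset/=; last by move=> [_] /=; rewrite in_itv/=; exact/negP.
  case: (pselect (0 < t)) => t0.
    by rewrite mem_set/= ?h0 ?mulr0//; split=> //=; rewrite in_itv/= t0.
  by rewrite memNset//= => -[_] /=; rewrite in_itv/= andbT.
have bF : bst (fun p => c p * h' p.2).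
  have bh' : @bmeas _ (measurableTypeR R) R h' by exact: bh.
  have := @bmeas_snd _ _ (mspace3 R) (measurableTypeR R) R h' bh'.
  exact: (@bmeasM _ (mspacetime R) R).
have := @Rint_prod2 _ _ _ _ R (mu_space R) leb cell `]a, b[%classic
  (@measurable_cell R) (measurable_itv _) (@cell_fin R) (leb_itv_fin _ _ _ _) _ bF.
move=> e; apply: (etrans e); apply: eq_Rintegral => t; rewrite inE/= in_itv/= => /andP[at_ tb].
rewrite -hh'// -[X in X * _]/(ave _) -aveZr//.
exact: (@bmeas_slice2 _ _ (mspace3 R) (measurableTypeR R) R c t bc).
Qed.

Lemma bst_slice c t : bst c -> bm (fun x => c (x, t)).
Proof. exact: (@bmeas_slice2 _ _ (mspace3 R) (measurableTypeR R) R c t). Qed.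

Lemma bst_space g : bm g -> bst (fun p => g p.1).
Proof. exact: (@bmeas_fst _ _ (mspace3 R) (measurableTypeR R) R g). Qed.

Lemma bmeas_ave_slice c : bst c -> bmeas (fun t : measurableTypeR R => ave (fun x => c (x, t))).
Proof.
exact: (@bmeas_Rint2 _ _ (mspace3 R) (measurableTypeR R) R (mu_space R) cell
  (@measurable_cell R) (@cell_fin R) c).
Qed.

(** The null set depends on g; countably many test functions g are used in the
    sequel. *)
Lemma slice_gradient c (G : spacetime R -> R) k g : bst c -> bst G -> sm g ->
  (forall a b n, 0 < a -> a < b ->
     \int[mu_spacetime R]_(p in cyl `]0, +oo[) (c p * (grad k g p.1 * tbump a b n p.2)) =
     - \int[mu_spacetime R]_(p in cyl `]0, +oo[) (G p * (g p.1 * tbump a b n p.2))) ->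
  {ae leb, forall t, 0 < t ->
    ave (fun x => c (x, t) * grad k g x) = - ave (fun x => G (x, t) * g x)}.
Proof.
move=> bc bG sg wg.
have bcg : bst (fun p => c p * grad k g p.1).
  exact: bmeasM bc (bst_space (sm_bmeas (grad_sm k sg))).
have bGg : bst (fun p => G p * g p.1) by exact: bmeasM bG (bst_space (sm_bmeas sg)).
have := @slice_stationary R _ _ (bmeas_ave_slice bcg) (bmeas_ave_slice bGg).
apply => a b n a0 ab.
have bt : bmeas (fun t : measurableTypeR R => tbump a b n t * \1_(`]a, b[%classic) t).
  by apply: bmeasM; [exact: bmeas_tbump | exact: bmeas_indic].
rewrite -(Rint_tensor bcg bt (ltW a0) (fun t _ => @tbump0 a b t n ab)).
rewrite -(Rint_tensor bGg bt (ltW a0) (fun t _ => @tbump0 a b t n ab)).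
apply: etrans (etrans (wg _ _ n a0 ab) _); [|congr (- _)];
  by apply: eq_Rintegral => -[x t] _; rewrite mulrA.
Qed.

Lemma slice_mass c (J : 'I_3 -> spacetime R -> R) (a0 : R) g :
  bst c -> (forall k, bst (J k)) -> sm g ->
  (forall T n, 0 < T ->
     a0 * tramp T n 0 +
     \int[mu_spacetime R]_(p in cyl `]0, +oo[)
       (c p * (g p.1 * dramp T n p.2)) +
     \int[mu_spacetime R]_(p in cyl `]0, +oo[)
       (\sum_(k < 3) J k p * (grad k g p.1 * tramp T n p.2)) = 0) ->
  {ae leb, forall t, 0 < t ->
    ave (fun x => c (x, t) * g x) =
    a0 + \int[leb]_(s in `[0, t]) ave (fun x => \sum_(k < 3) J k (x, s) * grad k g x)}.
Proof.
move=> bc bJ sg wm.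
have bcg : bst (fun p => c p * g p.1) by exact: bmeasM bc (bst_space (sm_bmeas sg)).
have bJg : bst (fun p => \sum_(k < 3) J k p * grad k g p.1).
  by apply: bmeas_sum => k _; exact: bmeasM (bJ k) (bst_space (sm_bmeas (grad_sm k sg))).
have := @slice_evolution R _ _ a0 (bmeas_ave_slice bcg) (bmeas_ave_slice bJg).
apply => T n T0; apply: etrans (wm T n T0); congr (_ + _ + _).
  have bt : bmeas (fun t : measurableTypeR R => dramp T n t * \1_(`]0, T[%classic) t).
    by apply: bmeasM; [exact: bmeas_dramp | exact: bmeas_indic].
  rewrite -(Rint_tensor bcg bt (lexx 0)) => [|t t0]; last first.
    by rewrite t0/= -leNgt; exact: dramp0.
  by apply: eq_Rintegral => -[x t] _; rewrite mulrA.
have bt : bmeas (fun t : measurableTypeR R => tramp T n t * \1_(`]0, T[%classic) t).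
  split.
    apply: measurable_funM; first exact: (continuous_measurable_fun (@continuous_tramp R T n)).
    exact: measurable_indic.
  exists `|T| => t; rewrite indicE; case: (boolP (t \in _)) => [|_].
    by rewrite inE/= in_itv/= mulr1 => /andP[t0 _]; rewrite tramp_le// ltW.
  by rewrite mulr0 normr0.
rewrite -(Rint_tensor bJg bt (lexx 0)) => [|t t0]; last first.
  by rewrite t0/= -leNgt; exact: tramp0.
apply: eq_Rintegral => -[x t] _; rewrite mulr_suml; apply: eq_bigr => k _.
by rewrite mulrA.
Qed.

End space_time_slices.

(** * The commutator of mollification and multiplication *)

Section separated_kernel.
Context (R : realType) (N m : nat) (e f : nat -> space3 R -> R).
Hypotheses (se : forall a, sm (e a)) (sf : forall a, sm (f a)).
Hypothesis eK : forall x y, K N x y = \sum_(a < m) e a x * f a y.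
Implicit Types (h : space3 R -> R) (y : space3 R).

Lemma grad_conv_sep k h y : bm h ->
  grad k (conv N h) y = \sum_(a < m) ave (fun x => h x * e a x) * grad k (f a) y.
Proof.
move=> bh; have -> : conv N h = fun z => \sum_(a < m) ave (fun x => h x * e a x) * f a z.
  by apply/funext => z; exact: conv_sum.
exact: (@grad_sum R k m (fun a => ave (fun x => h x * e a x))).
Qed.

Lemma div_conv_sep k h y : bm h ->
  \sum_(a < m) ave (fun x => h x * grad k (e a) x) * f a y = - grad k (conv N h) y.
Proof.
move=> bh; rewrite grad_conv// opprK.
have bhe a : bm (fun x => h x * grad k (e a) x).
  exact: bmeasM bh (sm_bmeas (grad_sm k (se a))).
transitivity (ave (fun x => \sum_(a < m) h x * grad k (e a) x * f a y)).
  rewrite ave_sum => [|a _]; last exact: bmeasM (bhe a) (bmeas_cst _ (f a y)).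
  by apply: eq_bigr => a _; rewrite aveZr.
apply: eq_ave => x; rewrite (_ : (fun x => K N x y) = fun x => \sum_(a < m) f a y * e a x).
  by rewrite (@grad_sum R k m (f ^~ y) e)// mulr_sumr; apply: eq_bigr => a _; rewrite -mulrA [f
    a y * _]mulrC.
by apply/funext => z; rewrite eK; apply: eq_bigr => a _; rewrite mulrC.
Qed.

Lemma sep_bounds : exists A : nat -> R, forall a, [/\ forall x, `|e a x| <= A a,
  forall k x, `|grad k (e a) x| <= A a, forall x, `|f a x| <= A a &
  forall k x, `|grad k (f a) x| <= A a].
Proof.
have bd g : sm g -> exists2 B : R, 0 <= B &
    (forall x, `|g x| <= B) /\ (forall k x, `|grad k g x| <= B).
  move=> sg; have [_ [B gB]] := sm_bmeas sg; have [C gC] := sm_grad_bounded sg.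
  have B0 : 0 <= B := le_trans (normr_ge0 _) (gB 0).
  have C0 : 0 <= C := le_trans (normr_ge0 _) (gC 0 0).
  exists (B + C); first exact: addr_ge0.
  split=> [x|k x]; first by rewrite (le_trans (gB x))// lerDl.
  by rewrite (le_trans (gC k x))// lerDr.
have /choice[A hA] : forall a, exists Aa : R, [/\ forall x, `|e a x| <= Aa,
  forall k x, `|grad k (e a) x| <= Aa, forall x, `|f a x| <= Aa &
  forall k x, `|grad k (f a) x| <= Aa]; last by exists A.
move=> a; have [B B0 [eB gB]] := bd _ (se a); have [C C0 [fC gC]] := bd _ (sf a).
exists (B + C); split=> [x|k x|x|k x].
- by rewrite (le_trans (eB x))// lerDl.
- by rewrite (le_trans (gB k x))// lerDl.
- by rewrite (le_trans (fC x))// lerDr.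
- by rewrite (le_trans (gC k x))// lerDr.
Qed.

End separated_kernel.

Section commutator.
Context (R : realType).
Implicit Types (f h : space3 R -> R).

(** The Friedrichs commutator. It equals the mean of
    (conv N f y - f(x)) h(x) K N x y, and by conv_close f(x) may be replaced by
    conv N f x, whose distance to conv N f y is controlled by the first moment
    of the kernel. *)
Lemma conv_commutator N r f h Lf Lh y : moment_le N r -> bm f -> bm h -> 0 <= Lh ->
  (forall N k y, `|grad k (conv N f) y| <= Lf) -> (forall x, `|h x| <= Lh) ->
  `|conv N f y * conv N h y - conv N (fun x => f x * h x) y| <= 2 * Lh * Lf * r.
Proof.
move=> Nr bf bh Lh0 fL hL; have [f' ff' [bf' f'L]] := conv_close bf fL.
have bK := bm_K N y; set F := conv N f y.
have cF : C1p (conv N f) := sm_C1p (sm_conv N bf).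
have bcf : bm (conv N f) := C1p_bm cF.
have -> : conv N (fun x => f x * h x) y = ave (fun x => f' x * h x * K N x y).
  apply: (@ae_eq_Rint _ _ _ (mu_space R) _ (@measurable_cell R) _ _).
  - exact: bmeasM (bmeasM bf bh) bK.
  - exact: bmeasM (bmeasM bf' bh) bK.
  - by apply: ae_mono ff' => x e cx; rewrite e.
rewrite /conv -aveZl; last exact: bmeasM bh bK.
rewrite -aveB; [|by apply: bmeasM (bmeas_cst _ F) (bmeasM bh bK)|
  exact: bmeasM (bmeasM bf' bh) bK].
have bT : bm (fun x => Lh * (K N x y * `|conv N f x - conv N f y|) + Lh * (Lf * r) * K N x y).
  apply: bmeasD; apply: bmeasM; [exact: bmeas_cst| |exact: bmeas_cst|exact: bK].
  apply: bmeasM bK _; apply: bmeas_norm; exact: bmeasB bcf (bmeas_cst _ F).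
apply: (@le_trans _ _ (ave (fun x => Lh * (K N x y * `|conv N f x - conv N f y|)
    + Lh * (Lf * r) * K N x y))).
  apply: ave_norm_le bT _.
    by apply: bmeasB; [exact: bmeasM (bmeas_cst _ F) (bmeasM bh bK) |
      exact: bmeasM (bmeasM bf' bh) bK].
  move=> x; rewrite (_ : _ - _ = (F - f' x) * h x * K N x y); last by ring.
  rewrite !normrM (ger0_norm (K_ge0 N x y)).
  have -> : Lh * (K N x y * `|conv N f x - conv N f y|) + Lh * (Lf * r) * K N x y =
    (`|conv N f x - F| + Lf * r) * Lh * K N x y by rewrite /F; ring.
  rewrite ler_wpM2r ?K_ge0// ler_pM//.
  have -> : F - f' x = - (conv N f x - F) - (f' x - conv N f x) by ring.
  by rewrite (le_trans (ler_normB _ _))// normrN lerD2l f'L.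
rewrite aveD; last 2 first.
- apply: bmeasM (bmeas_cst _ Lh) _; apply: bmeasM bK _; apply: bmeas_norm.
  exact: bmeasB bcf (bmeas_cst _ F).
- exact: bmeasM (bmeas_cst _ _) bK.
rewrite !aveZl//; last first.
  by apply: bmeasM bK _; apply: bmeas_norm; exact: bmeasB bcf (bmeas_cst _ F).
rewrite ave_K mulr1 -mulrDr; have := Nr _ _ cF (fL N) y.
set u := ave _ => hu; have -> : 2 * Lh * Lf * r = Lh * (Lf * r + Lf * r) by ring.
by rewrite ler_wpM2l// lerD2r.
Qed.

End commutator.

(** * Integrals over time intervals *)

(** Clipping f at the level M reduces this to a bound valid everywhere. *)
Lemma Rint_le_cst_ae d (T : measurableType d) (R : realType)
    (mu : {measure set T -> \bar R}) (D : set T) (f : T -> R) M :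
  measurable D -> (mu D < +oo)%E -> 0 <= M -> bmeas f ->
  {ae mu, forall x, D x -> `|f x| <= M} ->
  `|\int[mu]_(x in D) f x| <= M * fine (mu D).
Proof.
move=> mD Dfin M0 bf fM; pose g x := Num.max (- M) (Num.min (f x) M).
have gM x : `|g x| <= M.
  rewrite ler_norml /g le_max lexx/= ge_max ge_min lexx orbT andbT.
  by rewrite (le_trans _ M0)// oppr_le0.
have bg : bmeas g.
  split; last by exists M.
  apply: measurable_maxr; first exact: measurable_cst.
  by apply: measurable_minr; [case: bf | exact: measurable_cst].
rewrite (ae_eq_Rint mD bf bg); first exact: Rint_le_cst.
apply: ae_mono fM => x fM Dx; have := fM Dx; rewrite ler_norml => /andP[h1 h2].
by rewrite /g (min_idPl h2) (max_idPr h1).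
Qed.

Section line_increments.
Context (R : realType).
Notation leb := (@lebesgue_measure R).
Implicit Types (h : measurableTypeR R -> R).

Lemma leb_len (t t' : R) : t < t' -> fine (leb `]t, t']) = t' - t.
Proof. by move=> tt'; rewrite lebesgue_measure_itv/= lte_fin tt'. Qed.

Lemma Rint_increment h (t t' : R) : bmeas h -> 0 <= t -> t < t' ->
  \int[leb]_(s in `[0, t']) h s = \int[leb]_(s in `[0, t]) h s + \int[leb]_(s in `]t, t']) h s.
Proof.
move=> bh t0 tt'; have := @Rintegral_itvB R h (BLeft 0) (BRight t') t.
move=> <-; [by rewrite addrC subrK| |by rewrite bnd_simp|by rewrite bnd_simp ltW].
by apply: (@bmeas_integrable _ (measurableTypeR R)) => //; exact: leb_itv_fin.
Qed.

Lemma ae_dense (P : R -> Prop) (t u : R) : 0 <= t -> t < u ->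
  {ae leb, forall s, 0 < s -> P s} -> exists2 s, t < s < u & P s.
Proof.
move=> t0 tu aeP; apply: contrapT => nP.
have : {ae leb, forall s, `]t, u[%classic s -> False}.
  apply: ae_mono aeP => s Ps; rewrite /= in_itv/= => /andP[ts su].
  by apply: nP; exists s; [rewrite ts su | exact: Ps (le_lt_trans t0 ts)].
move=> no; have := @ae_eq_Rint _ (measurableTypeR R) R leb `]t, u[%classic
  (measurable_itv _) (cst 1) (cst 0) (bmeas_cst _ 1) (bmeas_cst _ 0).
move=> /(_ _)-/(_ (ae_mono (fun s f Ds => False_ind _ (f Ds)) no)).
rewrite !Rintegral_cst//= mul1r mul0r lebesgue_measure_itv/= lte_fin tu /= => /eqP.
by rewrite subr_eq0 => /eqP ut; move: tu; rewrite ut ltxx.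
Qed.

End line_increments.

(** * Mollified solutions *)

Section mollified_solutions.
Context (R : realType) (n : nat).
Notation leb := (@lebesgue_measure R).
Variables (d : 'I_n -> 'I_n -> R) (dl dL : R).
Hypotheses (dl0 : 0 < dl) (d_ge : forall i j, dl <= d i j) (d_le : forall i j, d i j <= dL).
Hypothesis n0 : (0 < n)%N.
Variable L : R.
Hypothesis L0 : 0 <= L.

(** The gradient of the concentration i in the direction k is - msx c J i k. *)
Definition msx (c : 'I_n -> spacetime R -> R) (J : 'I_n -> 'I_3 -> spacetime R -> R) i k p :=
  ms d (c ^~ p) (fun j => J j k p) i.

(** What is needed of a solution. The relations sl_grad and sl_mass are the weak
    formulation on almost every time slice; the gradient of the concentrations
    has been replaced by its expression in terms of the fluxes, and the initial
    data only enter through the functional a0. *)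
Record slices (a0 : 'I_n -> (space3 R -> R) -> R) (c : 'I_n -> spacetime R -> R)
    (J : 'I_n -> 'I_3 -> spacetime R -> R) : Prop := {
  sl_c : forall i, bst (c i) ;
  sl_J : forall i k, bst (J i k) ;
  sl_ge0 : forall i p, 0 <= c i p ;
  sl_sum : forall p, \sum_i c i p = 1 ;
  sl_flux : forall i k p, `|J i k p| <= L ;
  sl_fluxsum : forall k p, \sum_i J i k p = 0 ;
  sl_grad : forall i k g, sm g -> {ae leb, forall t, 0 < t ->
    ave (fun x => c i (x, t) * grad k g x) = ave (fun x => msx c J i k (x, t) * g x)} ;
  sl_mass : forall i g, sm g -> {ae leb, forall t, 0 < t ->
    ave (fun x => c i (x, t) * g x) =
    a0 i g + \int[leb]_(s in `[0, t]) ave (fun x => \sum_(k < 3) J i k (x, s) * grad k g x)} }.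

Variables (m : nat -> nat) (e f : nat -> nat -> space3 R -> R).
Hypotheses (se : forall N a, sm (e N a)) (sf : forall N a, sm (f N a)).
Hypothesis eK : forall N x y, K N x y = \sum_(a < m N) e N a x * f N a y.

Let Lg := dL * (L + n%:R * L).

Let dL_ge0 : 0 <= dL.
Proof. exact/ltW/(dL0 dl0 d_ge d_le n0). Qed.

Let Lg_ge0 : 0 <= Lg.
Proof. by rewrite mulr_ge0// addr_ge0// mulr_ge0// ler0n. Qed.

(** Times at which the identities hold for all the test functions e N a. They
    are valid for all scales N together, as conv_close requires. *)
Definition good (a0 : 'I_n -> (space3 R -> R) -> R) c J (t : R) := forall N a i,
  (forall k, ave (fun x => c i (x, t) * grad k (e N a) x) =
             ave (fun x => msx c J i k (x, t) * e N a x)) /\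
  ave (fun x => c i (x, t) * e N a x) =
    a0 i (e N a) +
    \int[leb]_(s in `[0, t]) ave (fun x => \sum_(k < 3) J i k (x, s) * grad k (e N a) x).

Lemma ae_good a0 c J : slices a0 c J -> {ae leb, forall t, 0 < t -> good a0 c J t}.
Proof.
move=> sl; have H1 N a i k := sl_grad sl i k (se N a).
have H2 N a i := sl_mass sl i (se N a).
have H1' := ae_countable (fun N => ae_countable (fun a => ae_ord (fun i => ae_ord (H1 N a i)))).
have H2' := ae_countable (fun N => ae_countable (fun a => ae_ord (H2 N a))).
by apply: ae_mono2 H1' H2' => t h1 h2 t0 N a i; split=> [k|]; [exact: h1 | exact: h2].
Qed.

Definition divflux (J : 'I_n -> 'I_3 -> spacetime R -> R) N i a s :=
  ave (fun x => \sum_(k < 3) J i k (x, s) * grad k (e N a) x).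

Definition flux_coef (J : 'I_n -> 'I_3 -> spacetime R -> R) N i k a s :=
  ave (fun x => J i k (x, s) * e N a x).

(** At good times mollC is the mollification of the concentration at scale N
    (mollC_good). The formula is used at every time t >= 0, where it is Lipschitz
    in t, and it makes the initial value depend on a0 only. *)
Definition mollC (a0 : 'I_n -> (space3 R -> R) -> R) J N t i y :=
  \sum_(a < m N) (a0 i (e N a) + \int[leb]_(s in `[0, t]) divflux J N i a s) * f N a y.

Definition mollJ J N t t' i k y :=
  \sum_(a < m N) ((t' - t)^-1 * \int[leb]_(s in `]t, t']) flux_coef J N i k a s) * f N a y.

Lemma ave_bound (h : space3 R -> R) M : bm h -> (forall x, `|h x| <= M) -> `|ave h| <= M.
Proof. by move=> bh hM; rewrite -(ave_cst M); apply: ave_norm_le bh (bmeas_cst _ M) hM. Qed.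

Section one_solution.
Variables (a0 : 'I_n -> (space3 R -> R) -> R) (c : 'I_n -> spacetime R -> R).
Variable (J : 'I_n -> 'I_3 -> spacetime R -> R).
Hypothesis sl : slices a0 c J.

Let c_le1 i p : c i p <= 1.
Proof.
rewrite -(sl_sum sl p) (bigD1 i)//= lerDl sumr_ge0// => j _; exact: sl_ge0 sl j p.
Qed.

Let bmc i t : bm (fun x => c i (x, t)). Proof. exact: bst_slice (sl_c sl i). Qed.
Let bmJ i k t : bm (fun x => J i k (x, t)). Proof. exact: bst_slice (sl_J sl i k). Qed.

Let bst_ms i k : bst (msx c J i k).
Proof.
apply: bmeas_sum => j _; apply: bmeasM; first exact: bmeas_cst.
by apply: bmeasB; apply: bmeasM; (exact: sl_c sl _ || exact: sl_J sl _ _).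
Qed.

Let bmms i k t : bm (fun x => msx c J i k (x, t)). Proof. exact: bst_slice (bst_ms i k). Qed.

Let sum_norm_le (v : 'I_n -> R) M : (forall j, `|v j| <= M) -> \sum_j `|v j| <= n%:R * M.
Proof.
move=> vM; rewrite (le_trans (ler_sum _ (fun j _ => vM j)))// sumr_const card_ord.
by rewrite -[_ *+ n]mulr_natl.
Qed.

Let ms_le i k p : `|msx c J i k p| <= Lg.
Proof.
apply: (le_trans (ms_norm dl0 d_ge d_le _ _ _)); rewrite ler_wpM2l//.
rewrite (eq_bigr (fun j => c j p)) => [|j _]; last by rewrite ger0_norm// (sl_ge0 sl).
rewrite (sl_sum sl) mul1r lerD ?(sl_flux sl)// -[leRHS]mul1r ler_pM//.
- exact: sumr_ge0.
- by rewrite ger0_norm ?(sl_ge0 sl).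
- by apply: sum_norm_le => j; exact: sl_flux sl _ _ _.
Qed.

Section good_times.
Variables (t : R) (gt : good a0 c J t).

(** Since K N is a finite combination of the test functions, the weak relation
    between gradients and fluxes passes to mollifications exactly; in particular
    these are Lipschitz uniformly in N. *)
Lemma good_grad N i k y :
  grad k (conv N (fun x => c i (x, t))) y = - conv N (fun x => msx c J i k (x, t)) y.
Proof.
apply: oppr_inj; rewrite -(div_conv_sep (se N) (eK N))// opprK.
rewrite (conv_sum (bmms i k t) (se N) (eK N)); apply: eq_bigr => a _.
by have [-> _] := gt N a i.
Qed.

Lemma good_grad_le N i k y : `|grad k (conv N (fun x => c i (x, t))) y| <= Lg.
Proof.
by rewrite good_grad normrN; apply: conv_norm (bmms i k t) _ => x; exact: ms_le.
Qed.

Lemma good_sum N y : \sum_i conv N (fun x => c i (x, t)) y = 1.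
Proof.
rewrite -conv_csum// /conv (eq_ave (g := K N ^~ y)) ?ave_K// => x.
by rewrite (sl_sum sl) mul1r.
Qed.

Lemma good_ms N r i k y : moment_le N r ->
  `|ms d (fun j => conv N (fun x => c j (x, t)) y) (fun j => conv N (fun x => J j k (x, t)) y) i
    - conv N (fun x => msx c J i k (x, t)) y| <= n%:R * (dL * (2 * (2 * L * Lg * r))).
Proof.
move=> Nr.
have bcJ j l : bm (fun x => c j (x, t) * J l k (x, t)) by exact: bmeasM (bmc j t) (bmJ l k t).
have cm j l := conv_commutator y Nr (bmc j t) (bmJ l k t) L0
  (fun N' k' y' => good_grad_le N' j k' y') (fun x => sl_flux sl l k (x, t)).
rewrite /msx /ms conv_csum; last first.
  by move=> j; apply: bmeasM (bmeas_cst _ _) _; exact: bmeasB (bcJ j i) (bcJ i j).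
rewrite -sumrB; apply: (le_trans (ler_norm_sum _ _ _)).
rewrite mulr_natl -[X in _ *+ X]card_ord -sumr_const; apply: ler_sum => j _.
rewrite convZ; last exact: bmeasB (bcJ j i) (bcJ i j).
rewrite convD; [|exact: bcJ|by apply: bmeasN; exact: bcJ].
rewrite convN// -mulrBr normrM ler_pM//.
  by rewrite ger0_norm ?d_le// (le_trans _ (d_ge i j))// ltW.
set A := conv N _ y * conv N _ y; set B := conv N _ y * conv N _ y; set A' := conv _ _ _.
set B' := conv _ _ _; have -> : A - B - (A' - B') = (A - A') - (B - B') by ring.
by rewrite mulr_natl [_ *+ 2]mulr2n (le_trans (ler_normB _ _))// lerD// cm.
Qed.

End good_times.

Section scale.
Variables (N : nat) (A : nat -> R).
Hypothesis hA : forall a, [/\ forall x, `|e N a x| <= A a,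
  forall k x, `|grad k (e N a) x| <= A a, forall x, `|f N a x| <= A a &
  forall k x, `|grad k (f N a) x| <= A a].

Let S := \sum_(a < m N) A a * A a.

Let A0 a : 0 <= A a. Proof. by have [h _ _ _] := hA a; exact: le_trans (h 0). Qed.

Let S0 : 0 <= S. Proof. by apply: sumr_ge0 => a _; rewrite mulr_ge0. Qed.

Let bd i a : bmeas (divflux J N i a : measurableTypeR R -> R).
Proof.
apply: (@bmeas_ave_slice R (fun p => \sum_(k < 3) J i k p * grad k (e N a) p.1)).
apply: bmeas_sum => k _.
exact: bmeasM (sl_J sl i k) (bst_space (sm_bmeas (grad_sm k (se N a)))).
Qed.

Let bfc i k a : bmeas (flux_coef J N i k a : measurableTypeR R -> R).
Proof.
apply: (@bmeas_ave_slice R (fun p => J i k p * e N a p.1)).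
exact: bmeasM (sl_J sl i k) (bst_space (sm_bmeas (se N a))).
Qed.

Let bcJ i k y : bmeas ((fun s => conv N (fun x => J i k (x, s)) y) : measurableTypeR R -> R).
Proof.
apply: (@bmeas_ave_slice R (fun p => J i k p * K N p.1 y)).
exact: bmeasM (sl_J sl i k) (bst_space (bm_K N y)).
Qed.

Let divflux_le i a s : `|divflux J N i a s| <= 3 * L * A a.
Proof.
apply: ave_bound => [|x].
  by apply: bmeas_sum => k _; exact: bmeasM (bmJ i k s) (sm_bmeas (grad_sm k (se N a))).
apply: (le_trans (ler_norm_sum _ _ _)).
have -> : 3 * L * A a = \sum_(k < 3) L * A a.
  by rewrite sumr_const card_ord -[RHS]mulr_natl mulrA.
apply: ler_sum => k _; have [_ h _ _] := hA a.
by rewrite normrM ler_pM// (sl_flux sl).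
Qed.

Let Rint_incr_le h M t t' : bmeas (h : measurableTypeR R -> R) -> 0 <= t -> t < t' ->
  (forall s, `|h s| <= M) -> `|\int[leb]_(s in `]t, t']) h s| <= M * (t' - t).
Proof.
move=> bh t0 tt' hM; rewrite -(leb_len tt').
apply: (@Rint_le_cst _ (measurableTypeR R)) => //; exact: leb_itv_fin.
Qed.

Lemma sm_mollC t i : sm (mollC a0 J N t i).
Proof. by apply: sm_sum => a; exact: smZ. Qed.

Lemma sm_mollJ t t' i k : sm (mollJ J N t t' i k).
Proof. by apply: sm_sum => a; exact: smZ. Qed.

Let grad_mollC k t i y : grad k (mollC a0 J N t i) y =
  \sum_(a < m N) (a0 i (e N a) + \int[leb]_(s in `[0, t]) divflux J N i a s) * grad k (f N a) y.
Proof.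
exact: (@grad_sum R k (m N) (fun a => a0 i (e N a) + \int[leb]_(s in `[0, t]) divflux J N i a s)).
Qed.

Let grad_mollJ t t' i k l y : grad l (mollJ J N t t' i k) y = \sum_(a < m N)
  ((t' - t)^-1 * \int[leb]_(s in `]t, t']) flux_coef J N i k a s) * grad l (f N a) y.
Proof.
exact: (@grad_sum R l (m N)
  (fun a => (t' - t)^-1 * \int[leb]_(s in `]t, t']) flux_coef J N i k a s)).
Qed.

Let incr_le t t' i (g : nat -> R) : 0 <= t -> t < t' -> (forall a, `|g a| <= A a) ->
  `|\sum_(a < m N) (a0 i (e N a) + \int[leb]_(s in `[0, t']) divflux J N i a s) * g a
   - \sum_(a < m N) (a0 i (e N a) + \int[leb]_(s in `[0, t]) divflux J N i a s) * g a| <=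
  3 * L * S * (t' - t).
Proof.
move=> t0 tt' gA; rewrite -sumrB; apply: (le_trans (ler_norm_sum _ _ _)).
rewrite /S mulr_sumr mulr_suml; apply: ler_sum => a _.
rewrite (Rint_increment (bd i a) t0 tt').
set I := \int[leb]_(s in `]t, t']) _; rewrite -mulrBl.
have -> : 3 * L * (A a * A a) * (t' - t) = (3 * L * A a * (t' - t)) * A a by ring.
rewrite normrM ler_pM// (_ : _ - _ = I); last by ring.
by apply: Rint_incr_le => // s; exact: divflux_le.
Qed.

Lemma mollC_lip t t' i y : 0 <= t -> t < t' ->
  `|mollC a0 J N t' i y - mollC a0 J N t i y| <= 3 * L * S * (t' - t).
Proof. by move=> t0 tt'; apply: incr_le (fun a => f N a y) t0 tt' _ => a; have [] := hA a. Qed.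

Lemma grad_mollC_lip k t t' i y : 0 <= t -> t < t' ->
  `|grad k (mollC a0 J N t' i) y - grad k (mollC a0 J N t i) y| <= 3 * L * S * (t' - t).
Proof.
move=> t0 tt'; rewrite !grad_mollC.
by apply: incr_le (fun a => grad k (f N a) y) t0 tt' _ => a; have [] := hA a.
Qed.

Lemma mollC_good t i : good a0 c J t -> mollC a0 J N t i = conv N (fun x => c i (x, t)).
Proof.
move=> gt; apply/funext => y; rewrite (conv_sum (bmc i t) (se N) (eK N)).
by apply: eq_bigr => a _; have [_ ->] := gt N a i.
Qed.

Lemma mollJE t t' i k y : 0 <= t -> t < t' -> mollJ J N t t' i k y =
  (t' - t)^-1 * \int[leb]_(s in `]t, t']) conv N (fun x => J i k (x, s)) y.
Proof.
move=> t0 tt'; have lf := @leb_itv_fin R t t' false false.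
rewrite (@eq_Rintegral _ _ _ leb _ (fun s => \sum_(a < m N) flux_coef J N i k a s * f N a y));
  last first.
  by move=> s _; rewrite (conv_sum (bmJ i k s) (se N) (eK N)).
rewrite (@Rint_sum _ (measurableTypeR R))//; last first.
  by move=> a _; exact: bmeasM (bfc i k a) (bmeas_cst _ _).
rewrite mulr_sumr; apply: eq_bigr => a _.
by rewrite (@RintZr _ (measurableTypeR R))// mulrA.
Qed.

Lemma grad_mollJE t t' i k l y : 0 <= t -> t < t' -> grad l (mollJ J N t t' i k) y =
  (t' - t)^-1 * \int[leb]_(s in `]t, t']) grad l (conv N (fun x => J i k (x, s))) y.
Proof.
move=> t0 tt'; have lf := @leb_itv_fin R t t' false false; rewrite grad_mollJ.
rewrite (@eq_Rintegral _ _ _ leb _ (fun s => \sum_(a < m N) flux_coef J N i k a s * grad l (f N a) y));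
  last by move=> s _; rewrite (grad_conv_sep (se N) (sf N) (eK N)).
rewrite (@Rint_sum _ (measurableTypeR R))//; last first.
  by move=> a _; exact: bmeasM (bfc i k a) (bmeas_cst _ _).
rewrite mulr_sumr; apply: eq_bigr => a _.
by rewrite (@RintZr _ (measurableTypeR R))// mulrA.
Qed.

(** Good times are dense, so that closed conditions on Lipschitz functions of
    time extend from good times to all times. *)
Let closed_le (F : R -> R) D M : 0 <= D ->
  (forall t t', 0 <= t -> t < t' -> F t - F t' <= D * (t' - t)) ->
  (forall t, good a0 c J t -> F t <= M) -> forall t, 0 <= t -> F t <= M.
Proof.
move=> D0 Flip FM t t0; rewrite leNgt; apply/negP => Mt.
pose q := (F t - M) / (D + 1).
have D1 : 0 < D + 1 by lra.
have q0 : 0 < q by rewrite divr_gt0// subr_gt0.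
have tq : t < t + q by rewrite ltrDl.
have [s /andP[ts sq] gs] := ae_dense t0 tq (ae_good sl).
have := FM s gs; have := Flip t s t0 ts.
have : D * (s - t) <= D * q by rewrite ler_wpM2l//; lra.
have : q * (D + 1) = F t - M by rewrite /q divfK// gt_eqF.
lra.
Qed.

Let msDl a b (Jx : 'I_n -> R) i : ms d a Jx i - ms d b Jx i = ms d (fun j => a j - b j) Jx i.
Proof. by rewrite /ms -sumrB; apply: eq_bigr => j _; ring. Qed.

Let lip := 3 * L * S.

Let lip0 : 0 <= lip. Proof. by rewrite /lip !mulr_ge0. Qed.

(** The operator is linear in the fluxes, so that it commutes with the mean
    over ]t, t']. *)
Let ms_mean a t t' i k y (g : R) : 0 <= t -> t < t' ->
  g + ms d a (fun j => mollJ J N t t' j k y) i = (t' - t)^-1 * \int[leb]_(s in `]t, t'])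
    (g + ms d a (fun j => conv N (fun x => J j k (x, s)) y) i).
Proof.
move=> t0 tt'; have lf := @leb_itv_fin R t t' false false.
have tt'0 : t' - t != 0 by rewrite subr_eq0 gt_eqF.
have b1 j : bmeas ((fun s => a j * conv N (fun x => J i k (x, s)) y -
    a i * conv N (fun x => J j k (x, s)) y) : measurableTypeR R -> R).
  by apply: bmeasB; apply: bmeasM; [exact: bmeas_cst|exact: bcJ|exact: bmeas_cst|exact: bcJ].
rewrite (@RintD _ (measurableTypeR R))//; [|exact: bmeas_cst|]; last first.
  by apply: bmeas_sum => j _; apply: bmeasM (bmeas_cst _ _) (b1 j).
rewrite Rintegral_cst// leb_len// mulrDr mulrCA mulVf// mulr1; congr (_ + _).
rewrite (@Rint_sum _ (measurableTypeR R))//; last first.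
  by move=> j _; apply: bmeasM (bmeas_cst _ _) (b1 j).
rewrite mulr_sumr; apply: eq_bigr => j _; rewrite (@RintZl _ (measurableTypeR R))//.
rewrite (@RintB _ (measurableTypeR R))//; last 2 first.
- by apply: bmeasM (bmeas_cst _ _) _; exact: bcJ.
- by apply: bmeasM (bmeas_cst _ _) _; exact: bcJ.
rewrite !(@RintZl _ (measurableTypeR R))// !mollJE//.
by rewrite [RHS]mulrCA [in RHS]mulrBr; congr (_ * (_ - _)); rewrite mulrCA.
Qed.

(** The relations between concentrations and fluxes are obtained by averaging
    over the good times s in ]t, t']: at such an s the error is the commutator,
    and replacing s by t in the concentrations costs O(t' - t). *)
Lemma approx_moll r : moment_le N r -> 0 <= r ->
  approx d Lg L (n%:R * (dL * (2 * (2 * L * Lg * r)))) (3 * L * S * (1 + 2 * n%:R * dL * L))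
    (mollC a0 J N) (mollJ J N).
Proof.
move=> Nr r0; rewrite -/lip; have Clip := mollC_lip; have gClip := grad_mollC_lip.
have LS : L * S <= lip by rewrite /lip -mulrA; have := mulr_ge0 L0 S0; lra.
have nDL : 0 <= 2 * n%:R * dL * L by rewrite !mulr_ge0// ler0n.
have lipD : lip <= lip * (1 + 2 * n%:R * dL * L) by rewrite ler_peMr// lerDl.
have invt (u : R) : 0 < u -> 0 <= u^-1 by move=> u0; rewrite invr_ge0 ltW.
split=> [t i t0|t i y t0|t y t0|t i k y t0|t t' i k t0 tt'|t t' i k y t0 tt'|t t' k y t0 tt'|
  t t' i k y t0 tt'|t t' i y t0 tt'|t t' i k y t0 tt'].
- exact: sm_C1p (sm_mollC t i).
- rewrite -oppr_le0.
  apply: (@closed_le (fun t => - mollC a0 J N t i y) lip) t0 => // [s s' s0 ss'|s gs].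
    by have := Clip s s' i y s0 ss'; rewrite -/lip ler_norml => /andP[? ?]; lra.
  rewrite mollC_good// oppr_le0 /conv; apply: ave_ge0 => x.
  by rewrite mulr_ge0 ?K_ge0// (sl_ge0 sl).
- apply/eqP; rewrite -subr_eq0 -normr_le0.
  apply: (@closed_le (fun t => `|\sum_i mollC a0 J N t i y - 1|) (n%:R * lip)) t0 => //.
  + by rewrite mulr_ge0.
  + move=> s s' s0 ss'; apply: (le_trans (lerB_dist _ _)).
    rewrite (_ : _ - _ - _ = - \sum_i (mollC a0 J N s' i y - mollC a0 J N s i y)); last first.
      by rewrite sumrB; ring.
    rewrite normrN -mulrA mulr_natl -[X in _ *+ X]card_ord -sumr_const.
    apply: (le_trans (ler_norm_sum _ _ _)); apply: ler_sum => j _; exact: Clip.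
  + move=> s gs; under eq_bigr do rewrite mollC_good//.
    by rewrite (good_sum s) subrr normr0.
- apply: (@closed_le (fun t => `|grad k (mollC a0 J N t i) y|) lip) t0 => //.
    move=> s s' s0 ss'; apply: (le_trans (lerB_dist _ _)).
    by rewrite distrC; exact: gClip.
  by move=> s gs; rewrite mollC_good//; exact: good_grad_le.
- exact: sm_C1p (sm_mollJ t t' i k).
- have tt'0 : 0 < t' - t by rewrite subr_gt0.
  rewrite mollJE// normrM (ger0_norm (invt _ tt'0)) ler_pdivrMl// mulrC.
  apply: Rint_incr_le => // s.
  by apply: conv_norm (bmJ i k s) _ => x; exact: sl_flux sl _ _ _.
- under eq_bigr do rewrite mollJE//.
  have lf := @leb_itv_fin R t t' false false.
  rewrite -mulr_sumr -(@Rint_sum _ (measurableTypeR R))//.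
  rewrite (@Rint_eq0 _ (measurableTypeR R)) ?mulr0// => s.
  rewrite -conv_csum; last by move=> i; exact: bmJ.
  by rewrite /conv -[RHS](ave_cst 0); apply: eq_ave => x; rewrite (sl_fluxsum sl) mul0r.
- have tt'0 : 0 < t' - t by rewrite subr_gt0.
  apply: (le_trans _ lipD); apply: (le_trans _ LS).
  rewrite grad_mollJ /S mulr_sumr; apply: (le_trans (ler_norm_sum _ _ _)).
  apply: ler_sum => a _; have [h _ _ h'] := hA a; rewrite mulrA normrM ler_pM//.
  rewrite normrM (ger0_norm (invt _ tt'0)) ler_pdivrMl// mulrC.
  apply: Rint_incr_le => // s.
  apply: ave_bound => [|x]; first exact: bmeasM (bmJ i k s) (sm_bmeas (se N a)).
  by rewrite normrM ler_pM// (sl_flux sl).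
- have lf := @leb_itv_fin R t t' false false.
  have tt'0 : t' - t != 0 by rewrite subr_eq0 gt_eqF.
  have E : - (t' - t) * \sum_(k < 3) grad k (mollJ J N t t' i k) y =
     \int[leb]_(s in `]t, t']) \sum_(a < m N) divflux J N i a s * f N a y.
    under eq_bigr do rewrite grad_mollJE//.
    rewrite -mulr_sumr mulrA mulNr mulfV// mulN1r -(@Rint_sum _ (measurableTypeR R))//; last first.
      move=> k _; rewrite (_ : (fun s => _) = fun s => \sum_(a < m N) flux_coef J N i k a s *
        grad k (f N a) y).
        by apply: bmeas_sum => a _; exact: bmeasM (bfc i k a) (bmeas_cst _ _).
      by apply/funext => s; rewrite (grad_conv_sep (se N) (sf N) (eK N)).
    rewrite -(@RintN _ (measurableTypeR R))//; last first.
      apply: bmeas_sum => k _; rewrite (_ : (fun s => _) = fun s => \sum_(a < m N) flux_coef J N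
        i k a s * grad k (f N a) y).
        by apply: bmeas_sum => a _; exact: bmeasM (bfc i k a) (bmeas_cst _ _).
      by apply/funext => s; rewrite (grad_conv_sep (se N) (sf N) (eK N)).
    apply: eq_Rintegral => s _; rewrite -sumrN.
    under eq_bigr do rewrite -(div_conv_sep (se N) (eK N))//.
    rewrite exchange_big/=; apply: eq_bigr => a _; rewrite -mulr_suml; congr (_ * _).
    rewrite /divflux ave_sum// => k _.
    exact: bmeasM (bmJ i k s) (sm_bmeas (grad_sm k (se N a))).
  rewrite E (@Rint_sum _ (measurableTypeR R))//; last first.
    by move=> a _; exact: bmeasM (bd i a) (bmeas_cst _ _).
  rewrite -sumrB; apply: eq_bigr => a _; rewrite (@RintZr _ (measurableTypeR R))//.
  by rewrite (Rint_increment (bd i a) t0 tt') -mulrBl; congr (_ * _); ring.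
- have tt'0 : 0 < t' - t by rewrite subr_gt0.
  have lf := @leb_itv_fin R t t' false false.
  set D := lip * _; set r' := n%:R * _.
  have r'0 : 0 <= r' by rewrite /r'; do !apply: mulr_ge0 => //.
  have D0 : 0 <= D := le_trans lip0 lipD.
  rewrite ms_mean// normrM (ger0_norm (invt _ tt'0)) ler_pdivrMl// mulrC.
  rewrite -[X in _ * X](leb_len tt'); apply: (@Rint_le_cst_ae _ (measurableTypeR R)) => //.
  + by rewrite addr_ge0// mulr_ge0// ltW.
  + apply: bmeasD (bmeas_cst _ _) _; apply: bmeas_sum => j _; apply: bmeasM (bmeas_cst _ _) _.
    by apply: bmeasB; apply: bmeasM; [exact: bmeas_cst|exact: bcJ|exact: bmeas_cst|exact: bcJ].
  apply: ae_mono (ae_good sl) => s gs; rewrite /= in_itv/= => /andP[ts st'].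
  have {}gs := gs (le_lt_trans t0 ts).
  set a := fun j => mollC a0 J N t j y; set Js := fun j => conv N _ y.
  pose b j := mollC a0 J N s j y; pose eta := lip * (t' - t).
  have eta0 : 0 <= eta by rewrite mulr_ge0// ltW.
  have le_eta : lip * (s - t) <= eta by rewrite ler_wpM2l//; lra.
  have abj j : `|a j - b j| <= eta.
    by rewrite distrC; apply: (le_trans (Clip _ _ j y t0 ts)).
  have hgs : `|grad k (mollC a0 J N s i) y + ms d b Js i| <= r'.
    have eb : b = fun j => conv N (fun x => c j (x, s)) y.
      by apply/funext => j; rewrite /b mollC_good.
    by rewrite mollC_good// good_grad// addrC eb; exact: good_ms.
  have hg : `|grad k (mollC a0 J N t i) y - grad k (mollC a0 J N s i) y| <= eta.
    by rewrite distrC; apply: (le_trans (gClip k _ _ i y t0 ts)).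
  have Jsj j : `|Js j| <= L.
    by apply: conv_norm (bmJ j k s) _ => x; exact: sl_flux sl _ _ _.
  have hm : `|ms d (fun j => a j - b j) Js i| <= 2 * n%:R * dL * L * eta.
    apply: (le_trans (ms_norm dl0 d_ge d_le _ _ _)).
    have -> : 2 * n%:R * dL * L * eta = dL * (n%:R * eta * L + eta * (n%:R * L)) by ring.
    rewrite ler_wpM2l// lerD// ler_pM//.
    * exact: sumr_ge0.
    * exact: sum_norm_le.
    * exact: sumr_ge0.
    * exact: sum_norm_le.
  have := msDl a b Js i; rewrite /D -/eta.
  set X := ms d a Js i in |- *; set Y := ms d b Js i in hgs |- *; set Z := ms d (fun j => _) _ _
    in hm |- *.
  set u := grad k (mollC a0 J N t i) y in hg |- *; set v := grad k (mollC a0 J N s i) y in hg hgs.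
  move=> XYZ; have -> : u + X = (u - v) + (v + Y) + Z by rewrite -XYZ; ring.
  have -> : lip * (1 + 2 * n%:R * dL * L) * (t' - t) = eta + 2 * n%:R * dL * L * eta.
    by rewrite /eta; ring.
  apply: (le_trans (ler_normD _ _)); have := ler_normD (u - v) (v + Y).
  lra.
Qed.

End scale.
End one_solution.
End mollified_solutions.

(** * Uniqueness *)

Section uniqueness.
Context (R : realType) (n : nat).
Notation leb := (@lebesgue_measure R).
Notation cell := (@cell R : set (mspace3 R)).
Variables (d : 'I_n -> 'I_n -> R) (dl dL : R).
Hypotheses (dl0 : 0 < dl) (d_ge : forall i j, dl <= d i j) (d_le : forall i j, d i j <= dL).
Hypothesis d_sym : forall i j, d i j = d j i.
Hypothesis n0 : (0 < n)%N.
Variable L : R.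
Hypothesis L0 : 0 <= L.

Lemma separated_kernels : exists (m : nat -> nat) (e f : nat -> nat -> space3 R -> R),
  [/\ forall N a, sm (e N a), forall N a, sm (f N a) &
      forall N x y, K N x y = \sum_(a < m N) e N a x * f N a y].
Proof.
have /choice[z hz] : forall N : nat, exists z : nat * (nat -> space3 R -> R) * (nat -> space3 R -> R),
    [/\ forall a, sm (z.1.2 a), forall a, sm (z.2 a) &
        forall x y, K N x y = \sum_(a < z.1.1) z.1.2 a x * z.2 a y].
  by move=> N; have [m [e [f h]]] := sep_sum (sep_K R N); exists (m, e, f).
exists (fun N => (z N).1.1), (fun N => (z N).1.2), (fun N => (z N).2).
by split=> N; have [h1 h2 h3] := hz N.
Qed.

Lemma regularisation_exists : exists e : R,
  [/\ 0 < e, e <= 1, e * n%:R * dL ^+ 2 <= dl ^+ 2 & 4 * e * n%:R <= 1].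
Proof.
have dLp : 0 < dL := dL0 dl0 d_ge d_le n0.
have np : 0 < n%:R :> R by rewrite ltr0n.
have n1 : 1 <= n%:R :> R by rewrite ler1n.
have q0 : 0 < n%:R * dL ^+ 2 by rewrite mulr_gt0// exprn_gt0.
exists (Num.min (dl ^+ 2 / (n%:R * dL ^+ 2)) (4 * n%:R)^-1); set e := Num.min _ _.
have e1 : e <= dl ^+ 2 / (n%:R * dL ^+ 2) by rewrite ge_min lexx.
have e2 : e <= (4 * n%:R)^-1 by rewrite ge_min lexx orbT.
have n4 : 0 < 4 * n%:R :> R by rewrite mulr_gt0.
have e4 : e * (4 * n%:R) <= 1 by rewrite -ler_pdivlMr// div1r.
have e0 : 0 < e.
  by rewrite lt_min invr_gt0 n4 andbT divr_gt0// exprn_gt0.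
split=> //.
- have : e * 4 <= e * (4 * n%:R) by rewrite ler_wpM2l// ?ler_peMr// ltW.
  lra.
- by rewrite -mulrA -ler_pdivlMr.
- by rewrite (mulrC 4) -mulrA.
Qed.

Section two_solutions.
Variables (a0 : 'I_n -> (space3 R -> R) -> R) (c cb : 'I_n -> spacetime R -> R).
Variables (J Jb : 'I_n -> 'I_3 -> spacetime R -> R).
Hypotheses (sl : slices d L a0 c J) (slb : slices d L a0 cb Jb).

Let eq0_of_small (z C : R) : 0 <= C -> (forall del, 0 < del -> `|z| <= C * del) -> z = 0.
Proof.
move=> C0 h; apply/eqP; rewrite -normr_le0 leNgt; apply/negP => z0.
have C1 : 0 < C + 1 by lra.
have := h (`|z| / (C + 1)) (divr_gt0 z0 C1); rewrite mulrA ler_pdivlMr//.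
by rewrite mulrDr mulr1 (mulrC C) gerDl leNgt z0.
Qed.

(** At a good time t the energy bound gives a mean square of order del^2 for
    the mollified differences, for all large N. Their integrals against a smooth
    g are then O(del), by the inequality |s| <= del + s^2 / del, and converge to
    the integral of the difference itself against g. *)
Lemma slices_ae_slice_eq : {ae leb, forall t, 0 < t -> forall i,
  {ae mu_space R, forall x, cell x -> c i (x, t) - cb i (x, t) = 0}}.
Proof.
have [m [e [f [se sf eK]]]] := separated_kernels.
have [eps [eps0 eps1 eps2 eps3]] := regularisation_exists.
have dLp : 0 < dL := dL0 dl0 d_ge d_le n0.
pose Lg := dL * (L + n%:R * L).
have dLp' : 0 <= dL := ltW dLp.
have Lg0 : 0 <= Lg by rewrite mulr_ge0// addr_ge0// mulr_ge0.
have [Kap Kap0 hKap] := energy_pointwise dl0 d_ge d_le d_sym eps0 eps1 eps2 eps3 Lg0 L0.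
have := ae_good se sl; have := ae_good se slb; apply: ae_mono2 => t gbt gt t0 i.
have {}gt := gt t0; have {}gbt := gbt t0.
have bw : bm (fun x => c i (x, t) - cb i (x, t)).
  exact: bmeasB (bst_slice t (sl_c sl i)) (bst_slice t (sl_c slb i)).
apply: (sm_total bw) => g sg; have [_ [M gM]] := sm_bmeas sg.
have M0 : 0 <= M := le_trans (normr_ge0 _) (gM 0).
pose E := expR (12 * Kap * t); have E0 : 0 < E := expR_gt0 _.
have ME0 : 0 <= M * (1 + 2 * E) by rewrite mulr_ge0//; lra.
apply: (@eq0_of_small _ (M * (1 + 2 * E) + 1)) => [|del del0]; first lra.
pose Cst := n%:R * (dL * (2 * (2 * L * Lg))).
have Cst0 : 0 <= Cst by do !apply: mulr_ge0 => //.
have Cst1 : 0 < Cst + 1 by lra.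
pose r := del / (Cst + 1); have r0 : 0 < r by rewrite divr_gt0.
have [N0 hN0] := moment_small r0.
have := @cvg_ave_conv R _ g bw sg; move=> /cvgrPdist_le/(_ del del0)[N1 _ hN1].
pose N := maxn N0 N1.
have Nr := hN0 N (leq_maxl _ _); have /= := hN1 N (leq_maxr _ _).
have [A hA] := sep_bounds (se N) (sf N).
have ap := approx_moll dl0 d_ge d_le n0 L0 se sf eK sl hA Nr (ltW r0).
have apb := approx_moll dl0 d_ge d_le n0 L0 se sf eK slb hA Nr (ltW r0).
set rho := n%:R * (dL * _) in ap apb.
have rhoE : rho = Cst * r by rewrite /rho /Cst /Lg; ring.
have rho0 : 0 <= rho by rewrite rhoE mulr_ge0// ltW.
have rho_del : rho <= del.
  have : r * (Cst + 1) = del by rewrite /r divfK// gt_eqF.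
  by rewrite rhoE; lra.
set D := 3 * L * _ * _ in ap apb.
have D0 : 0 <= D.
  have := ap_fluxgrad ap (Ordinal n0) ord0 0 (lexx 0) ltr01.
  exact: le_trans (normr_ge0 _).
have init j x : mollC m e f a0 J N 0 j x = mollC m e f a0 Jb N 0 j x.
  by apply: eq_bigr => a _; rewrite set_itv1 !Rintegral_set1.
have := energy_bound eps0 eps1 Kap0 hKap rho0 D0 ap apb init (ltW t0).
pose w N x := conv N (fun x => c i (x, t) - cb i (x, t)) x.
have ew x : w N x = mollC m e f a0 J N t i x - mollC m e f a0 Jb N t i x.
  rewrite (mollC_good se eK sl N i gt) (mollC_good se eK slb N i gbt) /w.
  rewrite convD ?convN//; [exact: bst_slice (sl_c slb i)|exact: bst_slice (sl_c sl i)|].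
  by apply: bmeasN; exact: bst_slice (sl_c slb i).
set En := ave _ => EnE dist.
have bwN : bm (w N) := sm_bmeas (sm_conv N bw).
have bwN2 : bm (fun x => w N x ^+ 2) by exact: (bmeasM bwN bwN).
have w2 : ave (fun x => w N x ^+ 2) <= En.
  apply: ave_le => // [|x].
    have bC j := C1p_bm (ap_C1p ap j (ltW t0)).
    have bCb j := C1p_bm (ap_C1p apb j (ltW t0)).
    by apply: bmeas_sum => j _; exact: bmeasM (bmeasB (bC j) (bCb j)) (bmeasB (bC j) (bCb j)).
  by rewrite ew (bigD1 i)//= lerDl; apply: sumr_ge0 => j _; exact: sqr_ge0.
have wg : `|ave (fun x => w N x * g x)| <= M * (del + En / del).
  apply: (@le_trans _ _ (ave (fun x => M * del + (M / del) * w N x ^+ 2))).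
    apply: ave_norm_le; first exact: bmeasM bwN (sm_bmeas sg).
      exact: bmeasD (bmeas_cst _ _) (bmeasM (bmeas_cst _ _) bwN2).
    move=> x; rewrite normrM mulrC.
    have -> : M * del + M / del * w N x ^+ 2 = M * (del + w N x ^+ 2 / del) by ring.
    rewrite ler_pM// -lerBlDl ler_pdivlMr// -[leRHS]real_normK ?num_real//.
    have := sqr_ge0 (`|w N x| - del); have := mulr_ge0 (normr_ge0 (w N x)) (ltW del0).
    by rewrite !expr2; lra.
  rewrite aveD; [|exact: bmeas_cst|exact: bmeasM (bmeas_cst _ _) bwN2].
  rewrite (ave_cst (M * del)) aveZl// mulrDr lerD2l mulrAC -mulrA.
  by rewrite ler_wpM2l// ler_pM2r ?invr_gt0.
have En_del : En / del <= 2 * E * del.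
  rewrite ler_pdivrMr//; apply: (le_trans EnE); rewrite -/E.
  have : rho ^+ 2 <= del ^+ 2 by rewrite ler_sqr ?nnegrE// ltW.
  move=> h; have : rho ^+ 2 * E <= del ^+ 2 * E by rewrite ler_wpM2r// ltW.
  have -> : 2 * E * del * del = 2 * (del ^+ 2 * E) by ring.
  lra.
have := ler_normD (ave (fun x => (c i (x, t) - cb i (x, t)) * g x) - ave (fun x => w N x * g x))
  (ave (fun x => w N x * g x)); rewrite subrK.
have : M * (del + En / del) <= M * (del + 2 * E * del) by rewrite ler_wpM2l// lerD2l.
have -> : (M * (1 + 2 * E) + 1) * del = M * (del + 2 * E * del) + del by ring.
move: dist; rewrite -/(w N); lra.
Qed.

Lemma slices_unique i :
  {ae mu_spacetime R, forall p, cyl `]0, +oo[ p -> c i p = cb i p}.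
Proof.
pose w p := c i p - cb i p.
have bw : bst w := bmeasB (sl_c sl i) (sl_c slb i).
have bw2 : bst (fun p => w p ^+ 2) := bmeasM bw bw.
have ae_w k : {ae mu_spacetime R, forall p, (cell `*` `]0, k.+1%:R[) p -> w p = 0}.
  have mC : measurable (cell `*` `]0, k.+1%:R[%classic : set (mspacetime R)).
    by apply: measurableX => //; exact: measurable_cell.
  have fC : (mu_spacetime R (cell `*` `]0%R, k.+1%:R[%classic) < +oo)%E.
    by apply: prod_fin => //; [exact: measurable_cell|exact: cell_fin|exact: leb_itv_fin].
  apply: (Rint_sqr_eq0 mC fC bw).
  have := @Rint_prod2 _ _ _ _ R (mu_space R) leb cell `]0, k.+1%:R[%classic
    (@measurable_cell R) (measurable_itv _) (@cell_fin R) (leb_itv_fin _ _ _ _) _ bw2.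
  move=> E; apply: (etrans E).
  have bave : bmeas ((fun t => ave (fun x => w (x, t) ^+ 2)) : measurableTypeR R -> R).
    exact: bmeas_ave_slice bw2.
  have := @ae_eq_Rint _ (measurableTypeR R) R leb `]0, k.+1%:R[%classic
    (measurable_itv _) _ (cst 0) bave (bmeas_cst _ 0).
  rewrite Rintegral_cst// mul0r; apply.
  apply: ae_mono slices_ae_slice_eq => t h; rewrite /= in_itv/= => /andP[t0 _].
  have bs : bm (fun x => w (x, t) ^+ 2) := bst_slice t bw2.
  rewrite -[RHS](ave_cst 0); apply: (ae_eq_Rint (@measurable_cell R) bs (bmeas_cst _ 0)).
  by apply: ae_mono (h t0 i) => x hx cx; rewrite /w hx// expr0n.
have := ae_countable ae_w; apply: ae_mono => -[x t] h [/= cx].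
rewrite in_itv/= andbT => t0; apply/eqP; rewrite -subr_eq0; apply/eqP.
apply: (h (Num.trunc t)); split=> //=; rewrite in_itv/= t0.
exact: truncnS_gt.
Qed.

End two_solutions.
End uniqueness.

(** * Reduction to relations valid everywhere *)

Lemma ae_eq_Rint_mfun d (T : measurableType d) (R : realType)
    (mu : {measure set T -> \bar R}) (D : set T) (f g : T -> R) :
  measurable D -> measurable_fun D f -> measurable_fun D g ->
  {ae mu, forall x, D x -> f x = g x} ->
  \int[mu]_(x in D) f x = \int[mu]_(x in D) g x.
Proof.
move=> mD mf mg fg; congr fine; apply: ae_eq_integral => //.
- exact/measurable_EFinP.
- exact/measurable_EFinP.
- by apply: filterS fg => x fg Dx; rewrite fg.
Qed.

Lemma Lfun_oo_bound d (T : measurableType d) (R : realType)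
    (mu : {measure set T -> \bar R}) (f : T -> R) :
  f \in Lfun mu +oo%E ->
  measurable_fun setT f /\ exists M, {ae mu, forall x, `|f x| <= M}.
Proof.
move=> fL; split; first by have := sub_Lfun_mfun fL; rewrite inE.
have := sub_Lfun_finLfun fL; rewrite inE/= /finite_norm unlock/=.
case: ifPn => [mu0 fin|]; last first.
  rewrite -leNgt measure_le0 => /eqP mu0 _; exists 0.
  exists setT; split => //.
have [M hM] : exists M : R, (ess_sup mu (abse \o (EFin \o f)) <= M%:E)%E.
  by case: (ess_sup _ _) fin => [r _|//|_]; [exists r | exists 0; rewrite leNye].
by exists M; move/ess_supP : hM; apply: filterS => x /=; rewrite lee_fin.
Qed.

Section reduction.
Context (R : realType) (n : nat).
Notation leb := (@lebesgue_measure R).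
Notation cell := (@cell R : set (mspace3 R)).
Notation cyl0 := (cyl `]0%R, +oo[%classic : set (mspacetime R)).

(** Sums over all pairs of indices are crude, but explicit, uniform bounds of the
    coefficients D_ij and of their inverses. *)
Lemma diffusion_matrix (D : 'I_n -> 'I_n -> R) :
  (forall i j : 'I_n, i != j -> 0 < D i j /\ D i j = D j i) ->
  exists (d : 'I_n -> 'I_n -> R) (dl dL : R),
  [/\ 0 < dl, forall i j, dl <= d i j, forall i j, d i j <= dL,
      forall i j, d i j = d j i & forall i j, i != j -> d i j = (D i j)^-1].
Proof.
move=> hD; pose S := \sum_i \sum_(j | i != j) D i j.
pose S' := \sum_i \sum_(j | i != j) (D i j)^-1.
have sum_ge (F : 'I_n -> 'I_n -> R) i j : (forall i j, i != j -> 0 <= F i j) -> i != j ->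
    F i j <= \sum_i \sum_(j | i != j) F i j.
  move=> F0 ij; rewrite (bigD1 i)//= (bigD1 j)//= -addrA lerDl addr_ge0//.
    by rewrite sumr_ge0// => k /andP[ik _]; exact: F0.
  by rewrite sumr_ge0// => k _; rewrite sumr_ge0// => l kl; exact: F0.
have D0 i j : i != j -> 0 <= D i j by move=> ij; apply/ltW; have [] := hD i j ij.
have DV0 i j : i != j -> 0 <= (D i j)^-1 by move=> ij; rewrite invr_ge0 D0.
have S0 : 0 <= S by apply: sumr_ge0 => i _; apply: sumr_ge0 => j; exact: D0.
have S'0 : 0 <= S' by apply: sumr_ge0 => i _; apply: sumr_ge0 => j; exact: DV0.
have S1 : 0 < 1 + S by lra.
exists (fun i j => if i == j then (1 + S)^-1 else (D i j)^-1), (1 + S)^-1, ((1 + S)^-1 + S').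
have dl0 : 0 < (1 + S)^-1 by rewrite invr_gt0.
split=> // [i j|i j|i j|i j ij].
- case: eqVneq => // ij; have [Dp _] := hD i j ij.
  rewrite lef_pV2 ?posrE//; have := sum_ge D i j D0 ij; rewrite -/S; lra.
- case: eqVneq => [_|ij]; first by rewrite lerDl.
  by have := sum_ge _ i j DV0 ij; rewrite -/S'; lra.
- rewrite eq_sym; case: eqVneq => // ij.
  by have [_ ->] := hD i j (contra_neq (@esym _ _ _) ij).
- by rewrite (negbTE ij).
Qed.

Lemma ae_cyl_and (P Q : spacetime R -> Prop) : ae_cyl P -> ae_cyl Q ->
  ae_cyl (fun p => P p /\ Q p).
Proof.
by rewrite /ae_cyl; apply: ae_mono2 => p hP hQ cp; split; [exact: hP | exact: hQ].
Qed.

Lemma slicesW (d : 'I_n -> 'I_n -> R) L L' a0 c J : L <= L' -> slices d L a0 c J ->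
  slices d L' a0 c J.
Proof.
move=> LL' [h1 h2 h3 h4 h5 h6 h7 h8]; split=> // i k p; exact: le_trans (h5 i k p) LL'.
Qed.

Section one_solution.
Variables (D d : 'I_n -> 'I_n -> R) (c0 : 'I_n -> space3 R -> R).
Hypothesis dD : forall i j, i != j -> d i j = (D i j)^-1.
Hypothesis hc0 : initial_data c0.
Variables (c : 'I_n -> spacetime R -> R) (u : 'I_n -> spacetime R -> 'rV[R]_3).
Hypothesis sol : weak_solution D c0 c u.
Hypothesis hJ : forall i, Lqv (cyl `]0, +oo[) +oo%E (flux c u i).
Hypothesis n0 : (0 < n)%N.

Lemma measurable_cyl0 : measurable cyl0.
Proof. by apply: measurableX => //; exact: measurable_cell. Qed.

Lemma MS_component p dc : MS_system D (fun i => c i p) (fun i => flux c u i p) (fun i => dc i p) ->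
  (forall i k, dc i p 0 k = - msx d c (fun i k p => flux c u i p 0 k) i k p) /\
  forall k, \sum_i flux c u i p 0 k = 0.
Proof.
move=> [hg hs]; split=> [i k|k]; last by have := congr1 (fun v : 'rV_3 => v 0 k) hs; rewrite summxE mxE.
rewrite -hg mxE summxE /msx /ms [in RHS](bigD1 i)//= subrr mulr0 add0r; congr (- _).
apply: eq_bigr => j ji; rewrite !mxE dD//; first by rewrite eq_sym.
Qed.

Lemma flux_bound : exists2 L, 0 <= L &
  ae_cyl (fun p => forall i k, `|flux c u i p 0 k| <= L).
Proof.
have /choice[M hM] : forall z : 'I_n * 'I_3, exists M : R,
    {ae mu_spacetime R, forall p, `|((fun p => flux c u z.1 p 0 z.2) \_ (cyl `]0, +oo[)) p| <= M}.
  by move=> z; have [_] := Lfun_oo_bound (hJ z.1 z.2).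
exists (\sum_z `|M z|); first exact: sumr_ge0.
have := ae_ord (fun i => ae_ord (fun k => hM (i, k))); apply: ae_mono => p h cp i k.
have := h i k; rewrite patchE mem_set// => hz; rewrite (le_trans hz)//.
rewrite (le_trans (ler_norm _))// (bigD1 (i, k))//= lerDl; exact: sumr_ge0.
Qed.

Let a0 i g := \int[mu_space R]_(x in cell) (c0 i x * g x).

(** The initial datum is only essentially bounded; it is clipped in order to use
    the linearity of the mean on bounded functions. *)
Let a0E i : exists2 h, bm h & forall g, bm g -> a0 i g = ave (fun x => h x * g x).
Proof.
have [m0 [M hM]] := Lfun_oo_bound (init_Linfty hc0 i).
pose h x := Num.max (- M) (Num.min ((c0 i \_ cell) x) M).
have bh : bm h.
  split.
    apply: measurable_maxr; first exact: measurable_cst.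
    by apply: measurable_minr => //; exact: measurable_cst.
  exists `|M| => x; rewrite ler_norml /h le_max lerN2 ler_norm/= ge_max ge_min ler_norm orbT andbT.
  by rewrite -normrN ler_norm.
exists h => // g bg; apply: (ae_eq_Rint_mfun (@measurable_cell R)).
- apply: measurable_funM; first exact: (init_measurable hc0 i).
  by apply: measurable_funTS; case: bg.
- by apply: measurable_funTS; case: (bmeasM bh bg).
- apply: ae_mono hM => x hx cx; congr (_ * _); move: hx.
  rewrite /h patchE mem_set// ler_norml => /andP[h1 h2].
  by rewrite (min_idPl h2) (max_idPr h1).
Qed.

(** Off a null set the solution satisfies all the pointwise relations; on the
    null set, and outside the cylinder, it is replaced by the constant solution with
    the single species i0 at rest, so that the relations hold everywhere while
    the integrals in the weak formulation do not change. *)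
Lemma solution_slices : exists L (c' : 'I_n -> spacetime R -> R) J',
  [/\ 0 <= L, slices d L a0 c' J' & ae_cyl (fun p => forall i, c i p = c' i p)].
Proof.
have [L L0 hL] := flux_bound; have [dc hdc hMS] := sol_flux sol.
have aeQ : {ae mu_spacetime R, forall p, cyl `]0, +oo[ p ->
    [/\ forall i, 0 <= c i p <= 1, \sum_i c i p = 1,
        (forall i k, dc i p 0 k = - msx d c (fun i k p => flux c u i p 0 k) i k p) /\
        (forall k, \sum_i flux c u i p 0 k = 0) &
        forall i k, `|flux c u i p 0 k| <= L]}.
  have := ae_cyl_and (ae_cyl_and (sol_bounds sol) (sol_sum sol)) (ae_cyl_and hMS hL).
  apply: ae_mono => p h cp; have [[a1 a2] [b1 b2]] := h cp.
  by split=> //; exact: MS_component b1.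
have [A [mA A0 hA]] := aeQ.
have aeA : {ae mu_spacetime R, forall p, ~ A p}.
  by exists A; split=> // p /= nnA; exact: contrapT.
have good p : cyl0 p -> ~ A p ->
    [/\ forall i, 0 <= c i p <= 1, \sum_i c i p = 1,
        (forall i k, dc i p 0 k = - msx d c (fun i k p => flux c u i p 0 k) i k p) /\
        (forall k, \sum_i flux c u i p 0 k = 0) &
        forall i k, `|flux c u i p 0 k| <= L].
  by move=> cp nA; apply: contrapT => h; apply: nA; apply: hA => /(_ cp).
pose G := cyl0 `\` A.
have mG : measurable G by apply: measurableD => //; exact: measurable_cyl0.
pose i0 := Ordinal n0.
pose c' i p := \1_G p * (c i \_ cyl0) p + (1 - \1_G p) * (i == i0)%:R.
pose J' i k p := \1_G p * ((fun p => flux c u i p 0 k) \_ cyl0) p.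
have cG i p : G p -> c' i p = c i p.
  move=> Gp; rewrite /c' indicE mem_set// subrr mul0r addr0 mul1r patchE mem_set//.
  by case: Gp.
have JG i k p : G p -> J' i k p = flux c u i p 0 k.
  by move=> Gp; rewrite /J' indicE mem_set// mul1r patchE mem_set//; case: Gp.
have cNG i p : ~ G p -> c' i p = (i == i0)%:R.
  by move=> Gp; rewrite /c' indicE memNset// subr0 mul1r mul0r add0r.
have JNG i k p : ~ G p -> J' i k p = 0.
  by move=> Gp; rewrite /J' indicE memNset// mul0r.
have Ggood p : G p -> [/\ forall i, 0 <= c i p <= 1, \sum_i c i p = 1,
        (forall i k, dc i p 0 k = - msx d c (fun i k p => flux c u i p 0 k) i k p) /\
        (forall k, \sum_i flux c u i p 0 k = 0) &
        forall i k, `|flux c u i p 0 k| <= L] by case=> cp nA; exact: good.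
have bc' i : bst (c' i).
  split.
    apply: measurable_funD; apply: measurable_funM.
    - exact: measurable_indic.
    - by apply/(measurable_restrictT _ measurable_cyl0); exact: sol_measurable sol i.
    - by apply: measurable_funB; [exact: measurable_cst|exact: measurable_indic].
    - exact: measurable_cst.
  exists 1 => p; case: (pselect (G p)) => Gp.
    by rewrite cG//; have [h _ _ _] := Ggood p Gp; have /andP[? ?] := h i; rewrite ger0_norm.
  by rewrite cNG// ger0_norm// lern1; case: (_ == _).
have bJ' i k : bst (J' i k).
  split.
    apply: measurable_funM; first exact: measurable_indic.
    by have [h _] := Lfun_oo_bound (hJ i k).
  exists L => p; case: (pselect (G p)) => Gp; last by rewrite JNG// normr0.
  by rewrite JG//; have [_ _ _ ->] := Ggood p Gp.
have aec : ae_cyl (fun p => forall i, c i p = c' i p).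
  by apply: ae_mono aeA => p nA cp i; rewrite cG.
have mcyl := measurable_cyl0.
have swap i F : bst F ->
    \int[mu_spacetime R]_(p in cyl0) (c i p * F p) = \int[mu_spacetime R]_(p in cyl0) (c' i p * F p).
  move=> bF; apply: ae_eq_Rint_mfun => //.
  - apply: measurable_funM; first exact: sol_measurable sol i.
    by apply: measurable_funTS; case: bF.
  - by apply: measurable_funTS; case: (bmeasM (bc' i) bF).
  - by apply: ae_mono aec => p h cp; rewrite h.
exists L, c', J'; split=> //; split=> //.
- move=> i p; case: (pselect (G p)) => Gp; last by rewrite cNG.
  by rewrite cG//; have [h _ _ _] := Ggood p Gp; have /andP[] := h i.
- move=> p; case: (pselect (G p)) => Gp.
    by under eq_bigr do rewrite cG//; have [_ h _ _] := Ggood p Gp.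
  under eq_bigr do rewrite cNG//.
  by rewrite (bigD1 i0)//= ?eqxx big1 ?addr0// => j /negbTE ->.
- move=> i k p; case: (pselect (G p)) => Gp; last by rewrite JNG// normr0.
  by rewrite JG//; have [_ _ _ ->] := Ggood p Gp.
- move=> k p; case: (pselect (G p)) => Gp.
    by under eq_bigr do rewrite JG//; have [_ _ [_ h] _] := Ggood p Gp.
  by rewrite big1// => i _; rewrite JNG.
- move=> i k g sg.
  have bms : bst (fun p => msx d c' J' i k p).
    apply: bmeas_sum => j _; apply: bmeasM; first exact: bmeas_cst.
    by apply: bmeasB; [exact: bmeasM (bc' j) (bJ' i k) | exact: bmeasM (bc' i) (bJ' j k)].
  have := @slice_gradient R (c' i) (fun p => - msx d c' J' i k p) k g (bc' i) (bmeasN bms) sg.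
  have wg : forall a b N, 0 < a -> a < b ->
     \int[mu_spacetime R]_(p in cyl0) (c' i p * (grad k g p.1 * tbump a b N p.2)) =
     - \int[mu_spacetime R]_(p in cyl0) ((- msx d c' J' i k p) * (g p.1 * tbump a b N p.2)).
    move=> a b N a_gt0 ab; have [_ /(_ k) [locdc wg]] := hdc i.
    have bt : bst (fun p => tbump a b N p.2).
      exact: (@bmeas_snd _ _ (mspace3 R) (measurableTypeR R) R _ (bmeas_tbump a b N)).
    have bF : bst (fun p => grad k g p.1 * tbump a b N p.2).
      exact: bmeasM (bst_space (sm_bmeas (grad_sm k sg))) bt.
    have bH : bst (fun p => g p.1 * tbump a b N p.2).
      exact: bmeasM (bst_space (sm_bmeas sg)) bt.
    rewrite -(swap i _ bF).
    have := wg _ (test_open_tbump N sg a_gt0 ab).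
    rewrite (@eq_Rintegral _ _ _ (mu_spacetime R) _ (fun p => c i p * (grad k g p.1 * tbump a b
      N p.2))); last first.
      by move=> [x t] _; rewrite (dx_tensor _ _ (sm_is_derive k x sg)).
    move=> ->; congr (- _).
    (* The weak gradient is only known to be measurable locally in time; the
       test function vanishes outside [a, b]. *)
    rewrite (@eq_Rintegral _ _ _ (mu_spacetime R) _ (fun p => ((fun p => dc i p 0 k) \_ (cyl
      `[a, b])) p *
        (g p.1 * tbump a b N p.2))); last first.
      move=> [x t]; rewrite inE => -[/= cx _]; rewrite patchE.
      case: (boolP (a < t < b)) => [/andP[at_ tb]|nt].
        by rewrite mem_set//; split=> //=; rewrite in_itv/= !ltW.
      by rewrite tbump0// !mulr0.
    apply: ae_eq_Rint_mfun => //.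
    + apply: measurable_funM; last by apply: measurable_funTS; case: bH.
      apply: measurable_funTS; have := sub_Lfun_mfun (locdc a b a_gt0).
      by rewrite inE.
    + by apply: measurable_funTS; case: (bmeasM (bmeasN bms) bH).
    + apply: ae_mono aeA => -[x t] nA [/= cx t0].
      have Gp : G (x, t) by [].
      rewrite patchE; case: (boolP (a < t < b)) => [/andP[at_ tb]|nt]; last first.
        by rewrite tbump0// !mulr0.
      rewrite mem_set/=; last by split=> //=; rewrite in_itv/= !ltW.
      have [_ _ [-> _] _] := Ggood _ Gp; congr (- _ * _).
      by rewrite /msx /ms; apply: eq_bigr => j _; rewrite !cG// !JG.
  move=> /(_ wg); apply: ae_mono => t h t0; rewrite h// -aveN; last first.
    by apply: bmeasM (bst_slice t (bmeasN bms)) (sm_bmeas sg).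
  by apply: eq_ave => x; rewrite mulNr opprK.
- move=> i g sg; apply: (slice_mass (bc' i) (bJ' i) sg) => T N T0.
  have bd : bst (fun p => g p.1 * dramp T N p.2).
    apply: bmeasM (bst_space (sm_bmeas sg)) _.
    exact: (@bmeas_snd _ _ (mspace3 R) (measurableTypeR R) R _ (bmeas_dramp T N)).
  have mt : measurable_fun setT (fun p : mspacetime R => tramp T N p.2).
    apply: (measurableT_comp (f := (tramp T N : measurableTypeR R -> R))).
      exact: (continuous_measurable_fun (@continuous_tramp R T N)).
    exact: measurable_snd.
  rewrite -(swap i _ bd); apply: etrans (sol_mass sol i (test_closed_tramp T N sg)).
  congr (_ + _ + _).
  + have [h bh hE] := a0E i; have bg := sm_bmeas sg.
    rewrite hE// -(aveZr _ (bmeasM bh bg)) -[RHS]/(a0 i (fun x => g x * tramp T N 0)) hE.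
      by apply: eq_ave => x; rewrite mulrA.
    exact: bmeasM bg (bmeas_cst _ (tramp T N 0)).
  + apply: eq_Rintegral => -[x t] _.
    by rewrite (dt_tensor _ _ (is_derive_tramp T N t)).
  + have mF k : measurable_fun setT (fun p : mspacetime R => grad k g p.1 * tramp T N p.2).
      by apply: measurable_funM => //; case: (bst_space (sm_bmeas (grad_sm k sg))).
    rewrite [RHS](@eq_Rintegral _ _ _ (mu_spacetime R) _ (fun p => \sum_(k < 3)
      ((fun p => flux c u i p 0 k) \_ cyl0) p * (grad k g p.1 * tramp T N p.2))); last first.
      move=> [x t] cp; apply: eq_bigr => k _; rewrite patchE cp.
      by rewrite (dx_tensor _ _ (sm_is_derive k x sg)).
    apply: ae_eq_Rint_mfun => //.
    * apply: measurable_funTS.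
      apply: (@measurable_sum _ _ _ _ _ _ (fun k p => J' i k p * (grad k g p.1 * tramp T N p.2))).
      by move=> k; apply: measurable_funM => //; case: (bJ' i k).
    * apply: measurable_funTS.
      apply: (@measurable_sum _ _ _ _ _ _ (fun k p => ((fun p => flux c u i p 0 k) \_ cyl0) p *
        (grad k g p.1 * tramp T N p.2))).
      move=> k; apply: measurable_funM => //.
      by have [] := Lfun_oo_bound (hJ i k).
    * apply: ae_mono aeA => p nA cp; apply: eq_bigr => k _.
      by rewrite JG// patchE mem_set.
Qed.

End one_solution.
End reduction.

Theorem corollary7 (R : realType) (n : nat) (hn : (2 <= n)%N)
    (D : 'I_n -> 'I_n -> R)
    (hD : forall i j : 'I_n, i != j -> 0 < D i j /\ D i j = D j i)
    (c0 : 'I_n -> space3 R -> R) (hc0 : initial_data c0)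
    (c cbar : 'I_n -> spacetime R -> R)
    (u ubar : 'I_n -> spacetime R -> 'rV[R]_3)
    (hc : weak_solution D c0 c u)
    (hcbar : weak_solution D c0 cbar ubar)
    (hJ : forall i, Lqv (cyl `]0, +oo[) +oo%E (flux c u i))
    (hJbar : forall i, Lqv (cyl `]0, +oo[) +oo%E (flux cbar ubar i)) :
  ae_cyl (fun p => forall i, c i p = cbar i p).
Proof.
have n0 : (0 < n)%N by exact: ltnW hn.
have [d [dl [dL [dl0 d_ge d_le d_sym dD]]]] := diffusion_matrix hD.
have [L [c1 [J1 [L0 sl cc1]]]] := solution_slices dD hc0 hc hJ n0.
have [L' [c2 [J2 [L'0 sl' cc2]]]] := solution_slices dD hc0 hcbar hJbar n0.
have LL : L <= L + L' by rewrite lerDl.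
have LL' : L' <= L + L' by rewrite lerDr.
have eq12 i := slices_unique dl0 d_ge d_le d_sym n0 (addr_ge0 L0 L'0)
  (slicesW LL sl) (slicesW LL' sl') i.
apply: ae_mono2 (ae_cyl_and cc1 cc2) (ae_ord eq12) => p h h' cp i.
by have [-> ->] := h cp; exact: h'.
Qed.
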